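(* Let $\Omega\subset\mathbb{R}^n$ be a normal domain with packing constant $\delta$ and one-term Weyl function $w$. Then $\Omega$ is Dirichlet-superspectral to $w/\delta$.
   Context: A normal domain in $\mathbb{R}^n$ is a compact codimension zero submanifold of $\mathbb{R}^n$ with piecewise smooth, Lipschitz boundary. The one-term Weyl function of $\Omega$ is $w(\lambda)=\frac{\omega_n|\Omega|}{(2\pi)^n}\lambda^{n/2}$, with $|\Omega|$ the volume of $\Omega$ and $\omega_n$ the volume of the unit ball in $\mathbb{R}^n$. Let $N(\lambda)$ be the number of eigenvalues $\le\lambda$, with multiplicity, of the Dirichlet Laplacian on $\Omega$ (the Friedrichs extension of $-\sum_i\partial_i^2$ on smooth functions supported away from $\partial\Omega$). $\Omega$ is Dirichlet-superspectral to $F:[0,\infty)\to\mathbb{R}$ if $N(\lambda)\le F(\lambda)$ for all $\lambda\ge0$. Packing constant: a packing $\mathcal{P}$ of $\mathbb{R}^n$ by $\Omega$ is a collection of pairwise disjoint congruent copies of $\Omega$. For a domain $G$, set $d_{\mathrm{inn}}(\mathcal{P}|G)=\frac1{|G|}\sum_{A\in\mathcal{P},A\subset G}|A|$ and $d_{\mathrm{out}}(\mathcal{P}|G)=\frac1{|G|}\sum_{A\in\mathcal{P},A\cap G\ne\emptyset}|A|$. A gauge is a pair $(G,o)$ of a bounded domain $G$ and a point $o$. With $\lambda G$ the image of $G$ under the homothety of scale $\lambda$ fixing $o$, put $d_-(\mathcal{P},G,o)=\liminf_{\lambda\to\infty}d_{\mathrm{inn}}(\mathcal{P}|\lambda G)$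 and $d_+(\mathcal{P},G,o)=\limsup_{\lambda\to\infty}d_{\mathrm{out}}(\mathcal{P}|\lambda G)$. The packing constant $\delta$ of $\Omega$ is the supremum of $d_+(\mathcal{P},G,o)$ over all packings $\mathcal{P}$ by $\Omega$ and all gauges $(G,o)$.
   Formalization: In the packing constant, gauges (G,o) range over bounded measurable sets G with nonempty interior whose boundary has measure zero; with arbitrary bounded domains (e.g. thin open sets dense in a ball) the constant would be infinite and the claim false. *)

(* Defs.v *)
From HB Require Import structures.
From mathcomp Require Import all_boot all_order all_algebra.
From mathcomp Require Import all_classical all_reals all_analysis.

Set Implicit Arguments.
Unset Strict Implicit.
Unset Printing Implicit Defensive.
Import Order.TTheory GRing.Theory Num.Theory.
Import numFieldNormedType.Exports.

Local Open Scope classical_set_scope.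
Local Open Scope ring_scope.

(** * Lebesgue measure on ['rV[R]_n] *)

Definition rV_display : measure_display. Proof. by constructor. Qed.

Section measurable_rV.
Context {R : realType} (n : nat).

Let coord (i : 'I_n) (v : 'rV[R]_n) : measurableTypeR R := v 0 i.

Let rV_set0 : g_sigma_preimage coord set0.
Proof. exact: sigma_algebra0. Qed.

Let rV_setC A : g_sigma_preimage coord A -> g_sigma_preimage coord (~` A).
Proof. exact: sigma_algebraC. Qed.

Let rV_bigcup (F : _^nat) : (forall i, g_sigma_preimage coord (F i)) ->
  g_sigma_preimage coord (\bigcup_i (F i)).
Proof. exact: sigma_algebra_bigcup. Qed.

(* The product sigma-algebra, which is the Borel sigma-algebra of R^n. *)
HB.instance Definition _ := @isMeasurable.Build rV_display 'rV[R]_n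
  (g_sigma_preimage coord) rV_set0 rV_setC rV_bigcup.

End measurable_rV.

Section measurable_rV_theory.
Context {R : realType}.

Lemma measurable_coord n (i : 'I_n) :
  measurable_fun [set: 'rV[R]_n] (fun v => v 0 i : measurableTypeR R).
Proof.
move=> _ Y mY; rewrite setTI; apply: sub_sigma_algebra => /=.
rewrite -bigcup_seq/=; exists i => /=; first by rewrite mem_index_enum.
by exists Y => //; rewrite setTI.
Qed.

Lemma measurable_fun_rV d (T : measurableType d) n (f : T -> 'rV[R]_n) :
  (forall i, measurable_fun setT (fun x => f x 0 i : measurableTypeR R)) ->
  measurable_fun setT f.
Proof.
move=> mf.
have H : g_sigma_preimage
    (fun (i : 'I_n) (x : T) => f x 0 i : measurableTypeR R) `<=` measurable.
  apply: smallest_sub; first exact: sigma_algebra_measurable.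
  rewrite -bigcup_seq; apply: bigcup_sub => i _ A [B mB <-].
  exact: mf.
move=> _ A mA; apply: H.
rewrite (@g_sigma_preimage_comp _ _ n _
  (fun (i : 'I_n) (v : 'rV[R]_n) => v 0 i : measurableTypeR R)).
by exists A.
Qed.

Definition consrV n (p : measurableTypeR R * 'rV[R]_n) : 'rV[R]_n.+1 :=
  row_mx (p.1)%:M p.2 : 'rV[R]_(1 + n).

Lemma consrV0 n p (j : 'I_1) : @consrV n p 0 (lshift n j : 'I_(1 + n)) = p.1.
Proof.
by rewrite /consrV (@row_mxEl _ 1 1 n) ord1 mxE eqxx mulr1n.
Qed.

Lemma consrVS n p (j : 'I_n) :
  @consrV n p 0 (rshift 1 j : 'I_(1 + n)) = p.2 0 j.
Proof. by rewrite /consrV (@row_mxEr _ 1 1 n). Qed.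

Lemma measurable_consrV n : measurable_fun setT (@consrV n).
Proof.
apply: measurable_fun_rV => i; have [j ->|j ->] := @split_ordP 1 n i.
  rewrite (_ : (fun _ => _) = fst); first exact: measurable_fst.
  by apply/funext => p; exact: consrV0.
rewrite (_ : (fun _ => _) = (fun v : 'rV[R]_n => v 0 j : measurableTypeR R) \o snd).
  by apply: measurableT_comp; [exact: measurable_coord|exact: measurable_snd].
by apply/funext => p; exact: consrVS.
Qed.

Definition unconsrV n (v : 'rV[R]_n.+1) : measurableTypeR R * 'rV[R]_n :=
  (v 0 0, @rsubmx R 1 1 n v).

Lemma measurable_unconsrV n : measurable_fun setT (@unconsrV n).
Proof.
apply/measurable_fun_pairP; split; first exact: measurable_coord.
apply: measurable_fun_rV => i.
rewrite (_ : (fun _ => _) =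
  fun v : 'rV[R]_n.+1 => v 0 (rshift 1 i : 'I_(1 + n)) : measurableTypeR R).
  exact: measurable_coord.
by apply/funext => v; rewrite /= mxE.
Qed.

Lemma consrVK n : cancel (@consrV n) (@unconsrV n).
Proof.
move=> [x v]; rewrite /unconsrV; congr pair; last first.
  by rewrite /consrV (@row_mxKr _ 1 1 n).
have -> : (0 : 'I_n.+1) = lshift n (0 : 'I_1) by apply/val_inj.
exact: consrV0.
Qed.

End measurable_rV_theory.

Lemma product_sigma_finite d1 d2 (T1 : measurableType d1)
    (T2 : measurableType d2) (R : realType)
    (m1 : {sigma_finite_measure set T1 -> \bar R})
    (m2 : {sigma_finite_measure set T2 -> \bar R}) :
  sigma_finite setT (m1 \x m2)%E.
Proof.
have /sigma_finiteP[F [TF ndF Foo]] := sigma_finiteT m1.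
have /sigma_finiteP[G [TG ndG Goo]] := sigma_finiteT m2.
exists (fun n => F n `*` G n).
  rewrite -setXTT TF TG predeqE => -[x y]; split.
    move=> [/= [n _ Fnx] [k _ Gky]]; exists (maxn n k) => //; split.
    - by move: x Fnx; exact/subsetPset/ndF/leq_maxl.
    - by move: y Gky; exact/subsetPset/ndG/leq_maxr.
  by move=> [n _ []/= ? ?]; split; exists n.
move=> k; have [? ?] := Foo k; have [? ?] := Goo k.
split; first exact: measurableX.
by rewrite product_measure1E// lte_mul_pinfty// ge0_fin_numE.
Qed.

Section lebesgue_step.
Local Open Scope ereal_scope.
Context {R : realType} (n : nat).
Variable m : {sigma_finite_measure set 'rV[R]_n -> \bar R}.

Definition lebesgue_step : set 'rV[R]_n.+1 -> \bar R :=
  pushforward (@lebesgue_measure R \x m) (@consrV R n).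

Let lebesgue_step0 : lebesgue_step set0 = 0.
Proof. by rewrite /lebesgue_step /pushforward preimage_set0 measure0. Qed.

Let lebesgue_step_ge0 A : 0 <= lebesgue_step A.
Proof. exact: integral_ge0. Qed.

Let lebesgue_step_sigma_additive : semi_sigma_additive lebesgue_step.
Proof.
have mf A : measurable A -> measurable (@consrV R n @^-1` A).
  by move=> mA; rewrite -[X in measurable X]setTI; exact: measurable_consrV.
move=> F mF tF mUF; rewrite /lebesgue_step /pushforward preimage_bigcup.
apply: measure_semi_sigma_additive.
- by move=> k; exact: mf.
- apply/trivIsetP => /= i j _ _ ij; rewrite -preimage_setI.
  by move/trivIsetP : tF => /(_ _ _ _ _ ij) ->//; rewrite preimage_set0.
- by rewrite -preimage_bigcup; exact: mf.
Qed.

HB.instance Definition _ := isMeasure.Build _ _ _ lebesgue_step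
  lebesgue_step0 lebesgue_step_ge0 lebesgue_step_sigma_additive.

Let lebesgue_step_sigma_finite : sigma_finite setT lebesgue_step.
Proof.
have [F TF mF] := product_sigma_finite (@lebesgue_measure R) m.
exists (fun k => @unconsrV R n @^-1` F k).
  by rewrite -preimage_bigcup -TF preimage_setT.
move=> k; have [mFk Fk] := mF k; split.
  by rewrite -[X in measurable X]setTI; exact: measurable_unconsrV.
rewrite /lebesgue_step /pushforward -comp_preimage.
by rewrite (_ : @unconsrV R n \o _ = id)//; apply/funext => p /=; rewrite consrVK.
Qed.

HB.instance Definition _ := Measure_isSigmaFinite.Build _ _ _ lebesgue_step
  lebesgue_step_sigma_finite.

End lebesgue_step.

(* Iterated product measure; R^0 is a point of mass 1. *)
Fixpoint lebesgue_rV {R : realType} (n : nat) :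
    {sigma_finite_measure set 'rV[R]_n -> \bar R} :=
  match n with
  | 0 => dirac (0 : 'rV[R]_0)
  | k.+1 => lebesgue_step (lebesgue_rV k)
  end.

Section superspectral.
Context {R : realType} {n : nat}.
Implicit Types (x y o : 'rV[R]_n) (f g u v phi psi : 'rV[R]_n -> R).
Implicit Types (U A G Omega : set 'rV[R]_n) (P : set (set 'rV[R]_n)).

Local Notation vol := (@lebesgue_rV R n).

(** * Euclidean structure *)

Definition dot x y : R := \sum_(i < n) x 0 i * y 0 i.

(* The library norm on ['rV[R]_n] is the sup norm. *)
Definition enorm x : R := Num.sqrt (dot x x).

Definition boundary A : set 'rV[R]_n := closure A `\` interior A.

(** * Smooth functions and submanifolds *)

Definition partial (i : 'I_n) f : 'rV[R]_n -> R :=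
  fun x => 'D_(delta_mx 0 i) f x.

(* C^infinity on an open set: all iterated partial derivatives exist and are
   differentiable, hence continuous. *)
Definition smooth_on U f := forall (s : seq 'I_n) x, U x ->
  differentiable (foldr partial f s) x.

(* Embedded submanifold of codimension c, without boundary and not necessarily
   closed, as a local regular level set. *)
Definition embedded_submanifold (c : nat) (S : set 'rV[R]_n) :=
  forall p, S p -> exists U (F : 'I_c -> 'rV[R]_n -> R),
    [/\ open U, U p, (forall j, smooth_on U (F j)),
        row_free (\matrix_(j < c, i < n) partial i (F j) p)
      & forall x, U x -> (S x <-> forall j, F j x = 0)].

(** * Normal domains *)

(* The boundary is partitioned into finitely many connected smooth pieces. *)
Definition piecewise_smooth_boundary Omega :=
  exists (m : nat) (c : 'I_m -> nat) (S : 'I_m -> set 'rV[R]_n),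
    [/\ forall k, [/\ (0 < c k)%N, connected (S k)
                    & embedded_submanifold (c k) (S k)],
        trivIset setT S & boundary Omega = \bigcup_k S k].

(* Near each boundary point, Omega is the closed region under the graph, in the
   direction e, of a Lipschitz function on the hyperplane orthogonal to e; that
   function is encoded as gamma, constant along e. In particular Omega is a
   codimension zero topological submanifold with boundary. *)
Definition lipschitz_boundary Omega := forall p, boundary Omega p ->
  exists (e : 'rV[R]_n) (gamma : 'rV[R]_n -> R),
    [/\ enorm e = 1,
        (forall x (t : R), gamma (x + t *: e) = gamma x),
        [lipschitz gamma x | x in [set: 'rV[R]_n]]
      & \forall x \near p, Omega x <-> dot x e <= gamma x].

Definition normal_domain Omega :=
  [/\ compact Omega, piecewise_smooth_boundary Omega
    & lipschitz_boundary Omega].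

(** * The Dirichlet Laplacian *)

(* Functions on Omega with support in Omega minus its boundary, extended by
   zero. *)
Definition test_function Omega phi :=
  smooth_on setT phi /\ closure [set x | phi x != 0] `<=` interior Omega.

Definition laplacian f : 'rV[R]_n -> R :=
  fun x => \sum_(i < n) partial i (partial i f) x.

Definition L2 Omega u :=
  measurable_fun Omega u /\ vol.-integrable Omega (fun x => (u x ^+ 2)%:E).

Definition inner Omega u v : R := \int[vol]_(x in Omega) (u x * v x).

(* The quadratic form of the minus Laplacian on test functions. *)
Definition form Omega phi : R := inner Omega (\- laplacian phi) phi.

(* L^2 limits of form-Cauchy sequences of test functions: the domain of the
   closure of the form. *)
Definition form_domain Omega u := L2 Omega u /\
  exists phi : nat -> 'rV[R]_n -> R,
    [/\ forall k, test_function Omega (phi k),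
        inner Omega (phi k \- u) (phi k \- u) @[k --> \oo] --> (0 : R)
      & forall eps : R, 0 < eps -> exists N : nat, forall j k,
          (N <= j)%N -> (N <= k)%N -> form Omega (phi j \- phi k) < eps].

(* Graph of the Friedrichs extension of the minus Laplacian on test functions:
   its adjoint, restricted to the domain of the closed form. *)
Definition dirichlet_laplacian Omega u f :=
  [/\ form_domain Omega u, L2 Omega f
    & forall psi, test_function Omega psi ->
        inner Omega u (\- laplacian psi) = inner Omega f psi].

Definition L2_independent Omega (k : nat) (u : 'I_k -> 'rV[R]_n -> R) :=
  forall c : 'I_k -> R,
    {ae vol, forall x, Omega x -> \sum_(i < k) c i * u i x = 0} ->
    forall i, c i = 0.

(* Dimension of the eigenspace for mu; 0 when mu is not an eigenvalue. *)
Definition multiplicity Omega (mu : R) : \bar R :=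
  ereal_sup [set (k%:R)%:E | k in [set k : nat |
    exists u : 'I_k -> 'rV[R]_n -> R,
      (forall i, dirichlet_laplacian Omega (u i) (fun x => mu * u i x)) /\
      L2_independent Omega u]].

Definition eigenvalue_count Omega (lambda : R) : \bar R :=
  \esum_(mu in [set mu : R | mu <= lambda]) multiplicity Omega mu.

Definition dirichlet_superspectral Omega (F : R -> R) :=
  forall lambda : R, 0 <= lambda ->
    (eigenvalue_count Omega lambda <= (F lambda)%:E)%E.

Definition weyl_function Omega (lambda : R) : R :=
  fine (vol [set x | enorm x <= 1]) * fine (vol Omega) / (2 * pi) ^+ n
  * lambda `^ (n%:R / 2).

(** * The packing constant *)

Definition congruent Omega A := exists f : 'rV[R]_n -> 'rV[R]_n,
  (forall x y, enorm (f x - f y) = enorm (x - y)) /\ A = f @` Omega.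

Definition packing Omega P :=
  (forall A, P A -> congruent Omega A) /\ trivIset P id.

Definition homothety o (lambda : R) G : set 'rV[R]_n :=
  [set o + lambda *: (x - o) | x in G].

Definition outer_density P G : \bar R :=
  ((fine (vol G))^-1%:E *
     \esum_(A in [set A | P A /\ A `&` G !=set0]) vol A)%E.

(* Bounded domains, not required to be open, closed or connected. The boundary
   has to be negligible: otherwise outer densities can be arbitrarily large,
   since a domain of small volume can be dense in a ball. *)
Definition gauge_domain G :=
  [/\ measurable G, bounded_set G, interior G !=set0 & vol (boundary G) = 0%E].

Definition upper_density P G o : \bar R :=
  limf_esup (fun lambda : R => outer_density P (homothety o lambda G))
            (+oo : set_system R).

Definition packing_constant Omega : \bar R :=
  ereal_sup [set upper_density q.1.1 q.1.2 q.2 | q in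
    [set q : set (set 'rV[R]_n) * set 'rV[R]_n * 'rV[R]_n |
       packing Omega q.1.1 /\ gauge_domain q.1.2]].

End superspectral.

(* Main.v *)
(* Pólya's argument for tiling domains, run with packings. Eigenfunctions with
   eigenvalues at most lambda are approximated by K test functions on whose span
   the Dirichlet form is below (lambda + t) times the squared L^2 norm. Copying
   them to N disjoint congruent copies of Omega inside a cube of side l gives
   K N such functions on the cube, where the count of eigenvalues of a cube
   bounds K N by the one-term Weyl function of the cube. A packing of density d
   covers a gauge with about d / |Omega| copies per unit volume, so cutting space
   into large cubes yields K d <= w(lambda + t), and t tends to 0.

   The bound on a cube avoids spectral theory there: the test functions are
   sampled on a fine grid, on which the discrete Dirichlet Laplacian is
   diagonalized by discrete sines. *)
Require Import Defs.
From HB Require Import structures.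
From mathcomp Require Import all_boot all_order all_algebra.
From mathcomp Require Import all_classical all_reals all_analysis.
From mathcomp Require Import measurable_realfun.
From mathcomp Require Import ring lra zify.
Set Implicit Arguments.
Unset Strict Implicit.
Unset Printing Implicit Defensive.
Import Order.TTheory GRing.Theory Num.Theory.
Import numFieldNormedType.Exports.
Local Open Scope classical_set_scope.
Local Open Scope ring_scope.

(** * Lebesgue measure of boxes and dyadic cells *)

(** One property is carried through the proof: [posdef] for the matrix [lam * ip (v i) (v j) - ip (v
    i) (\- laplacian (v j))]. Being strict, it is an open condition on finitely many entries, so it
    survives both passages to a limit: from eigenfunctions to test functions, and from test
    functions to samples on a fine grid. The gap between lambda and lambda + t pays for this
    strictness. The cube can replace a tile because its Weyl bound has no remainder: each frequency
    vector with positive integer entries accounts for [2 ^+ n] unit cells inside a ball. Grid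
    eigenvalues lie below their continuous counterparts, so this bound is not inherited mode by
    mode; it holds for fine meshes because finitely many modes are at stake. The grid also replaces
    integration by parts: symmetry and nonnegativity of the Dirichlet form are limits of the same
    facts for finite sums. Since [fine] sends infinity to 0 and division by 0 gives 0, the packing
    constant must be shown finite and positive before it can be divided by. *)

Section row_norm.
Context {R : realType} {n : nat}.
Implicit Types x y : 'rV[R]_n.

Lemma coord_le_norm x i : `|x 0 i| <= `|x|.
Proof.
rewrite [leRHS]/Num.norm/= mx_normrE.
exact: (le_bigmax _ (fun ij : 'I_1 * 'I_n => `|x ij.1 ij.2|) (0, i)).
Qed.

Lemma norm_le_coord x (r : R) :
  0 <= r -> (forall i, `|x 0 i| <= r) -> `|x| <= r.
Proof.
move=> r0 xr; rewrite [leLHS]/Num.norm/= mx_normrE.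
by apply/bigmax_leP; split=> // -[i j] _; rewrite (ord1 i) xr.
Qed.

Lemma norm_lt_coord x (r : R) :
  0 < r -> (forall i, `|x 0 i| < r) -> `|x| < r.
Proof.
move=> r0 xr; rewrite [ltLHS]/Num.norm/= mx_normrE.
by apply/bigmax_ltP; split=> // -[i j] _; rewrite (ord1 i) xr.
Qed.

End row_norm.

Section boxes.
Context {R : realType} {n : nat}.

Definition rect (A : 'I_n -> set R) : set 'rV[R]_n :=
  [set x | forall i, A i (x 0 i)].

Lemma measurable_rect (A : 'I_n -> set (measurableTypeR R)) :
  (forall i, measurable (A i)) -> measurable (rect A).
Proof.
move=> mA.
have -> : rect A = \bigcap_(i in [set: 'I_n])
    [set x : 'rV[R]_n | A i (x 0 i : measurableTypeR R)].
  by apply/seteqP; split => x /=; [move=> h i _; exact: h|move=> h i; exact: h].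
apply: fin_bigcap_measurable => //= i _.
have := @measurable_coord R n i measurableT (A i) (mA i).
by rewrite setTI.
Qed.

End boxes.

Lemma vol_rect {R : realType} n (A : 'I_n -> set (measurableTypeR R))
    (a : 'I_n -> R) :
  (forall i, measurable (A i)) ->
  (forall i, @lebesgue_measure R (A i) = (a i)%:E) ->
  @lebesgue_rV R n (rect A) = (\prod_(i < n) a i)%:E.
Proof.
elim: n A a => [|n IH] A a mA Aa.
  rewrite big_ord0 /= diracE mem_set// => i; by case: i.
rewrite big_ord_recl /= /lebesgue_step /pushforward.
have -> : @consrV R n @^-1` rect A = A ord0 `*` rect (fun i => A (lift ord0 i)).
  apply/seteqP; split => [[x v] /= h|[x v] /= [h0 h] i].
    split => [|i].
      have := h ord0; have -> : (ord0 : 'I_n.+1) = lshift n (0 : 'I_1).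
        exact/val_inj.
      by rewrite consrV0.
    have := h (lift ord0 i); have e : lift ord0 i = rshift 1 i by exact/val_inj.
    by rewrite {2}e consrVS.
  case: (unliftP ord0 i) => [j ->|->].
    have e : lift ord0 j = rshift 1 j by exact/val_inj.
    by rewrite {2}e consrVS; exact: h.
  have {2}-> : (ord0 : 'I_n.+1) = lshift n (0 : 'I_1) by exact/val_inj.
  by rewrite consrV0.
rewrite product_measure1E//; last first.
  by apply: measurable_rect => i; exact: mA.
by rewrite EFinM; congr (_ * _)%E; [exact: Aa|exact: IH].
Qed.

(** * Dyadic cells, a countable family that determines measures *)

Section cells.
Context {R : realType} {n : nat}.
Implicit Types (x : 'rV[R]_n) (z : {ffun 'I_n -> int}) (e : R).
Local Notation vol := (@lebesgue_rV R n).

(** Half-open on the right, so that the cells of one size partition space and [Num.floor] finds the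
    cell of a point. *)
Definition cell e z : set 'rV[R]_n :=
  [set x | forall i, (z i)%:~R * e <= x 0 i < ((z i)%:~R + 1) * e].

Definition cell_index e x : {ffun 'I_n -> int} :=
  [ffun i => Num.floor (x 0 i / e)].

Lemma cellP e z x : 0 < e -> cell e z x <-> cell_index e x = z.
Proof.
move=> e0; split.
  move=> h; apply/ffunP => i; rewrite ffunE; apply: floor_def.
  by rewrite ler_pdivlMr// ltr_pdivrMr// intrD.
move=> <- i; rewrite ffunE.
have := floor_itv (x 0 i / e); rewrite intrD ler_pdivlMr// ltr_pdivrMr//.
Qed.

Lemma cell_index_in e x : 0 < e -> cell e (cell_index e x) x.
Proof. by move=> e0; apply/cellP. Qed.

Lemma cell_rect e z :
  cell e z = rect (fun i => `[(z i)%:~R * e, ((z i)%:~R + 1) * e[%classic).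
Proof.
by apply/seteqP; split => x h i; have := h i; rewrite /= in_itv.
Qed.

Lemma measurable_cell e z : measurable (cell e z).
Proof. rewrite cell_rect; apply: measurable_rect => i; exact: measurable_itv. Qed.

Lemma vol_cell e z : 0 < e -> vol (cell e z) = (e ^+ n)%:E.
Proof.
move=> e0; rewrite cell_rect (@vol_rect _ _ _ (fun=> e)).
- by rewrite prodr_const card_ord.
- by move=> i; exact: measurable_itv.
- move=> i; rewrite lebesgue_measure_itv/= lte_fin ltr_pM2r// ltrDl ltr01.
  by rewrite -EFinB mulrDl mul1r addrAC subrr add0r.
Qed.

Lemma cell_dist e z x y : 0 < e -> cell e z x -> cell e z y -> `|x - y| < e.
Proof.
move=> e0 zx zy; apply: norm_lt_coord => // i; rewrite !mxE.
have /andP[x1 x2] := zx i; have /andP[y1 y2] := zy i.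
by rewrite ltr_norml; apply/andP; split; nra.
Qed.

Definition dyadic k : R := 2^-1 ^+ k.

Lemma dyadic_gt0 k : 0 < dyadic k.
Proof. by rewrite exprn_gt0// invr_gt0. Qed.

Lemma dyadicS k : dyadic k = 2 * dyadic k.+1.
Proof. by rewrite /dyadic exprS mulrA divff ?mul1r. Qed.

Lemma dyadic_small (r : R) : 0 < r -> exists k, dyadic k < r.
Proof.
move=> r0; have /cvgrPdist_lt/(_ _ r0)[k _ /(_ k (leqnn k))] :
    geometric 1 (2^-1 : R) x @[x --> \oo] --> (0 : R).
  apply: cvg_geometric; rewrite ger0_norm ?invr_ge0//; lra.
rewrite /= sub0r normrN mul1r ger0_norm ?exprn_ge0 ?invr_ge0// => h.
by exists k.
Qed.

(** The floor at the coarse scale is determined by the floor at the fine one, since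
    [m <= floor (u / (2 * e))] amounts to [m * 2 <= floor (u / e)]. *)
Lemma cell_index_half e x y : 0 < e ->
  cell_index e x = cell_index e y -> cell_index (2 * e) x = cell_index (2 * e) y.
Proof.
move=> e0 /ffunP h; apply/ffunP => i; have := h i; rewrite !ffunE => hi.
have H m (u : R) : (m <= Num.floor (u / (2 * e))) = (m * 2 <= Num.floor (u / e)).
  rewrite !floor_ge_int !ler_pdivlMr ?mulr_gt0//.
  by rewrite intrM mulrA.
by apply/eqP; rewrite eq_le !H -hi -H lexx hi -H lexx.
Qed.

Lemma cell_index_dyadic k j x y :
  cell_index (dyadic (k + j)) x = cell_index (dyadic (k + j)) y ->
  cell_index (dyadic k) x = cell_index (dyadic k) y.
Proof.
elim: j => [|j IH]; first by rewrite addn0.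
rewrite addnS => h; apply: IH; rewrite (dyadicS (k + j)).
by apply: cell_index_half => //; exact: dyadic_gt0.
Qed.

(** A cell smaller than a ball around the point fits into the ball. The index type is countable,
    which is what makes open sets measurable. *)
Lemma open_bigcup_cell (U : set 'rV[R]_n) : open U ->
  U = \bigcup_(p in [set p : nat * {ffun 'I_n -> int} |
                     cell (dyadic p.1) p.2 `<=` U]) cell (dyadic p.1) p.2.
Proof.
move=> oU; apply/seteqP; split => [x Ux|x [p /= pU px]]; last exact: pU.
have /nbhs_ballP[r /= r0 rU] : nbhs x U by exact: open_nbhs_nbhs.
have [k kr] := dyadic_small r0.
exists (k, cell_index (dyadic k) x) => /=; last first.
  exact/cell_index_in/dyadic_gt0.
move=> y hy; apply: rU; rewrite mx_norm_ball /ball_/=.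
apply: lt_trans kr; apply: cell_dist hy => //; first exact: dyadic_gt0.
exact/cell_index_in/dyadic_gt0.
Qed.

Lemma measurable_open (U : set 'rV[R]_n) : open U -> measurable U.
Proof.
move=> /open_bigcup_cell ->; rewrite bigcup_mkcond.
apply: countable_bigcupT_measurable => [|p]; first exact: countableP.
by case: ifP => _; [exact: measurable_cell|exact: measurable0].
Qed.

Lemma measurable_closed (U : set 'rV[R]_n) : closed U -> measurable U.
Proof.
move=> cU; rewrite -(setCK U); apply: measurableC; apply: measurable_open.
exact: closed_openC.
Qed.

Definition dyadic_cells : set (set 'rV[R]_n) :=
  [set A | A = set0 \/ exists k z, A = cell (dyadic k) z].

(** Two dyadic cells are nested or disjoint, so adding the empty set is enough to obtain a family
    closed under intersection. *)
Lemma dyadic_cellsI : setI_closed dyadic_cells.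
Proof.
move=> A B [->|[k [z ->]]]; first by rewrite set0I; left.
move=> [->|[l [w ->]]]; first by rewrite setI0; left.
wlog kl : k l z w / (k <= l)%N => [H|].
  have [/H//|/ltnW/H] := leqP k l; by rewrite setIC.
have [->|/set0P[x [xz xw]]] := eqVneq (cell (dyadic k) z `&` cell (dyadic l) w) set0.
  by left.
right; exists l, w; apply/seteqP; split => [y []//|y yw]; split=> //.
apply/cellP; first exact: dyadic_gt0.
move/cellP: xz => <-; last exact: dyadic_gt0.
move: (kl) => /subnKC kj; apply: (@cell_index_dyadic k (l - k)); rewrite kj.
move/cellP: xw => ->; last exact: dyadic_gt0.
by move/cellP: yw => ->//; exact: dyadic_gt0.
Qed.

(** Coordinates are continuous, so preimages of open intervals are open, hence countable unions of
    cells. *)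
Lemma sigma_dyadic_cells : @measurable _ 'rV[R]_n = <<s dyadic_cells >>.
Proof.
have H : dyadic_cells `<=` (@measurable _ 'rV[R]_n).
  by move=> A [->|[k [z ->]]]; [exact: measurable0|exact: measurable_cell].
apply/seteqP; split; last first.
  by apply: smallest_sub => //; exact: sigma_algebra_measurable.
have openD (U : set 'rV[R]_n) : open U -> <<s dyadic_cells >> U.
  move=> /open_bigcup_cell ->.
  rewrite -[<<s _ >> _]/((@measurable _ (g_sigma_algebraType dyadic_cells)) _).
  rewrite bigcup_mkcond; apply: countable_bigcupT_measurable => [|p].
    exact: countableP.
  case: ifP => _; last exact: measurable0.
  by apply: sub_sigma_algebra; right; exists p.1, p.2.
apply: smallest_sub; first exact: smallest_sigma_algebra.
rewrite -bigcup_seq; apply: bigcup_sub => i _ A [B mB <-].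
rewrite setTI.
have mf : @measurable_fun _ _ (g_sigma_algebraType dyadic_cells) (measurableTypeR R)
    setT (fun v : 'rV[R]_n => v 0 i).
  apply: (measurability _ (RGenOpens.measurableE R)) => _ [_ [a [b ->]] <-].
  rewrite setTI; apply: openD; apply: open_comp; last exact: interval_open.
  by move=> v _; exact: coord_continuous.
by have := mf measurableT B mB; rewrite setTI.
Qed.

Lemma measure_cells_unique (m1 m2 : {measure set 'rV[R]_n -> \bar R}) :
  (forall k z, m1 (cell (dyadic k) z) = m2 (cell (dyadic k) z)) ->
  (forall z, m1 (cell 1 z) < +oo)%E ->
  forall A, measurable A -> m1 A = m2 A.
Proof.
move=> m12 m1oo.
(* An enumeration of the unit cells, which exhaust space by sets of finite measure; codes that
   decode to nothing give the empty set. *)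
pose g k := if @unpickle {ffun 'I_n -> int} k is Some z then cell 1 z else set0.
have d0 : dyadic 0 = 1 by rewrite /dyadic expr0.
apply: (@measure_unique _ _ _ dyadic_cells g sigma_dyadic_cells dyadic_cellsI).
- move=> k; rewrite /g; case: unpickle => [z|]; last by left.
  by right; exists 0%N, z; rewrite d0.
- apply/seteqP; split=> // x _; exists (pickle (cell_index 1 x)) => //.
  by rewrite /g pickleK; exact: cell_index_in.
- move=> A [->|[k [z ->]]]; first by rewrite !measure0.
  exact: m12.
- move=> k; rewrite /g; case: unpickle => [z|] //.
  by rewrite measure0.
Qed.

End cells.

(** * Measures of affine and isometric images *)

(* Stated over an abstract domain: on matrices, [nbhs] is unfolded eagerly and
   the filter instance is lost. *)
Section continuity.
Context {R : realType} {T : topologicalType} {V : normedModType R}.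

Lemma contD (f g : T -> V) :
  continuous f -> continuous g -> continuous (fun x => f x + g x).
Proof. by move=> cf cg x; apply: cvgD; [exact: cf|exact: cg]. Qed.

Lemma contZ (f : T -> R) (g : T -> V) :
  continuous f -> continuous g -> continuous (fun x => f x *: g x).
Proof. by move=> cf cg x; apply: cvgZ; [exact: cf|exact: cg]. Qed.

Lemma contN (f : T -> V) : continuous f -> continuous (fun x => - f x).
Proof. by move=> cf x; apply: cvgN; exact: cf. Qed.

Lemma contM (f g : T -> R) :
  continuous f -> continuous g -> continuous (fun x => f x * g x).
Proof. by move=> cf cg x; apply: cvgM; [exact: cf|exact: cg]. Qed.

Lemma cont_cst (v : V) : continuous (fun _ : T => v).
Proof. by move=> x; exact: cvg_cst. Qed.

Lemma cont_sum (I : Type) (r : seq I) (f : I -> T -> V) :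
  (forall i, continuous (f i)) -> continuous (fun x => \sum_(i <- r) f i x).
Proof.
move=> cf; elim: r => [|i r IH].
  under eq_fun do rewrite big_nil; exact: cont_cst.
under eq_fun do rewrite big_cons; exact: contD.
Qed.

End continuity.

Section measurability.
Context {R : realType} {n : nat}.

Lemma continuous_measurable_rV (f : 'rV[R]_n -> R) :
  continuous f -> measurable_fun [set: 'rV[R]_n] f.
Proof.
move=> cf; apply: (measurability _ (RGenOpens.measurableE R)).
move=> _ [_ [a [b ->]] <-]; rewrite setTI; apply: measurable_open.
by apply: open_comp; [move=> ? _; exact: cf|exact: interval_open].
Qed.

Lemma continuous_measurable_rV_rV m (f : 'rV[R]_n -> 'rV[R]_m) :
  continuous f -> measurable_fun setT f.
Proof.
move=> cf; apply: measurable_fun_rV => i.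
apply: (@continuous_measurable_rV (fun x => f x 0 i)) => x.
apply: (@continuous_comp _ _ _ f (fun v : 'rV_m => v 0 i)); first exact: cf.
exact: coord_continuous.
Qed.

End measurability.

Section change_of_variables.
Context {R : realType} {n : nat}.
Local Notation vol := (@lebesgue_rV R n).

(** Reduces a change of variables to the effect of [g] on dyadic cells: the pushforward of [vol] and
    its multiple by [c] agree there, hence everywhere. *)
Lemma vol_preimage_cells (g : 'rV[R]_n -> 'rV[R]_n) (c : R) :
  measurable_fun setT g -> 0 <= c ->
  (forall k z, vol (g @^-1` cell (dyadic k) z) = (c * dyadic k ^+ n)%:E) ->
  forall A, measurable A -> vol (g @^-1` A) = (c%:E * vol A)%E.
Proof.
move=> mg c0 H A mA.
pose m1 : {measure set 'rV[R]_n -> \bar R} :=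
  measure_function_pushforward__canonical__measure_function_Measure vol mg.
pose m2 : {measure set 'rV[R]_n -> \bar R} := mscale (NngNum c0) vol.
apply: (@measure_cells_unique _ _ m1 m2) => // [k z|z].
  by rewrite /m1 /m2 /= /pushforward /mscale /= H vol_cell ?dyadic_gt0.
have -> : (1 : R) = dyadic 0 by rewrite /dyadic expr0.
by rewrite /m1 /= /pushforward H ltry.
Qed.

Lemma affine_continuous (s : R) (b : 'rV[R]_n) :
  continuous (fun x : 'rV[R]_n => s *: x + b).
Proof.
apply: contD; last exact: cont_cst.
by apply: contZ; [exact: cont_cst|move=> x; exact: cvg_id].
Qed.

Lemma vol_affine (s : R) (b : 'rV[R]_n) (A : set 'rV[R]_n) :
  0 < s -> measurable A ->
  vol [set x | A (s *: x + b)] = ((s^-1 ^+ n)%:E * vol A)%E.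
Proof.
move=> s0; apply: vol_preimage_cells.
- by apply: continuous_measurable_rV_rV; exact: affine_continuous.
- by rewrite exprn_ge0// invr_ge0 ltW.
- move=> k z; set e := dyadic k.
  rewrite [X in vol X](_ : _ = rect (fun i =>
    `[((z i)%:~R * e - b 0 i) / s, (((z i)%:~R + 1) * e - b 0 i) / s[%classic)); last first.
  apply/seteqP; split => x h i; have := h i; rewrite /= in_itv/= !mxE.
        by rewrite ler_pdivrMr// ltr_pdivlMr// lerBlDr ltrBrDr [x 0 i * s]mulrC.
      by rewrite ler_pdivrMr// ltr_pdivlMr// lerBlDr ltrBrDr [x 0 i * s]mulrC.
  rewrite (@vol_rect _ _ _ (fun=> e / s)).
  + by rewrite prodr_const card_ord exprMn mulrC.
  + by move=> i; exact: measurable_itv.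
  + have e0 : 0 < e by exact: dyadic_gt0.
    move=> i; rewrite lebesgue_measure_itv/= lte_fin ltr_pM2r ?invr_gt0//.
    rewrite ltrD2r ltr_pM2r// ltrDl ltr01 -EFinB; congr (_%:E).
    by rewrite -mulrBl; congr (_ / _); ring.
Qed.

Lemma measurable_affine (s : R) (b : 'rV[R]_n) (A : set 'rV[R]_n) :
  measurable A -> measurable [set x | A (s *: x + b)].
Proof.
move=> mA.
have := continuous_measurable_rV_rV (@affine_continuous s b) measurableT mA.
by rewrite setTI.
Qed.

Lemma vol_box_le (A : set 'rV[R]_n) (a : 'rV[R]_n) (r : R) : measurable A -> 0 <= r ->
  (forall x, A x -> forall i, a 0 i <= x 0 i <= a 0 i + r) -> (vol A <= (r ^+ n)%:E)%E.
Proof.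
move=> mA r0 Ar.
have mr : forall i, measurable (`[a 0 i, a 0 i + r]%classic : set (measurableTypeR R)).
  by move=> i; exact: measurable_itv.
apply: (@le_trans _ _ (vol (rect (fun i => `[a 0 i, a 0 i + r]%classic)))).
  by apply: le_measure; rewrite ?inE//; exact: measurable_rect.
rewrite (@vol_rect _ _ _ (fun=> r)); [by rewrite prodr_const card_ord| by []| move=> i].
rewrite lebesgue_measure_itv/= lte_fin; case: ltP => [h|h].
  by rewrite -EFinB addrAC subrr add0r.
by congr (_%:E); lra.
Qed.

Lemma vol_bounded (A : set 'rV[R]_n) : measurable A -> bounded_set A ->
  (vol A < +oo)%E.
Proof.
move=> mA [M [_ /(_ (`|M| + 1))]]; rewrite (le_lt_trans (ler_norm M)) ?ltrDl//.
move=> /(_ isT) AM; apply: (@le_lt_trans _ _ (((`|M| + 1) *+ 2) ^+ n)%:E).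
  apply: (@vol_box_le _ (const_mx (- (`|M| + 1)))) => // x /AM xM i.
  have := coord_le_norm x i.
  move=> /le_trans/(_ xM); rewrite ler_norml mxE => /andP[h1 h2].
  by rewrite h1 mulr2n addKr.
exact: ltry.
Qed.

Lemma vol_open_gt0 (U : set 'rV[R]_n) : open U -> U !=set0 -> (0 < vol U)%E.
Proof.
move=> oU [x Ux]; have := Ux; rewrite {1}(open_bigcup_cell oU) => -[p /= pU px].
apply: (@lt_le_trans _ _ (vol (cell (dyadic p.1) p.2))).
  by rewrite vol_cell ?dyadic_gt0// lte_fin exprn_gt0// dyadic_gt0.
apply: le_measure; rewrite ?inE//; first exact: measurable_cell.
exact: measurable_open.
Qed.

End change_of_variables.

Section euclidean.
Context {R : realType} {n : nat}.
Implicit Types x y z : 'rV[R]_n.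
Local Notation vol := (@lebesgue_rV R n).

Lemma dotE x y : dot x y = (x *m y^T) 0 0.
Proof. by rewrite mxE; apply: eq_bigr => i _; rewrite mxE. Qed.

Lemma dotC x y : dot x y = dot y x.
Proof. by apply: eq_bigr => i _; rewrite mulrC. Qed.

Lemma dotDl x y z : dot (x + y) z = dot x z + dot y z.
Proof. by rewrite !dotE mulmxDl mxE. Qed.

Lemma dotZl (a : R) x z : dot (a *: x) z = a * dot x z.
Proof. by rewrite !dotE -scalemxAl mxE. Qed.

Lemma dotBl x y z : dot (x - y) z = dot x z - dot y z.
Proof. by rewrite dotDl -scaleN1r dotZl mulN1r. Qed.

Lemma dotBr x y z : dot z (x - y) = dot z x - dot z y.
Proof. by rewrite !(dotC z) dotBl. Qed.

Lemma dot_suml (I : finType) (F : I -> 'rV[R]_n) z :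
  dot (\sum_i F i) z = \sum_i dot (F i) z.
Proof. by rewrite dotE mulmx_suml summxE; apply: eq_bigr => i _; rewrite dotE. Qed.

Lemma dot_ge0 x : 0 <= dot x x.
Proof. by apply: sumr_ge0 => i _; rewrite -expr2 sqr_ge0. Qed.

Lemma dot_eq0 x : dot x x = 0 -> x = 0.
Proof.
move=> /eqP; rewrite psumr_eq0 => [/allP h|i _]; last by rewrite -expr2 sqr_ge0.
apply/rowP => i; rewrite mxE; have := h i (mem_index_enum _).
by rewrite mulf_eq0 orbb => /eqP.
Qed.

Lemma enorm_eq x y : (enorm x = enorm y) <-> dot x x = dot y y.
Proof.
split=> [h|h]; last by rewrite /enorm h.
by rewrite -(sqr_sqrtr (dot_ge0 x)) -/(enorm x) h sqr_sqrtr// dot_ge0.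
Qed.

Lemma coord_le_enorm x i : `|x 0 i| <= enorm x.
Proof.
rewrite /enorm -sqrtr_sqr ler_wsqrtr// /dot (bigD1 i)//= expr2 lerDl.
by apply: sumr_ge0 => j _; rewrite -expr2 sqr_ge0.
Qed.

(** Polarization shows that [g x = f x - f 0] preserves [dot]. The defect [w] between [g x] and the
    combination of the images of the basis vectors is orthogonal to every [g y]; being itself a
    combination of such values, it is orthogonal to itself. *)
Lemma isometry_affine (f : 'rV[R]_n -> 'rV[R]_n) :
  (forall x y, enorm (f x - f y) = enorm (x - y)) ->
  exists (a : 'rV[R]_n) (O : 'M[R]_n), O *m O^T = 1%:M /\ forall x, f x = x *m O + a.
Proof.
move=> fi; have [g gE] : exists g, forall x, g x = f x - f 0 by eexists.
have gg x y : dot (g x) (g y) = dot x y.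
  have h u v : dot (f u - f v) (f u - f v) = dot (u - v) (u - v).
    by apply/enorm_eq.
  have := h x y; have -> : f x - f y = g x - g y.
    by rewrite !gE opprB addrA subrK.
  have := h x 0; have := h y 0; rewrite !subr0 -!gE.
  rewrite !(dotBl, dotBr) (dotC (g y) (g x)) (dotC y x); lra.
have gl x : g x = \sum_i x 0 i *: g (delta_mx 0 i).
  apply/eqP; rewrite -subr_eq0; apply/eqP; set w := _ - _.
  have wg y : dot w (g y) = 0.
    rewrite /w dotBl dot_suml gg.
    under eq_bigr do rewrite dotZl gg.
    rewrite [X in dot X y](row_sum_delta x) dot_suml.
    by under [X in X - _]eq_bigr do rewrite dotZl; rewrite subrr.
  apply: dot_eq0; rewrite {2}/w dotBr wg dotC dot_suml big1 ?subrr// => i _.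
  by rewrite dotZl dotC wg mulr0.
exists (f 0), (\matrix_i g (delta_mx 0 i)); split; last first.
  move=> x; rewrite -[LHS](subrK (f 0)) -gE gl mulmx_sum_row.
  by congr (_ + _); apply: eq_bigr => i _; rewrite rowK.
apply/matrixP => i j; have := gg (delta_mx 0 i) (delta_mx 0 j).
rewrite dotE !mxE => h.
transitivity (dot (g (delta_mx 0 i)) (g (delta_mx 0 j))).
  by rewrite dotE mxE; apply: eq_bigr => k _; rewrite !mxE.
rewrite gg /dot (bigD1 i)//= !mxE !eqxx mul1r big1 ?addr0 => [|k ki].
  by rewrite eq_sym.
by rewrite !mxE (negbTE ki) mul0r.
Qed.

Lemma mulmx_continuous m (O : 'M[R]_(n, m)) :
  continuous (fun x : 'rV[R]_n => x *m O).
Proof.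
have -> : (fun x : 'rV[R]_n => x *m O) = (fun x => \sum_i x 0 i *: row i O).
  by apply/funext => y; rewrite mulmx_sum_row.
apply: cont_sum => i; apply: contZ; last exact: cont_cst.
by move=> x; exact: coord_continuous.
Qed.

Lemma dot_orthogonal (O : 'M[R]_n) x y :
  O *m O^T = 1%:M -> dot (x *m O) (y *m O) = dot x y.
Proof. by move=> h; rewrite !dotE trmx_mul mulmxA -(mulmxA x) h mulmx1. Qed.

Lemma enorm_continuous : continuous (@enorm R n).
Proof.
have cd : continuous (fun x : 'rV[R]_n => dot x x).
  apply: cont_sum => i; apply: contM => x; exact: coord_continuous.
by move=> x; apply: (continuous_comp (cd x)); exact: sqrt_continuous.
Qed.

Definition unit_ball : set 'rV[R]_n := [set x | enorm x <= 1].

Lemma measurable_unit_ball : measurable unit_ball.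
Proof.
apply: measurable_closed.
apply: (@closed_comp _ _ (@enorm R n) [set t | t <= 1]); last exact: closed_le.
by move=> x _; exact: enorm_continuous.
Qed.

Lemma bounded_unit_ball : bounded_set unit_ball.
Proof.
exists 1; split => // M M1 x /= x1; apply: norm_le_coord => [|i].
  by rewrite (le_trans _ (ltW M1)).
exact: (le_trans (coord_le_enorm x i)) (le_trans x1 (ltW M1)).
Qed.

Lemma vol_unit_ball_fin : vol unit_ball \is a fin_num.
Proof.
rewrite ge0_fin_numE//; apply: vol_bounded; first exact: measurable_unit_ball.
exact: bounded_unit_ball.
Qed.

Lemma vol_unit_ball_gt0 : (0 < vol unit_ball)%E.
Proof.
have oU : open [set x : 'rV[R]_n | enorm x < 1].
  apply: (@open_comp _ _ (@enorm R n) [set t | t < 1]); last exact: open_lt.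
  by move=> x _; exact: enorm_continuous.
apply: (@lt_le_trans _ _ (vol [set x | enorm x < 1])).
  apply: vol_open_gt0 => //; exists 0.
  by rewrite /= /enorm /dot big1 ?sqrtr0// => i _; rewrite mxE mul0r.
apply: le_measure; rewrite ?inE//; first exact: measurable_open.
- exact: measurable_unit_ball.
- by move=> x /= /ltW.
Qed.

(* The pushforward of the Lebesgue measure is translation invariant, hence a
   multiple of it, and the factor is read off the unit ball. *)
Lemma vol_orthogonal (O : 'M[R]_n) (A : set 'rV[R]_n) :
  O *m O^T = 1%:M -> measurable A -> vol [set x | A (x *m O)] = vol A.
Proof.
move=> OO mA; have OO' : O^T *m O = 1%:M by exact: mulmx1C.
have mg : measurable_fun setT (fun x : 'rV[R]_n => x *m O).
  by apply: continuous_measurable_rV_rV; exact: mulmx_continuous.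
have mp (B : set 'rV[R]_n) : measurable B -> measurable [set x | B (x *m O)].
  by move=> mB; have := mg measurableT B mB; rewrite setTI.
pose D : set 'rV[R]_n := [set x | cell 1 0 (x *m O)].
have mD : measurable D by apply: mp; exact: measurable_cell.
have fD : vol D \is a fin_num.
  rewrite ge0_fin_numE//; apply: vol_bounded => //.
  exists (enorm (const_mx 1 : 'rV[R]_n)); split; first exact: num_real.
    move=> M M1 x /= xD.
  have eM : enorm x <= M.
    apply: le_trans (ltW M1); rewrite /enorm ler_wsqrtr//.
    rewrite -(dot_orthogonal x x OO); apply: ler_sum => i _.
    have -> : (const_mx 1 : 'rV[R]_n) 0 i = 1 by rewrite mxE.
    have := xD i; rewrite ffunE/= !mulr1 add0r => /andP[h1 /ltW h2].
    by rewrite -[leRHS]mulr1 ler_pM.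
  apply: norm_le_coord => [|i]; first by rewrite (le_trans _ eM)// sqrtr_ge0.
  exact: le_trans (coord_le_enorm x i) eM.
have H : forall B, measurable B -> vol [set x | B (x *m O)] = ((fine (vol D))%:E * vol B)%E.
  apply: vol_preimage_cells => // [|k z]; first by rewrite fine_ge0.
  set e := dyadic k; have e0 : 0 < e by exact: dyadic_gt0.
  (* Undoing the scale and the lattice translation turns the preimage of any cell into an affine
     image of the single set [D], so [vol D] is the common factor. *)
  pose zr : 'rV[R]_n := \row_i (z i)%:~R.
  rewrite [X in vol X](_ : _ = [set x | D (e^-1 *: x + (- (zr *m O^T)))]); last first.
    apply/seteqP; split => x /= h i; have := h i;
      rewrite /= mulmxDl -scalemxAl mulNmx -mulmxA OO' mulmx1 !ffunE !mxE/= mul0r add0r mul1r.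
      move=> /andP[h1 h2]; rewrite subr_ge0 mulrC ler_pdivlMr// h1/=.
      by rewrite ltrBlDr [1 + _]addrC ltr_pdivrMr.
    rewrite subr_ge0 [e^-1 * _]mulrC ler_pdivlMr// => /andP[-> /=].
    by rewrite ltrBlDr [1 + _]addrC ltr_pdivrMr.
  rewrite vol_affine ?invr_gt0// invrK -[vol D in LHS]fineK// -EFinM.
  by rewrite mulrC.
have := H _ measurable_unit_ball.
have -> : [set x | unit_ball (x *m O)] = unit_ball.
  apply/seteqP; split => x; rewrite /unit_ball /= /enorm dot_orthogonal//.
move=> h; rewrite H//.
suff -> : fine (vol D) = 1 by rewrite mul1e.
move: h; rewrite -[vol unit_ball]fineK ?vol_unit_ball_fin// -EFinM => -[h].
have b0 : 0 < fine (vol unit_ball).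
  by rewrite fine_gt0// vol_unit_ball_gt0 -ge0_fin_numE// vol_unit_ball_fin.
by apply: (mulIf (lt0r_neq0 b0)); rewrite mul1r -h.
Qed.

Lemma vol_isometry (O : 'M[R]_n) (a : 'rV[R]_n) (A : set 'rV[R]_n) :
  O *m O^T = 1%:M -> measurable A -> vol [set x | A (x *m O + a)] = vol A.
Proof.
move=> OO mA; have mB := measurable_affine 1 a mA.
have -> : [set x | A (x *m O + a)] =
    [set x | [set y | A (1 *: y + a)] (x *m O)].
  by apply/seteqP; split=> x /=; rewrite scale1r.
by rewrite (vol_orthogonal OO mB) vol_affine// invr1 expr1n mul1e.
Qed.

Lemma measurable_isometry (O : 'M[R]_n) (a : 'rV[R]_n) :
  measurable_fun setT (fun x : 'rV[R]_n => x *m O + a).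
Proof.
apply: continuous_measurable_rV_rV; apply: contD; last exact: cont_cst.
exact: mulmx_continuous.
Qed.

End euclidean.

(** * The discrete Dirichlet Laplacian on a grid *)

Section path_laplacian.
Context {R : realType} (m' : nat).
Local Notation m := m'.+1.
Implicit Types (j k : 'I_m').

Definition path_lap : 'M[R]_m' := \matrix_(i, j)
  (2 * (i == j)%:R - ((j : nat) == i.+1)%:R - ((i : nat) == j.+1)%:R).

Lemma path_lap_sym i j : path_lap i j = path_lap j i.
Proof. by rewrite !mxE eq_sym addrAC. Qed.

Lemma sum_ord_pick (G : nat -> R) (a : nat) :
  \sum_(j < m') (((j : nat) == a)%:R * G j) = if (a < m')%N then G a else 0.
Proof.
case: ifP => [am|am].
  rewrite (bigD1 (Ordinal am))//= eqxx mul1r big1 ?addr0// => j ja.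
  by rewrite -val_eqE/= in ja; rewrite (negbTE ja) mul0r.
rewrite big1// => j _; case: eqP => [ja|]; last by rewrite mul0r.
by move: (ltn_ord j); rewrite ja am.
Qed.

(** The zeros at [0] and [m] are the Dirichlet condition: with them the first and last rows take the
    same three-term form as all others. *)
Lemma path_lapE (G : nat -> R) (i : 'I_m') : G 0%N = 0 -> G m = 0 ->
  \sum_j path_lap i j * G j.+1 = 2 * G i.+1 - G i.+2 - G i.
Proof.
move=> G0 Gm.
under eq_bigr do rewrite mxE !mulrBl.
rewrite !sumrB; congr (_ - _ - _).
- under eq_bigr do rewrite -mulrA eq_sym.
  rewrite -mulr_sumr; congr (_ * _).
  by rewrite (sum_ord_pick (fun a : nat => G a.+1)) ltn_ord.
- rewrite (sum_ord_pick (fun a : nat => G a.+1)); case: ifPn => //.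
  rewrite -leqNgt => h; have -> : i.+2 = m by have := ltn_ord i; lia.
  by [].
- have [i0|i0] := posnP (i : nat).
    by rewrite i0 G0 big1// => j _; rewrite /= ?mulr0n mul0r.
  have e j : (i == j.+1 :> nat) = (j == i.-1 :> nat) by lia.
  under eq_bigr do rewrite e.
  have lt : (i.-1 < m')%N by have := ltn_ord i; lia.
  by rewrite (sum_ord_pick (fun a : nat => G a.+1)) lt prednK.
Qed.

Definition angle k : R := pi * k.+1%:R / m%:R.

Definition path_eigval k : R := 2 - 2 * cos (angle k).

Definition sine k (j : nat) : R := sin (angle k * j%:R).

Lemma sin_natpi (p : nat) : sin (pi * p%:R) = 0 :> R.
Proof.
elim: p => [|p IH]; first by rewrite mulr0 sin0.
by rewrite -natr1 mulrDr mulr1 sinDpi IH oppr0.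
Qed.

Lemma angle_itv k : 0 < angle k < pi.
Proof.
rewrite /angle divr_gt0 ?mulr_gt0 ?pi_gt0//= ltr_pdivrMr// ltr_pM2l ?pi_gt0//.
by rewrite ltr_nat ltnS.
Qed.

Lemma path_eigvecE k (i : 'I_m') :
  \sum_j path_lap i j * sine k j.+1 = path_eigval k * sine k i.+1.
Proof.
rewrite (path_lapE (G := sine k)); first last.
- by rewrite /sine /angle divfK// sin_natpi.
- by rewrite /sine mulr0 sin0.
rewrite /path_eigval /sine.
have -> : angle k * i.+2%:R = angle k * i.+1%:R + angle k.
  by rewrite -(@natr1 R i.+1) mulrDr mulr1.
have -> : angle k * i%:R = angle k * i.+1%:R - angle k.
  by rewrite -(@natr1 R i) mulrDr mulr1 addrK.
rewrite sinD sinB; ring.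
Qed.

Lemma path_eigval_inj : injective path_eigval.
Proof.
move=> k l h; have : cos (angle k) = cos (angle l).
  by move: h; rewrite /path_eigval; lra.
have /andP[k0 k1] := angle_itv k; have /andP[l0 l1] := angle_itv l.
move=> /cos_inj; rewrite !in_itv/= !ltW// => /(_ isT isT).
rewrite /angle => /(divIf (lt0r_neq0 (ltr0Sn _ _)))/(mulfI (lt0r_neq0 (pi_gt0 _))).
by move=> /eqP; rewrite eqr_nat eqSS => /eqP/val_inj.
Qed.

Lemma path_eigval_ge0 k : 0 <= path_eigval k.
Proof. by rewrite /path_eigval; have := cos_le1 (angle k); lra. Qed.

(** Symmetry of [path_lap] moves the eigenvalue from one factor to the other, and the two
    eigenvalues differ. *)
Lemma sine_ortho k l : k != l -> \sum_(j < m') sine k j.+1 * sine l j.+1 = 0 :> R.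
Proof.
move=> kl; apply/eqP; have : path_eigval k - path_eigval l != 0.
  by rewrite subr_eq0; apply: contra kl => /eqP/path_eigval_inj->.
move=> /mulfI h; rewrite -(inj_eq h) mulr0 mulrBl subr_eq0; apply/eqP.
rewrite !mulr_sumr.
under eq_bigr do rewrite mulrA -path_eigvecE mulr_suml.
rewrite exchange_big/=; apply: eq_bigr => j _.
rewrite mulrCA -path_eigvecE mulr_sumr; apply: eq_bigr => i _.
rewrite path_lap_sym; ring.
Qed.

Definition sine_sqnorm k : R := \sum_(j < m') sine k j.+1 ^+ 2.

Lemma sine_sqnorm_gt0 k : 0 < sine_sqnorm k.
Proof.
have m0 : (0 < m')%N by have := ltn_ord k; lia.
rewrite /sine_sqnorm (bigD1 (Ordinal m0))//= ltr_wpDr//.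
  by apply: sumr_ge0 => i _; exact: sqr_ge0.
by rewrite exprn_gt0// /sine mulr1; apply: sin_gt0_pi; exact: angle_itv.
Qed.

(** The orthonormal discrete sine transform; dividing by the norm avoids computing its closed
    form. *)
Definition dst k j : R := sine k j.+1 / Num.sqrt (sine_sqnorm k).

(** The rows of a square matrix are orthonormal, hence so are its columns. *)
Lemma dst_complete i j : \sum_k dst k i * dst k j = (i == j)%:R.
Proof.
pose S : 'M[R]_m' := \matrix_(k, j) dst k j.
have SS : S *m S^T = 1%:M.
  apply/matrixP => k l; rewrite !mxE.
  under eq_bigr do rewrite !mxE /dst mulrACA.
  rewrite -mulr_suml; have [<-|kl] := eqVneq k l; last first.
    by rewrite sine_ortho// mul0r.
  under eq_bigr do rewrite -expr2.
  rewrite -invfM -expr2 sqr_sqrtr ?divff ?lt0r_neq0 ?sine_sqnorm_gt0//.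
  exact/ltW/sine_sqnorm_gt0.
have /matrixP/(_ i j) := mulmx1C SS; rewrite !mxE => <-.
by apply: eq_bigr => k _; rewrite !mxE.
Qed.

Lemma dst_eig k i : \sum_j path_lap i j * dst k j = path_eigval k * dst k i.
Proof.
by rewrite /dst; under eq_bigr do rewrite mulrA; rewrite -mulr_suml path_eigvecE mulrA.
Qed.

(** * The Dirichlet Laplacian on a product grid *)

Section grid.
Variable n : nat.
Local Notation grid := {ffun 'I_n -> 'I_m'}.
Implicit Types (t : grid) (f g : grid -> R).

Definition upd t (i : 'I_n) j : grid := [ffun i' => if i' == i then j else t i'].

Lemma updK t i j : upd (upd t i j) i (t i) = t.
Proof. by apply/ffunP => i'; rewrite !ffunE; case: eqP => [->|]. Qed.

Lemma upd_at t i j : upd t i j i = j.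
Proof. by rewrite ffunE eqxx. Qed.

(** The Kronecker sum of [n] copies of [path_lap], hence diagonalized by products of sines. *)
Definition grid_lap f t : R := \sum_(i < n) \sum_j path_lap (t i) j * f (upd t i j).

Definition grid_dst t' t : R := \prod_(i < n) dst (t' i) (t i).

Definition grid_eigval t : R := \sum_(i < n) path_eigval (t i).

Lemma grid_eigval_ge0 t : 0 <= grid_eigval t.
Proof. by apply: sumr_ge0 => i _; exact: path_eigval_ge0. Qed.

Definition coef f t' : R := \sum_t f t * grid_dst t' t.

Lemma grid_lap_sym f g : \sum_t f t * grid_lap g t = \sum_t grid_lap f t * g t.
Proof.
rewrite /grid_lap.
under eq_bigr do rewrite mulr_sumr.
under [RHS]eq_bigr do rewrite mulr_suml.
rewrite exchange_big [RHS]exchange_big/=; apply: eq_bigr => i _.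
under eq_bigr do rewrite mulr_sumr.
under [RHS]eq_bigr do rewrite mulr_suml.
rewrite pair_bigA [RHS]pair_bigA/=.
(* The involution that swaps the two ends of a move along axis [i]; reindexing by it exchanges the
   two sides. *)
pose h (p : grid * 'I_m') := (upd p.1 i p.2, p.1 i).
have hK : involutive h by move=> [t j]; rewrite /h /= updK upd_at.
rewrite (reindex_inj (inv_inj hK))/=; apply: eq_bigr => -[t j] _ /=.
rewrite updK upd_at path_lap_sym; ring.
Qed.

Lemma grid_lap_dst t' t : grid_lap (grid_dst t') t = grid_eigval t' * grid_dst t' t.
Proof.
rewrite /grid_lap /grid_eigval mulr_suml; apply: eq_bigr => i _.
rewrite /grid_dst.
under eq_bigr => j _.
  rewrite (bigD1 i)//= upd_at.
  under eq_bigr => i' ii' do rewrite ffunE (negbTE ii').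
  rewrite mulrA; over.
by rewrite -mulr_suml dst_eig [in RHS](bigD1 i)//= [RHS]mulrA.
Qed.

Lemma coef_lap f t' : coef (grid_lap f) t' = grid_eigval t' * coef f t'.
Proof.
rewrite /coef -grid_lap_sym mulr_sumr; apply: eq_bigr => t _.
by rewrite grid_lap_dst mulrCA.
Qed.

(** One-dimensional completeness multiplied over the axes by [bigA_distr_bigA]; for two distinct
    nodes some axis contributes a zero factor. *)
Lemma grid_parseval f g : \sum_t f t * g t = \sum_t' coef f t' * coef g t'.
Proof.
rewrite /coef; under [RHS]eq_bigr do rewrite mulr_suml.
rewrite exchange_big/=; apply: eq_bigr => t _.
under [RHS]eq_bigr do rewrite mulr_sumr.
rewrite exchange_big/= (bigD1 t)//= [X in _ = _ + X]big1 ?addr0.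
  under eq_bigr do rewrite mulrACA.
  rewrite -mulr_sumr -[LHS]mulr1; congr (_ * _); apply/esym.
  rewrite /grid_dst; under eq_bigr do rewrite -big_split/=.
  rewrite -(bigA_distr_bigA (fun i k => dst k (t i) * dst k (t i))).
  by rewrite big1// => i _; rewrite dst_complete eqxx.
move=> u ut; under eq_bigr do rewrite mulrACA.
rewrite -mulr_sumr; apply/eqP; rewrite mulf_eq0; apply/orP; right; apply/eqP.
rewrite /grid_dst; under eq_bigr do rewrite -big_split/=.
rewrite -(bigA_distr_bigA (fun i k => dst k (t i) * dst k (u i))).
have [i tu] : exists i, t i != u i.
  apply/existsP; rewrite -negb_forall; apply: contra ut => /forallP h.
  by apply/eqP/ffunP => i; apply/esym/eqP.
by rewrite (bigD1 i)//= dst_complete (negbTE tu) mul0r.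
Qed.

Lemma grid_formE f g :
  \sum_t f t * grid_lap g t = \sum_t' grid_eigval t' * (coef f t' * coef g t').
Proof.
rewrite grid_parseval; apply: eq_bigr => t' _.
by rewrite coef_lap mulrCA.
Qed.

Lemma grid_form_sym f g : \sum_t f t * grid_lap g t = \sum_t g t * grid_lap f t.
Proof. by rewrite !grid_formE; apply: eq_bigr => t _; rewrite (mulrC (coef f t)). Qed.

Lemma grid_form_ge0 f : 0 <= \sum_t f t * grid_lap f t.
Proof.
rewrite grid_formE sumr_ge0// => t _.
by rewrite mulr_ge0 ?grid_eigval_ge0// -expr2 sqr_ge0.
Qed.

(* With more functions than low modes, some combination is orthogonal to all
   the low modes. *)
Lemma grid_minmax (I : finType) (v : I -> grid -> R) (lam : R) :
  (forall c : I -> R, (exists i, c i != 0) ->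
     let w := fun t => \sum_i c i * v i t in
     \sum_t w t * grid_lap w t < lam * \sum_t w t * w t) ->
  (#|I| <= #|[pred t : grid | (grid_eigval t < lam)%R]|)%N.
Proof.
move=> H; rewrite leqNgt; apply/negP => lt.
set L := [pred t | _] in lt.
pose M : 'M[R]_(#|I|, #|L|) := \matrix_(i, j) coef (v (enum_val i)) (enum_val j).
have : kermx M != 0.
  by rewrite kermx_eq0 /row_free neq_ltn (leq_ltn_trans (rank_leq_col M) lt).
move=> /rowV0Pn[a /sub_kermxP aM a0].
pose c i := a 0 (enum_rank i).
have : exists i, c i != 0.
  have /rV0Pn[j aj] := a0.
  by exists (enum_val j); rewrite /c enum_valK.
pose w (t : grid) := \sum_i c i * v i t.
move=> /H {H} H; have {H} : \sum_t w t * grid_lap w t < lam * \sum_t w t * w t by exact: H.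
have wL t : t \in L -> coef w t = 0.
  move=> tL; have /rowP/(_ (enum_rank_in tL t)) := aM; rewrite !mxE => <-.
  rewrite /coef /w; under eq_bigr do rewrite mulr_suml.
  rewrite exchange_big/= (reindex (@enum_val I predT))/=; last first.
    by apply: onW_bij; exact: enum_val_bij.
  apply: eq_bigr => i _; rewrite /c enum_valK mxE mulr_sumr.
  by rewrite enum_rankK_in//; apply: eq_bigr => t1 _; rewrite mulrA.
apply/negP; rewrite -leNgt grid_formE (grid_parseval w w) mulr_sumr.
apply: ler_sum => t _. have [/wL ->|] := boolP (t \in L).
  by rewrite !mulr0.
by rewrite inE -leNgt => h; rewrite ler_wpM2r// -expr2 sqr_ge0.
Qed.

End grid.
End path_laplacian.

(** * Smooth functions *)

Section same_increments.
Context {R : realType} {V V' W : normedModType R}.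
Variables (f : V -> W) (g : V' -> W) (a v : V) (a' v' : V').
Hypothesis fg : forall h : R, f (h *: v + a) - f a = g (h *: v' + a') - g a'.

Let quotients : (fun h : R => h^-1 *: ((f \o shift a) (h *: v) - f a)) =
  (fun h : R => h^-1 *: ((g \o shift a') (h *: v') - g a')).
Proof. by apply/funext => h; rewrite /= fg. Qed.

(** A directional derivative sees nothing but increments along a line, so it can be transported
    between functions on different spaces. This serves for affine substitutions and for restriction
    to a line. *)
Lemma derive_increments : 'D_v f a = 'D_v' g a'.
Proof. by rewrite /derive quotients. Qed.

Lemma derivable_increments : derivable g a' v' -> derivable f a v.
Proof. by rewrite /derivable quotients. Qed.

End same_increments.

Section smooth_functions.
Context {R : realType} {n : nat}.
Implicit Types (f g phi psi : 'rV[R]_n -> R) (A : set 'rV[R]_n).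

Lemma smooth_differentiable phi x : smooth_on setT phi -> differentiable phi x.
Proof. by move=> /(_ [::] x I). Qed.

Lemma smooth_partial i phi : smooth_on setT phi -> smooth_on setT (partial i phi).
Proof. by move=> sp s x _; have := sp (rcons s i) x I; rewrite foldr_rcons. Qed.

Lemma smooth_continuous phi : smooth_on setT phi -> continuous phi.
Proof. by move=> sp x; exact/differentiable_continuous/smooth_differentiable. Qed.

Lemma partialD i f g : smooth_on setT f -> smooth_on setT g ->
  partial i (f + g) = partial i f + partial i g.
Proof.
move=> sf sg; apply/funext => x; rewrite /partial deriveD//;
  exact/diff_derivable/smooth_differentiable.
Qed.

Lemma partialZ i (c : R) f : smooth_on setT f ->
  partial i (c *: f) = c *: partial i f.
Proof.
move=> sf; apply/funext => x; rewrite /partial.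
by rewrite deriveZ//; exact/diff_derivable/smooth_differentiable.
Qed.

Lemma smoothD f g : smooth_on setT f -> smooth_on setT g -> smooth_on setT (f + g).
Proof.
move=> sf sg s x _.
(* The induction on [s] carries the smoothness of both summands, which is what lets the next
   [partial] split. *)
suff [f' [g' [sf' sg' ->]]] : exists f' g', [/\ smooth_on setT f',
    smooth_on setT g' & foldr partial (f + g) s = f' + g'].
  by apply: differentiableD; exact: smooth_differentiable.
elim: s => [|i s [f' [g' [sf' sg' e]]]]; first by exists f, g.
exists (partial i f'), (partial i g'); split; [exact: smooth_partial..|].
by rewrite /= e partialD.
Qed.

Lemma smoothZ (c : R) f : smooth_on setT f -> smooth_on setT (c *: f).
Proof.
move=> sf s x _.
suff [f' [sf' ->]] : exists f', smooth_on setT f' /\ foldr partial (c *: f) s = c *: f'.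
  by apply: differentiableZ; exact: smooth_differentiable.
elim: s => [|i s [f' [sf' e]]]; first by exists f.
exists (partial i f'); split; first exact: smooth_partial.
by rewrite /= e partialZ.
Qed.

Lemma partial0 i : partial i (0 : 'rV[R]_n -> R) = 0.
Proof. by apply/funext => x; exact: derive_cst. Qed.

Lemma smooth0 : smooth_on setT (0 : 'rV[R]_n -> R).
Proof.
move=> s x _; have -> : foldr partial (0 : 'rV[R]_n -> R) s = 0.
  by elim: s => //= i s ->; exact: partial0.
exact: differentiable_cst.
Qed.

Lemma smooth_sum (I : Type) (r : seq I) (F : I -> 'rV[R]_n -> R) :
  (forall i, smooth_on setT (F i)) -> smooth_on setT (\sum_(i <- r) F i).
Proof.
move=> sF; elim: r => [|i r IH]; first by rewrite big_nil; exact: smooth0.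
by rewrite big_cons; exact: smoothD.
Qed.

Lemma partial_sum i (I : Type) (r : seq I) (F : I -> 'rV[R]_n -> R) :
  (forall j, smooth_on setT (F j)) ->
  partial i (\sum_(j <- r) F j) = \sum_(j <- r) partial i (F j).
Proof.
move=> sF; elim: r => [|j r IH]; first by rewrite !big_nil partial0.
by rewrite !big_cons partialD ?IH//; exact: smooth_sum.
Qed.

Lemma laplacianE f : laplacian f = \sum_(i < n) partial i (partial i f).
Proof. by apply/funext => x; rewrite /laplacian fct_sumE. Qed.

Lemma smooth_laplacian f : smooth_on setT f -> smooth_on setT (laplacian f).
Proof.
by move=> sf; rewrite laplacianE; apply: smooth_sum => i; do 2 apply: smooth_partial.
Qed.

Lemma derive_partial phi x v : differentiable phi x ->
  'D_v phi x = \sum_(i < n) v 0 i * partial i phi x.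
Proof.
move=> dp; rewrite deriveE// [in LHS](row_sum_delta v) linear_sum.
by apply: eq_bigr => i _; rewrite linearZ/= /partial deriveE.
Qed.

Lemma isometry_differentiable (O : 'M[R]_n) (b x : 'rV[R]_n) :
  differentiable (fun x : 'rV[R]_n => x *m O + b) x.
Proof.
apply: differentiableD; last exact: differentiable_cst.
have := @linear_differentiable R 'rV[R]_n 'rV[R]_n (mulmxr O) x.
by apply; exact: mulmx_continuous.
Qed.

(** A step in the direction [delta_mx 0 i] is sent to a step along row [i] of [O]. *)
Lemma partial_comp i phi (O : 'M[R]_n) (b : 'rV[R]_n) : smooth_on setT phi ->
  partial i (fun x => phi (x *m O + b)) =
  (fun x => (\sum_j O i j *: partial j phi) (x *m O + b)).
Proof.
move=> sp; apply/funext => x; rewrite fct_sumE.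
transitivity ('D_(row i O) phi (x *m O + b)); last first.
  rewrite derive_partial; last exact: smooth_differentiable.
  by apply: eq_bigr => j _; rewrite mxE.
apply: (@derive_increments _ _ _ _ (fun x => phi (x *m O + b)) phi x
  (delta_mx 0 i) (x *m O + b) (row i O)) => h.
by rewrite mulmxDl -scalemxAl -rowE addrA.
Qed.

Lemma smooth_comp phi (O : 'M[R]_n) (b : 'rV[R]_n) : smooth_on setT phi ->
  smooth_on setT (fun x => phi (x *m O + b)).
Proof.
move=> sp s x _.
suff [G [sG ->]] : exists G, smooth_on setT G /\
    foldr partial (fun x => phi (x *m O + b)) s = (fun x => G (x *m O + b)).
  apply: (differentiable_comp (isometry_differentiable O b x)).
  exact: smooth_differentiable.
elim: s => [|i s [G [sG e]]]; first by exists phi.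
exists (\sum_j O i j *: partial j G); split; last by rewrite /= e partial_comp.
by apply: smooth_sum => j; apply/smoothZ/smooth_partial.
Qed.

(** The columns of [O] are orthonormal, so among the second derivatives produced by the substitution
    the mixed ones cancel. *)
Lemma laplacian_comp phi (O : 'M[R]_n) (b : 'rV[R]_n) : O *m O^T = 1%:M ->
  smooth_on setT phi ->
  laplacian (fun x => phi (x *m O + b)) = (fun x => laplacian phi (x *m O + b)).
Proof.
move=> OO sp; apply/funext => x; rewrite /laplacian.
have OO' : forall j k, \sum_i O i j * O i k = (j == k)%:R.
  move=> j k; have /matrixP/(_ j k) := mulmx1C OO; rewrite !mxE => <-.
  by apply: eq_bigr => i _; rewrite mxE.
transitivity (\sum_(i < n) \sum_j \sum_k O i j * O i k *
    partial k (partial j phi) (x *m O + b)).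
  apply: eq_bigr => i _; rewrite partial_comp// partial_comp; last first.
    by apply: smooth_sum => j; apply/smoothZ/smooth_partial.
  rewrite fct_sumE exchange_big/=; apply: eq_bigr => k _.
  rewrite partial_sum; last by move=> j; apply/smoothZ/smooth_partial.
  rewrite [LHS]/GRing.scale/= fct_sumE [LHS]/GRing.scale/= mulr_sumr.
  apply: eq_bigr => j _; rewrite partialZ; last exact: smooth_partial.
  by rewrite [in LHS]/GRing.scale/= /GRing.scale/=; ring.
rewrite exchange_big/=; apply: eq_bigr => j _.
rewrite exchange_big/= (bigD1 j)//= [X in _ + X]big1 ?addr0.
  by rewrite -mulr_suml OO' eqxx mul1r.
by move=> k kj; rewrite -mulr_suml OO' eq_sym (negbTE kj) mul0r.
Qed.

(** [test_function] with an arbitrary set in place of the interior of [Omega], so that [Omega], its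
    copies and open cubes are treated alike. *)
Definition smooth_in A phi :=
  smooth_on setT phi /\ closure [set x | phi x != 0] `<=` A.

Lemma smooth_in_out A phi x : smooth_in A phi -> ~ A x -> phi x = 0.
Proof.
move=> [_ h] Ax; apply/eqP/negPn/negP => px; apply: Ax; apply: h.
exact: subset_closure.
Qed.

Lemma closure_neq0_sub f g :
  (forall x, ~ closure [set x | f x != 0] x -> g x = 0) ->
  closure [set x | g x != 0] `<=` closure [set x | f x != 0].
Proof.
move=> h; apply: subset_trans (@closed_closure _ [set x | f x != 0]).
apply: closure_subset => x /= gx; apply: contrapT => /h g0.
by rewrite g0 eqxx in gx.
Qed.

(** Off its closed support a function vanishes in a whole neighbourhood, and so does its
    increment. *)
Lemma smooth_in_partial A i phi : smooth_in A phi -> smooth_in A (partial i phi).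
Proof.
move=> [sp h]; split; first exact: smooth_partial.
apply: subset_trans h; apply: closure_neq0_sub => x xp.
rewrite /partial -(derive_cst (0 : R) x (delta_mx 0 i)); apply: near_eq_derive.
have oC : open (~` closure [set x | phi x != 0]).
  by rewrite openC; exact: closed_closure.
have : \forall y \near x, (~` closure [set x | phi x != 0]) y.
  by apply: open_nbhs_nbhs.
apply: filterS => y yc; apply/eqP/negPn/negP => py; apply: yc.
exact: subset_closure.
Qed.

Lemma smooth_inD A f g : smooth_in A f -> smooth_in A g -> smooth_in A (f + g).
Proof.
move=> [sf hf] [sg hg]; split; first exact: smoothD.
have : closure [set x | (f + g) x != 0] `<=`
    closure ([set x | f x != 0] `|` [set x | g x != 0]).
  apply: closure_subset => x /=; have [f0|f0 _] := eqVneq (f x) 0; last by left.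
  by move=> fg; right; move: fg; apply: contra_neq => g0; rewrite fctE f0 g0 addr0.
by rewrite closureU => h x /h[/hf|/hg].
Qed.

Lemma smooth_inZ A (c : R) f : smooth_in A f -> smooth_in A (c *: f).
Proof.
move=> [sf hf]; split; first exact: smoothZ.
apply: subset_trans hf; apply: closure_subset => x /=.
by apply: contra_neq => f0; rewrite fctE f0 scaler0.
Qed.

Lemma smooth_in0 A : smooth_in A 0.
Proof.
split; first exact: smooth0.
rewrite (_ : [set x | _] = set0) ?closure0//.
by apply/seteqP; split => x //=; rewrite eqxx.
Qed.

Lemma smooth_in_sum A (I : Type) (r : seq I) (F : I -> 'rV[R]_n -> R) :
  (forall i, smooth_in A (F i)) -> smooth_in A (\sum_(i <- r) F i).
Proof.
move=> sF; elim: r => [|i r IH]; first by rewrite big_nil; exact: smooth_in0.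
by rewrite big_cons; exact: smooth_inD.
Qed.

Lemma smooth_in_laplacian A f : smooth_in A f -> smooth_in A (laplacian f).
Proof.
by move=> sf; rewrite laplacianE; apply: smooth_in_sum => i; do 2 apply: smooth_in_partial.
Qed.

Lemma smooth_in_sub A B f : A `<=` B -> smooth_in A f -> smooth_in B f.
Proof. by move=> AB [? h]; split => //; exact: subset_trans AB. Qed.

Lemma smooth_in_bounded A phi : bounded_set A -> smooth_in A phi ->
  exists2 M : R, 0 <= M & forall x, `|phi x| <= M.
Proof.
move=> bA [sp h]; have cK : compact (closure [set x | phi x != 0]).
  apply: bounded_closed_compact; last exact: closed_closure.
  move: bA => [M [Mr AM]]; exists M; split => // N MN x /h; exact: AM.
have : compact (phi @` closure [set x | phi x != 0]).
  apply: continuous_compact => //.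
  by apply: continuous_subspaceT; exact: smooth_continuous.
move=> /compact_bounded[M [_ HM]]; exists (`|M| + 1) => // x.
have [p0|p0] := eqVneq (phi x) 0; first by rewrite p0 normr0.
apply: HM; first by rewrite (le_lt_trans (ler_norm M))// ltrDl.
by exists x => //; exact: subset_closure.
Qed.

Lemma smooth_in_comp A phi (O : 'M[R]_n) (b : 'rV[R]_n) : smooth_in A phi ->
  smooth_in [set x | A (x *m O + b)] (fun x => phi (x *m O + b)).
Proof.
move=> [sp h]; split; first exact: smooth_comp.
move=> x xc; apply: h => /= B nB.
have cg : continuous (fun x : 'rV[R]_n => x *m O + b).
  by apply: contD; [exact: mulmx_continuous|exact: cont_cst].
by have [y [/= y1 y2]] := xc _ (cg x B nB); exists (y *m O + b).
Qed.

Lemma is_derive_line phi x i (t : R) : smooth_on setT phi ->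
  is_derive t 1 (fun t : R => phi (x + t *: delta_mx 0 i))
    (partial i phi (x + t *: delta_mx 0 i)).
Proof.
move=> sp; set d := delta_mx 0 i : 'rV[R]_n.
have E (h : R) : phi (x + (h *: (1 : R) + t) *: d) - phi (x + t *: d) =
    phi (h *: d + (x + t *: d)) - phi (x + t *: d).
  by rewrite [h *: (1 : R)]/GRing.scale/= mulr1 scalerDl addrCA.
apply: DeriveDef; last exact: (derive_increments E).
by apply: (derivable_increments E); exact/diff_derivable/smooth_differentiable.
Qed.

Lemma mean_value (f df : R -> R) (a b : R) : a < b ->
  (forall t : R, is_derive t 1 f (df t)) ->
  exists2 c, a < c < b & f b - f a = df c * (b - a).
Proof.
move=> ab h; have [|c cab e] := @MVT R f df a b ab (fun t _ => h t).
- apply: continuous_subspaceT => t; apply: differentiable_continuous.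
  by apply/derivable1_diffP; have [] := h t.
- by exists c; rewrite // -in_itv.
Qed.

(** Mean value theorem twice: for the first difference [h] on [[- e, 0]], then for the first partial
    derivative on an interval of length [e]. An exact identity yields both a bound and a limit for
    the grid Laplacian. *)
Lemma second_difference phi x i (e : R) : smooth_on setT phi -> 0 < e ->
  exists2 t : R, `|t| <= e &
    phi (x + e *: delta_mx 0 i) + phi (x - e *: delta_mx 0 i) - 2 * phi x =
    e ^+ 2 * partial i (partial i phi) (x + t *: delta_mx 0 i).
Proof.
move=> sp e0; set d := delta_mx 0 i : 'rV[R]_n.
pose h (t : R) := phi (x + e *: d + t *: d) - phi (x + t *: d).
have dh (t : R) : is_derive t 1 h
    (partial i phi (x + e *: d + t *: d) - partial i phi (x + t *: d)).
  by apply: is_deriveB; exact: is_derive_line.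
have e1 : - e < 0 by rewrite oppr_lt0.
have [t1 /andP[t1e t10]] := mean_value e1 dh.
have t2 : t1 < t1 + e by rewrite ltrDl.
have [t3 /andP[t3e t30]] := mean_value t2
  (fun t => is_derive_line x i t (smooth_partial i sp)).
rewrite !scalerDl addrA addrAC => H2 H1.
exists t3; first by rewrite ler_norml; apply/andP; split; lra.
move: H1; rewrite H2 /h !scale0r !addr0 scaleNr addrK; lra.
Qed.

End smooth_functions.

(** * Integrals as limits of Riemann sums *)

Section integration.
Context {R : realType} {n : nat}.
Implicit Types (f g phi psi : 'rV[R]_n -> R) (A : set 'rV[R]_n).
Local Notation vol := (@lebesgue_rV R n).

Definition ip f g : R := \int[vol]_x (f x * g x).

Lemma integrable_cst_indic (C : R) A : measurable A -> (vol A < +oo)%E ->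
  vol.-integrable setT (fun x => (C * \1_A x)%:E).
Proof.
move=> mA Aoo; have := @integrableZl _ _ _ vol setT measurableT C
  (fun x => (\1_A x)%:E); apply.
apply/integrableP; split.
  by apply/measurable_EFinP; exact: measurable_indic.
rewrite (eq_integral (fun x => (\1_A x)%:E)) => [|x _].
  by rewrite integral_indic// setIT.
by rewrite gee0_abs// lee_fin.
Qed.

Lemma integrable_bounded_support f A (C : R) : measurable A -> (vol A < +oo)%E ->
  measurable_fun setT f -> (forall x, `|f x| <= C) -> (forall x, ~ A x -> f x = 0) ->
  vol.-integrable setT (EFin \o f).
Proof.
move=> mA Aoo mf fC fA.
apply: (le_integrable measurableT _ _ (integrable_cst_indic C mA Aoo)).
  exact/measurable_EFinP.
move=> x _; rewrite /= lee_fin indicE; have [xA|] := boolP (x \in A).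
  by rewrite mulr1 (le_trans (fC x))// ler_norm.
by rewrite notin_setE => /fA ->; rewrite normr0.
Qed.

Lemma smooth_in_integrable A f : bounded_set A -> smooth_in A f ->
  vol.-integrable setT (EFin \o f).
Proof.
move=> bA sf; have [C _ fC] := smooth_in_bounded bA sf.
have [M [_ AM]] := bA.
pose B : set 'rV[R]_n := closure [set x | f x != 0].
have mB : measurable B by apply: measurable_closed; exact: closed_closure.
apply: (@integrable_bounded_support f B C) => //.
- apply: vol_bounded => //; exists M; split; first exact: num_real.
  by move=> N MN x Bx; apply: AM => //; have [_] := sf; exact.
- by apply: continuous_measurable_rV; apply: smooth_continuous; have [] := sf.
- move=> x Bx; apply/eqP/negPn/negP => fx; apply: Bx; exact: subset_closure.
Qed.

Lemma smooth_inM_integrable A f g : bounded_set A -> smooth_in A f -> smooth_in A g ->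
  vol.-integrable setT (EFin \o (fun x => f x * g x)).
Proof.
move=> bA sf sg; have [C C0 fC] := smooth_in_bounded bA sf.
have mf h : smooth_in A h -> measurable_fun setT h.
  by move=> [sh _]; apply: continuous_measurable_rV; exact: smooth_continuous.
have ig := smooth_in_integrable bA sg.
apply: (le_integrable measurableT _ _ (integrableZl measurableT C ig)).
  by apply/measurable_EFinP; apply: measurable_funM; exact: mf.
move=> x _; rewrite /= lee_fin !normrM ler_wpM2r//.
by rewrite (le_trans (fC x))// ler_norm.
Qed.

Lemma Rintegral_isometry f (O : 'M[R]_n) (b : 'rV[R]_n) : O *m O^T = 1%:M ->
  measurable_fun setT f ->
  vol.-integrable setT (EFin \o (fun x => f (x *m O + b))) ->
  \int[vol]_x f (x *m O + b) = \int[vol]_x f x.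
Proof.
move=> OO mf fi; have mg := measurable_isometry O b.
rewrite /Rintegral; congr fine.
have := @integral_pushforward _ _ _ _ _ _ mg vol setT (EFin \o f).
rewrite preimage_setT => <- //; last exact/measurable_EFinP.
apply: eq_measure_integral => A mA _.
exact: vol_isometry.
Qed.

(** Open, so that functions supported inside vanish at the grid points on the faces. *)
Definition obox (l : R) : set 'rV[R]_n := [set x | forall i, 0 < x 0 i < l].

Lemma obox_bounded l : bounded_set (obox l).
Proof.
exists `|l|; split; first exact: num_real.
move=> M lM x xl; have l0 : 0 <= M by rewrite (le_trans _ (ltW lM)).
apply: norm_le_coord => // i; have /andP[x0 x1] := xl i.
by rewrite gtr0_norm// (le_trans (ltW x1))// (le_trans (ler_norm l))// ltW.
Qed.

Section riemann_sums.
Variable (l : R).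
Hypothesis l0 : 0 < l.

Definition mesh (m' : nat) : R := l / m'.+1%:R.

Lemma mesh_gt0 m' : 0 < mesh m'.
Proof. by rewrite divr_gt0. Qed.

Lemma mesh_cvg : mesh m' @[m' --> \oo] --> (0 : R).
Proof.
rewrite -[X in _ --> X](mulr0 l); apply: cvgMr; exact: cvg_harmonic.
Qed.

Lemma mesh_size m' : m'.+1%:R * mesh m' = l.
Proof. by rewrite /mesh mulrC divfK. Qed.

(** The shift by one leaves out the face at [0]; the face at [l] would be index [m'.+1], so only
    interior grid points remain. *)
Definition node m' (t : {ffun 'I_n -> 'I_m'}) : 'rV[R]_n :=
  \row_i ((t i).+1%:R * mesh m').

Definition node_cell m' (t : {ffun 'I_n -> 'I_m'}) : {ffun 'I_n -> int} :=
  [ffun i => (t i).+1 : int].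

Definition corner m' (x : 'rV[R]_n) : 'rV[R]_n :=
  \row_i ((cell_index (mesh m') x i)%:~R * mesh m').

Lemma corner_node m' (t : {ffun 'I_n -> 'I_m'}) x :
  cell (mesh m') (node_cell t) x -> corner m' x = node t.
Proof.
move/(cellP _ _ (mesh_gt0 m')) => h; apply/rowP => i.
by rewrite !mxE h ffunE.
Qed.

Lemma corner_dist m' x : `|corner m' x - x| < mesh m'.
Proof.
apply: norm_lt_coord => [|i]; first exact: mesh_gt0.
have /(_ i)/andP[] := cell_index_in x (mesh_gt0 m').
rewrite !mxE mulrDl mul1r => h1 h2; rewrite ltr_norml; apply/andP; split; lra.
Qed.

Lemma corner_obox m' x : obox l (corner m' x) ->
  exists t : {ffun 'I_n -> 'I_m'}, cell (mesh m') (node_cell t) x.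
Proof.
move=> h; set z := cell_index (mesh m') x.
have zi i : exists t : 'I_m', z i = t.+1 :> int.
  have /andP[z0 zl] := h i.
  have {}z0 : 0 < z i by move: z0; rewrite mxE -/z pmulr_lgt0 ?mesh_gt0// ltr0z.
  have {}zl : z i < m'.+1 :> int.
    move: zl; rewrite mxE -/z -[X in _ < X](mesh_size m') ltr_pM2r ?mesh_gt0//.
    by rewrite -[_.+1%:R]/(_.+1%:~R) ltr_int.
  case: (z i) z0 zl => [[|k]|k]// _; rewrite ltz_nat ltnS => km.
  by exists (Ordinal km).
have /fin_all_exists[t tE] := zi.
exists (finfun t); apply/cellP; first exact: mesh_gt0.
by apply/ffunP => i; rewrite -/z tE !ffunE.
Qed.

Lemma node_cell_inj m' : injective (@node_cell m').
Proof.
move=> t u /ffunP h; apply/ffunP => i; have := h i.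
by rewrite !ffunE => -[/val_inj].
Qed.

Lemma corner_sum m' (F : 'rV[R]_n -> R) x : (forall y, ~ obox l y -> F y = 0) ->
  F (corner m' x) = \sum_(t : {ffun 'I_n -> 'I_m'})
    F (node t) * \1_(cell (mesh m') (node_cell t)) x.
Proof.
move=> F0; have [xb|xb] := pselect (obox l (corner m' x)).
  have [t tx] := corner_obox xb.
  rewrite (bigD1 t)//= indicE mem_set// mulr1 big1 ?addr0 => [|u ut].
    by rewrite (corner_node tx).
  rewrite indicE memNset ?mulr0// => ux; move/eqP: ut; apply.
  apply: node_cell_inj; move/(cellP _ _ (mesh_gt0 m')) : ux => <-.
  by apply/(cellP _ _ (mesh_gt0 m')).
rewrite F0// big1// => t _; rewrite indicE.
have [tx|tx] := pselect (cell (mesh m') (node_cell t) x).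
  by rewrite -(corner_node tx) F0// mul0r.
by rewrite memNset// mulr0.
Qed.

(** Dominated convergence for the step functions [F m (corner m x)]. The integrand may depend on
    [m], which admits difference quotients on the mesh. *)
Lemma riemann_sum (F : nat -> 'rV[R]_n -> R) f (C : R) :
  measurable_fun setT f ->
  (forall m x, `|F m x| <= C) -> (forall m x, ~ obox l x -> F m x = 0) ->
  (forall x, F m (corner m x) @[m --> \oo] --> f x) ->
  mesh m ^+ n * \sum_(t : {ffun 'I_n -> 'I_m}) F m (node t) @[m --> \oo]
    --> \int[vol]_x f x.
Proof.
move=> mf FC F0 Ff.
pose g m x := F m (corner m x).
have mind m (t : {ffun 'I_n -> 'I_m}) : measurable (cell (mesh m) (node_cell t)).
  exact: measurable_cell.
have volc m (t : {ffun 'I_n -> 'I_m}) :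
    vol (cell (mesh m) (node_cell t)) = (mesh m ^+ n)%:E.
  by rewrite vol_cell// mesh_gt0.
have int_ind m (t : {ffun 'I_n -> 'I_m}) (c : R) :
    vol.-integrable setT (fun x => (c * \1_(cell (mesh m) (node_cell t)) x)%:E).
  by apply: integrable_cst_indic; rewrite ?volc ?ltry.
have gE m : (EFin \o g m) = (fun x => \sum_(t : {ffun 'I_n -> 'I_m})
    (F m (node t) * \1_(cell (mesh m) (node_cell t)) x)%:E)%E.
  by apply/funext => x; rewrite /= /g (corner_sum m x (F0 m)) sumEFin.
have ig m : (\int[vol]_x (g m x)%:E =
    (mesh m ^+ n * \sum_(t : {ffun 'I_n -> 'I_m}) F m (node t))%:E)%E.
  rewrite -[LHS]/(\int[vol]_x ((EFin \o g m) x))%E gE integral_sum//.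
  rewrite mulr_sumr -sumEFin; apply: eq_bigr => t _.
  transitivity (\int[vol]_x ((F m (node t))%:E *
      (\1_(cell (mesh m) (node_cell t)) x)%:E))%E; first by [].
  rewrite integralZl//; last first.
    have := int_ind m t 1; apply: eq_integrable => // x _.
    by rewrite mul1r.
  rewrite integral_indic// setIT [RHS]EFinM muleC.
  by congr (_ * _)%E; exact: volc.
pose B := rect (fun=> `[0, l]%classic : set (measurableTypeR R)) : set 'rV[R]_n.
have mB : measurable B by apply: measurable_rect => i; exact: measurable_itv.
have Boo : (vol B < +oo)%E.
  apply: (@le_lt_trans _ _ (l ^+ n)%:E); last exact: ltry.
  apply: (@vol_box_le _ _ _ 0) => //; first exact: ltW.
  by move=> x h i; have := h i; rewrite /= in_itv/= mxE add0r.
have dom m x : (`|(g m x)%:E| <= (C * \1_B x)%:E)%E.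
  rewrite /= lee_fin; have [xB|xB] := boolP (x \in B).
    by rewrite indicE xB mulr1; exact: FC.
  rewrite indicE (negbTE xB) mulr0 normr_le0; apply/eqP/F0 => h.
  move/negP: xB; apply; rewrite inE => i; rewrite /= in_itv/=.
  have [t tx] := corner_obox h; have /andP[h1 h2] := tx i.
  move: h1 h2; rewrite ffunE/= => h1 h2; apply/andP; split.
    by rewrite (le_trans _ h1)// mulr_ge0// ltW// mesh_gt0.
  (* The cell starting at multiple [t i + 1] of the mesh ends at [t i + 2], at most [m + 1], hence
     still inside [[0, l]]. *)
  apply: (le_trans (ltW h2)); rewrite -[leRHS](mesh_size m) ler_pM2r ?mesh_gt0//.
  by rewrite -[leLHS]/(((t i).+1%:R + 1)) natr1 ler_nat ltnS ltn_ord.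
have mg m : measurable_fun setT (fun x => (g m x)%:E).
  rewrite -[X in measurable_fun _ X]/(EFin \o g m) gE.
  by apply: measurable_int; apply: (integrable_sum measurableT) => t _; exact: int_ind.
have [||||if_ _] := @dominated_convergence _ _ _ vol setT measurableT
  (fun m x => (g m x)%:E) (EFin \o f) (fun x => (C * \1_B x)%:E) mg.
- exact/measurable_EFinP.
- apply: aeW => x _; apply: cvg_EFin; last exact: Ff.
  by apply: nearW => m; rewrite fin_numE.
- exact: integrable_cst_indic.
- by apply: aeW => x m _; exact: dom.
under eq_fun do rewrite ig.
rewrite -[X in _ --> X](fineK (integrable_fin_num measurableT if_)).
by move=> /fine_cvg.
Qed.

End riemann_sums.
End integration.

(** * The Dirichlet form as a limit of grid forms *)

Section form_limit.
Context {R : realType} {n : nat}.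
Implicit Types (f g phi psi : 'rV[R]_n -> R) (A : set 'rV[R]_n).
Local Notation vol := (@lebesgue_rV R n).

Lemma cvg_finsum (I : finType) (u : I -> nat -> R) (a : I -> R) :
  (forall i, u i m @[m --> \oo] --> a i) ->
  \sum_i u i m @[m --> \oo] --> \sum_i a i.
Proof.
move=> ua; elim: (index_enum I) => [|i r IH].
  by rewrite big_nil; under eq_fun do rewrite big_nil; exact: cvg_cst.
rewrite big_cons; under eq_fun do rewrite big_cons.
by apply: cvgD => //; exact: ua.
Qed.

Variable l : R.
Hypothesis l0 : 0 < l.

Definition neg_lap_diff m phi x : R := (mesh l m) ^- 2 *
  \sum_(i < n) (2 * phi x - phi (x + mesh l m *: delta_mx 0 i)
                - phi (x - mesh l m *: delta_mx 0 i)).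

(** A neighbour missing from the grid lies on a face of the cube, where [phi] vanishes, so the
    second difference has the same shape at every node. *)
Lemma grid_lap_node m phi (t : {ffun 'I_n -> 'I_m}) :
  (forall x, ~ obox l x -> phi x = 0) ->
  (mesh l m) ^- 2 * grid_lap (fun t => phi (node l t)) t = neg_lap_diff m phi (node l t).
Proof.
move=> phi0; congr (_ * _); apply: eq_bigr => i _.
set x := node l t; set e := mesh l m.
pose G (a : nat) := phi (x + (a%:R * e - x 0 i) *: delta_mx 0 i).
have xi : x 0 i = (t i).+1%:R * e by rewrite mxE.
have co a : (x + (a%:R * e - x 0 i) *: delta_mx 0 i) 0 i = a%:R * e.
  by rewrite !mxE !eqxx mulr1 addrC subrK.
have nodeE j : node l (upd t i j) = x + (j.+1%:R * e - x 0 i) *: delta_mx 0 i.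
  apply/rowP => k; have [->|ki] := eqVneq k i; first by rewrite co mxE upd_at.
  by rewrite !mxE ffunE (negbTE ki) mulr0 addr0.
under eq_bigr do rewrite nodeE -/(G _.+1).
rewrite path_lapE; first last.
- rewrite /G phi0// => /(_ i); rewrite co => /andP[_].
  by rewrite mesh_size ltxx.
- by rewrite /G phi0// => /(_ i); rewrite co mul0r ltxx.
rewrite /G xi subrr scale0r addr0; congr (2 * _ - phi (_ + _) - phi (_ + _)).
  by rewrite -mulrBl -natrB// subSnn mul1r.
by rewrite -mulrBl -(@natr1 R (t i)) opprD addrA subrr add0r mulN1r scaleNr.
Qed.

(** The factor 2 allows one mesh width from [x] to the corner of its cell and another from there to
    an intermediate point of the mean value theorem. *)
Lemma mesh_near_cvg (y : nat -> 'rV[R]_n) f x : continuous f ->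
  (forall m, `|y m - x| <= 2 * mesh l m) -> f (y m) @[m --> \oo] --> f x.
Proof.
move=> cf yx; apply: (@cvg_comp _ _ _ y f _ (nbhs x)); last exact: cf.
apply/cvgrPdist_lt => e e0.
have /cvgrPdist_lt/(_ (e / 2)) := mesh_cvg l; rewrite divr_gt0// => /(_ isT).
apply: filterS => m; rewrite sub0r normrN gtr0_norm ?mesh_gt0// => me.
by rewrite distrC (le_lt_trans (yx m))//; lra.
Qed.

Lemma corner_near m (x : 'rV[R]_n) : `|corner l m x - x| <= 2 * mesh l m.
Proof.
apply: ltW; apply: (lt_le_trans (corner_dist l0 m x)).
by have := mesh_gt0 l0 m; lra.
Qed.

(** [second_difference] provides what [riemann_sum] asks for: a bound by second derivatives that is
    uniform in the mesh, and the pointwise limit. *)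
Lemma form_riemann psi phi : smooth_in (obox l) psi -> smooth_in (obox l) phi ->
  mesh l m ^+ n * \sum_(t : {ffun 'I_n -> 'I_m}) psi (node l t) *
     (mesh l m ^- 2 * grid_lap (fun t => phi (node l t)) t) @[m --> \oo]
  --> ip psi (\- laplacian phi).
Proof.
move=> spsi sphi; have [spsi1 _] := spsi; have [sphi1 _] := sphi.
have bo := @obox_bounded R n l.
have [C1 C10 psiC] := smooth_in_bounded bo spsi.
have [M MC] : exists M : 'I_n -> R, forall i x, `|partial i (partial i phi) x| <= M i.
  have H i : exists M, forall x, `|partial i (partial i phi) x| <= M.
    have [M _ HM] := smooth_in_bounded bo (smooth_in_partial i (smooth_in_partial i sphi)).
    by exists M.
  by have [M HM] := choice H; exists M.
have sd m x i : exists t : R, `|t| <= mesh l m /\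
    mesh l m ^- 2 * (2 * phi x - phi (x + mesh l m *: delta_mx 0 i)
                - phi (x - mesh l m *: delta_mx 0 i)) =
    - partial i (partial i phi) (x + t *: delta_mx 0 i).
  have e0 := mesh_gt0 l0 m.
  have [t te h] := second_difference x i sphi1 e0; exists t; split=> //.
  rewrite (_ : _ - _ - _ = - (mesh l m ^+ 2 * partial i (partial i phi) (x + t *: delta_mx 0 i))).
    by rewrite mulrN mulrA mulVf ?mul1r// expf_neq0// lt0r_neq0.
  by rewrite -h; ring.
rewrite (_ : (fun m => _) = (fun m => mesh l m ^+ n * \sum_(t : {ffun 'I_n -> 'I_m})
    psi (node l t) * neg_lap_diff m phi (node l t))); last first.
  apply/funext => m; congr (_ * _); apply: eq_bigr => t _; rewrite grid_lap_node//.
  by move=> x; exact: smooth_in_out.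
apply: (@riemann_sum R n l l0 (fun m x => psi x * neg_lap_diff m phi x)
  (fun x => psi x * (\- laplacian phi) x) (C1 * \sum_i M i)).
- apply: measurable_funM; apply: continuous_measurable_rV.
    exact: smooth_continuous.
  apply: contN; exact/smooth_continuous/smooth_laplacian.
- move=> m x; rewrite normrM ler_pM// /neg_lap_diff mulr_sumr.
  rewrite (le_trans (ler_norm_sum _ _ _))//; apply: ler_sum => i _.
  by have [t [_ ->]] := sd m x i; rewrite normrN.
- by move=> m x xl; rewrite (smooth_in_out spsi xl) mul0r.
move=> x.
apply: cvgM.
  by apply: mesh_near_cvg => [|m]; [exact: smooth_continuous|exact: corner_near].
rewrite /laplacian /= -sumrN /neg_lap_diff; under eq_cvg do rewrite mulr_sumr.
apply: cvg_finsum => i.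
have [t tE] := choice (fun m => sd m (corner l m x) i).
under eq_cvg => m do rewrite (tE m).2.
apply: cvgN; apply: (mesh_near_cvg (y := fun m => corner l m x + t m *: delta_mx 0 i)
  (f := partial i (partial i phi))).
  by apply: smooth_continuous; do 2 apply: smooth_partial.
move=> m; rewrite addrAC (le_trans (ler_normD _ _))//.
rewrite mulrDl mul1r lerD//; first by rewrite ltW// corner_dist.
apply: le_trans (tE m).1; rewrite normrZ -[leRHS]mulr1 ler_wpM2l//.
apply: norm_le_coord => // j; rewrite mxE/=.
by case: eqP => _; rewrite ?normr1 ?normr0.
Qed.

Lemma ip_riemann psi phi : smooth_in (obox l) psi -> smooth_in (obox l) phi ->
  mesh l m ^+ n * \sum_(t : {ffun 'I_n -> 'I_m}) psi (node l t) * phi (node l t)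
    @[m --> \oo] --> ip psi phi.
Proof.
move=> spsi sphi; have [spsi1 _] := spsi; have [sphi1 _] := sphi.
have bo := @obox_bounded R n l.
have [C1 C10 psiC] := smooth_in_bounded bo spsi.
have [C2 C20 phiC] := smooth_in_bounded bo sphi.
have cM : continuous (fun x => psi x * phi x).
  by apply: contM; exact: smooth_continuous.
apply: (@riemann_sum R n l l0 (fun m x => psi x * phi x)
  (fun x => psi x * phi x) (C1 * C2)).
- exact: continuous_measurable_rV.
- by move=> m x; rewrite normrM ler_pM.
- by move=> m x xl; rewrite (smooth_in_out spsi xl) mul0r.
by move=> x; apply: (mesh_near_cvg (y := fun m => corner l m x)
  (f := fun x => psi x * phi x)) => // m; exact: corner_near.
Qed.

(** Green's identity without integration by parts: the grid forms are symmetric at every mesh, and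
    their limit inherits this. *)
Lemma form_sym_obox psi phi : smooth_in (obox l) psi -> smooth_in (obox l) phi ->
  ip psi (\- laplacian phi) = ip phi (\- laplacian psi).
Proof.
move=> s1 s2; have h1 := form_riemann s1 s2; have h2 := form_riemann s2 s1.
rewrite -(cvg_lim _ h1)// -(cvg_lim _ h2)//; congr (lim (_ @ \oo)).
apply/funext => m; congr (_ * _).
under eq_bigr do rewrite mulrCA; under [RHS]eq_bigr do rewrite mulrCA.
by rewrite -!mulr_sumr grid_form_sym.
Qed.

Lemma form_ge0_obox phi : smooth_in (obox l) phi -> 0 <= ip phi (\- laplacian phi).
Proof.
move=> s1; have h1 := form_riemann s1 s1.
rewrite -(cvg_lim _ h1)//; apply: limr_ge; first by apply/cvg_ex; eexists; exact: h1.
apply: nearW => m; rewrite mulr_ge0//.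
  by rewrite exprn_ge0// ltW// mesh_gt0.
under eq_bigr do rewrite mulrCA.
by rewrite -mulr_sumr mulr_ge0 ?grid_form_ge0// invr_ge0 sqr_ge0.
Qed.

End form_limit.

(** * Eigenvalue count on a cube *)

Section quadratic_forms.
Context {R : realType} {I : finType}.
Implicit Types (c : I -> R) (Q : I -> I -> R).

Definition quad Q c : R := \sum_i \sum_j c i * c j * Q i j.

Definition posdef Q := forall c, (exists i, c i != 0) -> 0 < quad Q c.

Lemma quadZ Q (a : R) c : quad Q (fun i => a * c i) = a ^+ 2 * quad Q c.
Proof.
rewrite /quad mulr_sumr; apply: eq_bigr => i _; rewrite mulr_sumr.
by apply: eq_bigr => j _; ring.
Qed.

(** By homogeneity the unit sphere suffices. It is compact, so [quad Q] has a positive minimum [eta]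
    on it; in the sup norm all coordinates are at most 1, so entries with total deviation below
    [eta] keep the form positive. *)
Lemma posdef_near Q (Qm : nat -> I -> I -> R) :
  (forall i j, Qm m i j @[m --> \oo] --> Q i j) -> posdef Q ->
  \forall m \near \oo, posdef (Qm m).
Proof.
move=> QmQ pQ; pose V := 'rV[R]_#|I|.
pose co (x : V) : I -> R := fun i => x 0 (enum_rank i).
pose S : set V := [set x | `|x| = 1].
have normal c : (exists i, c i != 0) -> exists a (x : V),
    [/\ S x, 0 < a & forall i, c i = a * co x i].
  move=> [i ci]; pose y : V := \row_k c (enum_val k).
  have y0 : 0 < `|y|.
    rewrite normr_gt0; apply/rV0Pn; exists (enum_rank i).
    by rewrite mxE enum_rankK.
  exists `|y|, (`|y|^-1 *: y); split => //.
    by rewrite /S /= normrZ ger0_norm ?invr_ge0// mulVf// lt0r_neq0.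
  by move=> j; rewrite /co !mxE enum_rankK mulrA divff ?mul1r// lt0r_neq0.
have qco Q' x : quad Q' (co x) = \sum_i \sum_j co x i * co x j * Q' i j by [].
have [S0|S0] := pselect (S !=set0); last first.
  by apply: nearW => m c /normal[a [x [Sx _ _]]]; case: S0; exists x.
have cS : compact S.
  apply: bounded_closed_compact.
    exists 1; split; first exact: num_real.
    by move=> M M1 x; rewrite /S /= => ->; exact: ltW.
  apply: (@closed_comp _ _ (fun x : V => `|x|) [set t | t = 1]).
    by move=> x _; exact: norm_continuous.
  exact: closed_eq.
have ccoef i : continuous (fun x : V => co x i) by move=> x; exact: coord_continuous.
have cq : continuous (fun x : V => quad Q (co x)).
  apply: cont_sum => i; apply: cont_sum => j.
  by apply: contM; [apply: contM; exact: ccoef|exact: cont_cst].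
have [x0] := EVT_min_rV S0 cS (continuous_subspaceT cq).
rewrite inE => Sx0 min0; set eta := quad Q (co x0) in min0.
have eta0 : 0 < eta.
  apply: pQ; have : x0 != 0 by rewrite -normr_gt0 Sx0.
  by move=> /rV0Pn[k xk]; exists (enum_val k); rewrite /co enum_valK.
pose D m := \sum_i \sum_j `|Qm m i j - Q i j|.
have D0 : D m @[m --> \oo] --> (0 : R).
  have -> : (0 : R) = \sum_(i : I) \sum_(j : I) 0.
    by rewrite big1// => i _; rewrite big1.
  apply: cvg_finsum => i; apply: cvg_finsum => j.
  rewrite -(normr0 R) -(subrr (Q i j)); apply: cvg_norm.
  by apply: cvgB; [exact: QmQ|exact: cvg_cst].
have /cvgrPdist_lt/(_ _ eta0) := D0; apply: filterS => m.
rewrite sub0r normrN ger0_norm; last by do 2 apply: sumr_ge0 => ? _.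
move=> Dm c /normal[a [x [Sx a0 cE]]].
rewrite (_ : quad _ c = quad (Qm m) (fun i => a * co x i)); last first.
  by congr (quad _ _); apply/funext.
rewrite quadZ mulr_gt0 ?exprn_gt0//.
have : eta <= quad Q (co x) by apply: min0; rewrite inE.
have xle i : `|co x i| <= 1 by rewrite -Sx; exact: coord_le_norm.
suff : quad Q (co x) - quad (Qm m) (co x) <= D m by lra.
rewrite /quad -sumrB; apply: ler_sum => i _; rewrite -sumrB; apply: ler_sum => j _.
rewrite -mulrBr (le_trans (ler_norm _))// normrM distrC.
by rewrite -[leRHS]mul1r ler_wpM2r// normrM mulr_ile1.
Qed.

End quadratic_forms.

Section cube.
Context {R : realType} {n : nat}.
Local Notation vol := (@lebesgue_rV R n).

(** Distinct cells of one size are disjoint, so the volume of [B] limits how many fit inside. *)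
Lemma card_cells_le (T : finType) (D : pred T) (z : T -> {ffun 'I_n -> int})
    (e : R) (B : set 'rV[R]_n) : 0 < e -> injective z -> measurable B ->
  (forall t, D t -> cell e (z t) `<=` B) -> ((#|D|%:R * e ^+ n)%:E <= vol B)%E.
Proof.
move=> e0 zi mB DB.
have tD : trivIset [set` enum D] (fun t => cell e (z t)).
  move=> s t _ _ [x [/(cellP _ _ e0) h1 /(cellP _ _ e0) h2]].
  by apply: zi; rewrite -h1 -h2.
have mD t : [set` enum D] t -> measurable (cell e (z t)).
  by move=> _; exact: measurable_cell.
apply: (@le_trans _ _ (vol (\bigcup_(t in [set` enum D]) cell e (z t)))).
  rewrite measure_fin_bigcup// -fsbig_seq ?enum_uniq//=.
  rewrite (eq_bigr (fun=> (e ^+ n)%:E)) => [|t _]; last by rewrite vol_cell.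
  by rewrite sumEFin big_const_seq count_predT -cardE iter_addr_0 mulr_natl.
apply: le_measure; rewrite ?inE//.
  by apply: fin_bigcup_measurable.
by apply: bigcup_sub => t /=; rewrite mem_enum => /DB.
Qed.

(** The one-term Weyl function per unit of volume, with the exponent [n / 2] written through the
    square root. *)
Definition weyl_density (lam : R) : R :=
  fine (vol unit_ball) / (2 * pi) ^+ n * Num.sqrt lam ^+ n.

Lemma enormZ (a : R) (x : 'rV[R]_n) : enorm (a *: x) = `|a| * enorm x.
Proof.
rewrite /enorm dotZl dotC dotZl mulrA -expr2 sqrtrM ?sqr_ge0//.
by rewrite sqrtr_sqr.
Qed.

Lemma measurable_ball (r : R) : measurable [set x : 'rV[R]_n | enorm x <= r].
Proof.
apply: measurable_closed.
apply: (@closed_comp _ _ (@enorm R n) [set t | t <= r]); last exact: closed_le.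
by move=> x _; exact: enorm_continuous.
Qed.

Lemma vol_ball (r : R) : 0 <= r ->
  vol [set x | enorm x <= r] = (r ^+ n * fine (vol unit_ball))%:E.
Proof.
rewrite le_eqVlt => /orP[/eqP<-|r0].
  (* Radius 0 is out of reach of the scaling argument. In dimension 0 the ball is the whole space
     and [0 ^+ 0] is 1; otherwise it is a null set. *)
  rewrite expr0n; case: (posnP n) => [n0|np].
    rewrite mul1r fineK ?vol_unit_ball_fin//; congr (vol _).
    apply/seteqP; split => x _; rewrite /unit_ball /= /enorm /dot big1 ?sqrtr0//;
      by move=> i; have := ltn_ord i; lia.
  rewrite mul0r; apply/eqP; rewrite eq_le measure_ge0 andbT.
  have := @vol_box_le R n [set x | enorm x <= 0] 0 0 (measurable_ball 0) (lexx 0).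
  rewrite expr0n (gtn_eqF np); apply => x /= x0 i; rewrite mxE addr0.
  have := le_trans (coord_le_enorm x i) x0; rewrite normr_le0 => /eqP ->.
  by rewrite lexx.
have := @vol_affine R n r^-1 0 unit_ball.
rewrite invr_gt0 r0 invrK => /(_ isT measurable_unit_ball).
rewrite EFinM fineK ?vol_unit_ball_fin// => <-; congr (vol _).
apply/seteqP; split => x /=;
  rewrite /unit_ball/= addr0 enormZ gtr0_norm ?invr_gt0// mulrC;
  by rewrite ler_pdivrMr// mul1r.
Qed.

(** A lattice point with positive entries is the outermost corner of a unit cell, so the cell lies
    in any centred ball containing the point. Reflections in the coordinate hyperplanes give
    [2 ^+ n] disjoint cells per point, and volume bounds their number. *)
Lemma lattice_count (b : nat) (s : R) : 0 <= s ->
  #|[pred k : {ffun 'I_n -> 'I_b} | (\sum_i ((k i).+1%:R : R) ^+ 2 <= s ^+ 2)%R]|%:R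
    * 2 ^+ n <= s ^+ n * fine (vol unit_ball).
Proof.
move=> s0; set D := [pred k | _].
pose T := ({ffun 'I_n -> 'I_b} * {ffun 'I_n -> bool})%type.
(* [p.2] chooses the sign of each coordinate; the reflection of the interval from [k] to [k + 1]
   starts at [- (k + 1)]. *)
pose z (p : T) : {ffun 'I_n -> int} :=
  [ffun i => if p.2 i then (p.1 i : int) else - (p.1 i).+1%:Z].
have zi : injective z.
  move=> [k u] [k' u'] /ffunP h.
  have hi i : k i = k' i /\ u i = u' i.
    have := h i; rewrite !ffunE/=; case: (u i); case: (u' i) => h'; split => //;
      by first [apply: ord_inj; lia | exfalso; lia].
  have -> : k = k' by apply/ffunP => a; have [] := hi a.
  by have -> : u = u' by apply/ffunP => a; have [] := hi a.
pose DT : pred T := [pred p | D p.1].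
have := @card_cells_le T DT z 1 [set x | enorm x <= s] ltr01 zi (measurable_ball s).
rewrite vol_ball// expr1n mulr1 lee_fin.
have -> : #|DT| = (#|D| * 2 ^ n)%N.
  rewrite (_ : #|DT| = #|[predX D & predT : pred {ffun 'I_n -> bool}]|).
    by rewrite cardX card_ffun card_bool card_ord.
  by apply: eq_card => -[k u]; rewrite !inE /= andbT.
rewrite natrM natrX; apply => -[k u]; rewrite /DT /= => kD x xz.
rewrite /= /enorm -(ger0_norm s0) -sqrtr_sqr ler_wsqrtr// (le_trans _ kD)//.
apply: ler_sum => i _; rewrite -expr2 -[x 0 i ^+ 2]real_normK ?num_real//.
rewrite ler_sqr ?nnegrE//; have := xz i; rewrite !ffunE/= !mulr1.
case: (u i) => /andP[h1 h2].
  rewrite ger0_norm ?(le_trans _ h1)//.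
  by rewrite -natr1 ltW.
rewrite ler_norml; apply/andP; split; first by rewrite (le_trans _ h1)// mulrNz.
apply: (le_trans (ltW h2)); rewrite mulrNz -[(_.+1)%:~R]/(_.+1%:R) -natr1.
have : 0 <= (k i)%:R :> R by []. lra.
Qed.

End cube.

(** * Low grid eigenvalues and lattice points in a ball *)

Section low_modes.
Context {R : realType}.

(** The lower bound [x ^+ 2 * cos (x / 2) ^+ 2] at the angle [x = pi * a / (m + 1)], divided by the
    squared mesh. It tends to the eigenvalue of the interval. *)
Definition scaled_mode (l : R) (a m : nat) : R :=
  (pi * a%:R / l) ^+ 2 * cos (pi * a%:R / 2 * (m.+1%:R)^-1) ^+ 2.

Lemma scaled_mode_cvg (l : R) a :
  scaled_mode l a m @[m --> \oo] --> (pi * a%:R / l) ^+ 2.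
Proof.
have h1 : (pi * a%:R / 2 : R) * (m.+1%:R)^-1 @[m --> \oo] --> (0 : R).
  by rewrite -[X in _ --> X](mulr0 (pi * a%:R / 2)); apply: cvgMr; exact: cvg_harmonic.
have h : cos (pi * a%:R / 2 * (m.+1%:R)^-1) @[m --> \oo] --> cos (0 : R).
  by apply: continuous_cvg => //; exact: continuous_cos.
have -> : (pi * a%:R / l) ^+ 2 = (pi * a%:R / l) ^+ 2 * (cos 0 * cos 0) :> R.
  by rewrite cos0 !mulr1.
by apply: cvgMr; apply: cvgM.
Qed.

(* Half-angle formula, and [sin y >= y * cos y] by the mean value theorem. *)
Lemma one_sub_cos_ge (x : R) : 0 <= x <= pi ->
  x ^+ 2 * cos (x / 2) ^+ 2 <= 2 - 2 * cos x.
Proof.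
move=> /andP[x0 xpi].
have -> : 2 - 2 * cos x = 4 * sin (x / 2) ^+ 2.
  have -> : cos x = cos ((x / 2) *+ 2) by congr cos; rewrite -mulr_natr divfK.
  by rewrite cos_mulr2n -[cos _ ^+ 2](addrK (sin (x / 2) ^+ 2)) cos2Dsin2; ring.
move: x0; rewrite le_eqVlt => /orP[/eqP<-|x0].
  by rewrite expr0n/= mul0r mulr_ge0// sqr_ge0.
have y0 : 0 < x / 2 by rewrite divr_gt0.
have [c /andP[c0 cy]] := mean_value y0 (fun t => @is_derive_sin R t).
rewrite sin0 !subr0 => ->.
rewrite [leRHS](_ : _ = x ^+ 2 * cos c ^+ 2); last by field.
apply: ler_wpM2l; first exact: sqr_ge0.
have cge : cos (x / 2) <= cos c.
  by apply/ltW; rewrite ltr_cos// in_itv/=; apply/andP; split; lra.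
rewrite ler_sqr ?nnegrE//.
all: by apply: cos_ge0_pihalf; apply/andP; split; lra.
Qed.

Lemma path_eigval_ge (l : R) m (k : 'I_m) : 0 < l ->
  mesh l m ^+ 2 * scaled_mode l k.+1 m <= path_eigval k.
Proof.
move=> l0; have /andP[a0 a1] := @angle_itv R m k.
apply: le_trans (one_sub_cos_ge _); last by rewrite !ltW.
rewrite /scaled_mode mulrA -exprMn /mesh /angle.
have -> : l / m.+1%:R * (pi * (k.+1)%:R / l) = pi * k.+1%:R / m.+1%:R :> R.
  by field; rewrite lt0r_neq0//= lt0r_neq0.
by rewrite (_ : pi * k.+1%:R / 2 / m.+1%:R = pi * k.+1%:R / m.+1%:R / 2)// mulrAC.
Qed.

Lemma path_eigval_mono m (k : 'I_m) (a : nat) : (a <= k)%N ->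
  2 - 2 * cos (pi * a.+1%:R / m.+1%:R) <= path_eigval k :> R.
Proof.
move=> ak; rewrite lerB// ler_pM2l//.
have /andP[a0 a1] := @angle_itv R m k.
have h : pi * a.+1%:R / m.+1%:R <= angle k :> R.
  by rewrite /angle ler_pM2r// ler_pM2l ?pi_gt0// ler_nat.
move: h; rewrite le_eqVlt => /orP[/eqP->//|h].
apply/ltW; rewrite ltr_cos// in_itv/= !ltW ?(lt_trans h)//.
by rewrite divr_gt0// mulr_gt0// pi_gt0.
Qed.

(** A mode with a coordinate beyond [b] exceeds [lam] by monotonicity in that coordinate alone. Of
    the finitely many remaining frequency vectors, those outside the ball have a limit eigenvalue
    strictly above [lam], so they exceed it too once the mesh is fine. *)
Lemma low_modes n (l lam : R) : 0 < l -> 0 <= lam ->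
  exists b : nat, \forall m \near \oo,
  (#|[pred t : {ffun 'I_n -> 'I_m} | (grid_eigval t < lam * mesh l m ^+ 2)%R]| <=
   #|[pred k : {ffun 'I_n -> 'I_b} |
       (\sum_i ((k i).+1%:R : R) ^+ 2 <= (l * Num.sqrt lam / pi) ^+ 2)%R]|)%N.
Proof.
move=> l0 lam0; set s := l * Num.sqrt lam / pi.
have pi0 : pi != 0 :> R by rewrite lt0r_neq0 ?pi_gt0.
have ln0 : l != 0 by rewrite lt0r_neq0.
(* Ordinals below [b.+1] stand for the frequencies 1 to [b + 1]. The next one, [b + 2], exceeds [s],
   which gives the strict inequality [sb]. *)
pose b := Num.truncn s; exists b.+1.
have sb : lam < (pi * b.+2%:R / l) ^+ 2.
  rewrite -[ltLHS](sqr_sqrtr lam0) ltr_sqr ?nnegrE ?sqrtr_ge0//; last first.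
    by rewrite divr_ge0 ?mulr_ge0 ?pi_ge0// ltW.
  rewrite ltr_pdivlMr// mulrC [ltRHS]mulrC -ltr_pdivrMr ?pi_gt0// -/s.
  by apply: (lt_trans (truncnS_gt s)); rewrite ltr_nat.
have scale (x : R) : (pi * x / l) ^+ 2 = (pi / l) ^+ 2 * x ^+ 2.
  by rewrite -exprMn mulrAC.
have N1 : \forall m \near \oo, lam < scaled_mode l b.+2 m.
  by apply: (cvgr_gt _ (scaled_mode_cvg (l := l) (a := b.+2))); exact: sb.
have N2 : \forall m \near \oo, forall k : {ffun 'I_n -> 'I_b.+1},
    s ^+ 2 < \sum_i ((k i).+1%:R : R) ^+ 2 -> lam < \sum_i scaled_mode l (k i).+1 m.
  apply: filter_forall => k; apply: filter_imply => sk.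
  have : lam < \sum_i (pi * (k i).+1%:R / l) ^+ 2.
    under eq_bigr do rewrite scale.
    rewrite -mulr_sumr mulrC -ltr_pdivrMr ?exprn_gt0 ?divr_gt0 ?pi_gt0//.
    apply: le_lt_trans sk; rewrite /s !exprMn sqr_sqrtr// !exprVn.
    rewrite le_eqVlt; apply/orP; left; apply/eqP.
    by move: pi0; generalize (pi : R) => p p0; field; rewrite p0 ln0.
  apply: cvgr_gt; apply: cvg_finsum => i; exact: scaled_mode_cvg.
have N3 : \forall m \near \oo, (b.+2 <= m)%N by exists b.+2.
near=> m.
have h1 : lam < scaled_mode l b.+2 m by near: m.
have h2 : forall k : {ffun 'I_n -> 'I_b.+1},
  s ^+ 2 < \sum_i ((k i).+1%:R : R) ^+ 2 -> lam < \sum_i scaled_mode l (k i).+1 m.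
  by near: m.
have h3 : (b.+2 <= m)%N by near: m.
have m0 : 0 < mesh l m by exact: mesh_gt0.
pose D := [pred t : {ffun 'I_n -> 'I_m} | grid_eigval t < lam * mesh l m ^+ 2].
pose f (t : {ffun 'I_n -> 'I_m}) : {ffun 'I_n -> 'I_b.+1} := [ffun i => inord (t i)].
have small t : t \in D -> forall i, (t i < b.+1)%N.
  rewrite inE => tD i; rewrite ltnNge; apply/negP => bt.
  move: tD; apply/negP; rewrite -leNgt /grid_eigval (bigD1 i)//=.
  apply: ler_wpDr; first by apply: sumr_ge0 => j _; exact: path_eigval_ge0.
  apply: le_trans (path_eigval_mono bt); rewrite mulrC.
  apply: (@le_trans _ _ (mesh l m ^+ 2 * scaled_mode l b.+2 m)).
    by rewrite ler_pM2l ?exprn_gt0// ltW.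
  have bm : (b.+1 < m)%N by [].
  exact: (@path_eigval_ge l m (Ordinal bm) l0).
have fi : {in D &, injective f}.
  move=> t u tD uD /ffunP tu; apply/ffunP => i; apply: val_inj.
  have := congr1 val (tu i); rewrite !ffunE /= !inordK//.
  - exact: small.
  - exact: small.
rewrite -(card_in_image fi); apply: subset_leq_card; apply/fintype.subsetP => k.
move=> /fintype.imageP[t tD ->]; rewrite inE leNgt; apply/negP => /h2.
under eq_bigr do rewrite ffunE inordK ?small//.
move=> h; have := tD; rewrite inE; apply/negP; rewrite -leNgt mulrC.
apply: (@le_trans _ _ (mesh l m ^+ 2 * \sum_i scaled_mode l (t i).+1 m)).
  by rewrite ler_pM2l ?exprn_gt0// ltW.
by rewrite mulr_sumr; apply: ler_sum => i _; exact: path_eigval_ge.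
Unshelve. all: by end_near.
Qed.

End low_modes.

Section cube_count.
Context {R : realType} {n : nat}.

Lemma quad_sum (T I : finType) (c : I -> R) (f g : I -> T -> R) :
  \sum_i \sum_j c i * c j * (\sum_t f i t * g j t) =
  \sum_t (\sum_i c i * f i t) * (\sum_j c j * g j t).
Proof.
under [RHS]eq_bigr do rewrite mulr_suml.
rewrite [RHS]exchange_big/=; apply: eq_bigr => i _.
under [RHS]eq_bigr do rewrite mulr_sumr.
rewrite [RHS]exchange_big/=; apply: eq_bigr => j _.
by rewrite mulr_sumr; apply: eq_bigr => t _; ring.
Qed.

Lemma grid_lap_sum (I : finType) m (c : I -> R) (f : I -> {ffun 'I_n -> 'I_m} -> R) t :
  grid_lap (fun t => \sum_i c i * f i t) t = \sum_i c i * grid_lap (f i) t.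
Proof.
rewrite /grid_lap; under [RHS]eq_bigr do rewrite mulr_sumr.
rewrite [RHS]exchange_big/=; apply: eq_bigr => a _.
under [RHS]eq_bigr do rewrite mulr_sumr.
rewrite [RHS]exchange_big/=; apply: eq_bigr => j _.
by rewrite mulr_sumr; apply: eq_bigr => i _; rewrite mulrCA.
Qed.

(** On some fine grid the samples still give a positive definite matrix; [grid_minmax] then bounds
    [#|I|] by the number of low modes, and [lattice_count] bounds these. The constant
    [(2 * pi) ^+ n] combines the frequency step [pi / l] with the [2 ^+ n] reflections. *)
Lemma cube_count (I : finType) (v : I -> 'rV[R]_n -> R) (l lam : R) :
  0 < l -> 0 <= lam -> (forall i, smooth_in (obox l) (v i)) ->
  posdef (fun i j => lam * ip (v i) (v j) - ip (v i) (\- laplacian (v j))) ->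
  #|I|%:R <= @weyl_density R n lam * l ^+ n.
Proof.
move=> l0 lam0 sv pQ.
pose Qm m i j := lam * (mesh l m ^+ n * \sum_(t : {ffun 'I_n -> 'I_m})
    v i (node l t) * v j (node l t)) -
  mesh l m ^+ n * \sum_(t : {ffun 'I_n -> 'I_m}) v i (node l t) *
     (mesh l m ^- 2 * grid_lap (fun t => v j (node l t)) t).
have N1 : \forall m \near \oo, posdef (Qm m).
  apply: posdef_near pQ => i j; apply: cvgB.
    by apply: cvgMr; exact: ip_riemann.
  exact: form_riemann.
have [b N2] := @low_modes R n l lam l0 lam0.
have [m [pm hm]] : exists m, posdef (Qm m) /\
  (#|[pred t : {ffun 'I_n -> 'I_m} | (grid_eigval t < lam * mesh l m ^+ 2)%R]| <=
   #|[pred k : {ffun 'I_n -> 'I_b} |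
       (\sum_i ((k i).+1%:R : R) ^+ 2 <= (l * Num.sqrt lam / pi) ^+ 2)%R]|)%N.
  apply: (@filter_ex _ \oo); apply: filterI; [exact: N1|exact: N2].
have m0 : 0 < mesh l m by exact: mesh_gt0.
have s0 : 0 <= l * Num.sqrt lam / pi.
  by rewrite divr_ge0 ?mulr_ge0 ?sqrtr_ge0 ?pi_ge0// ltW.
have := @lattice_count R n b _ s0.
set J := #|[pred k : {ffun 'I_n -> 'I_b} | _]| in hm * => hJ.
have IJ : (#|I| <= J)%N.
  apply: leq_trans hm.
  apply: (@grid_minmax R m n I (fun i t => v i (node l t))) => c /pm h /=.
  pose w (t : {ffun 'I_n -> 'I_m}) := \sum_i c i * v i (node l t).
  rewrite -[ltLHS]/(\sum_t w t * grid_lap w t) -[X in _ < _ * X]/(\sum_t w t * w t).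
  have E : quad (Qm m) c = mesh l m ^+ n * mesh l m ^- 2 *
     (lam * mesh l m ^+ 2 * (\sum_t w t * w t) - \sum_t w t * grid_lap w t).
    rewrite /w; under [X in _ = _ * (_ - X)]eq_bigr do rewrite grid_lap_sum.
    rewrite -!quad_sum mulrBr !mulr_sumr -sumrB; apply: eq_bigr => i _.
    rewrite !mulr_sumr -sumrB; apply: eq_bigr => j _.
    rewrite /Qm; under [X in _ - _ * X]eq_bigr do rewrite mulrCA.
    rewrite -mulr_sumr; field; exact: lt0r_neq0.
  move: h; rewrite E pmulr_rgt0 ?subr_gt0//.
  by rewrite mulr_gt0 ?exprn_gt0// invr_gt0 exprn_gt0.
apply: (@le_trans _ _ J%:R); first by rewrite ler_nat.
rewrite -(@ler_pM2r _ (2 ^+ n)) ?exprn_gt0//; apply: (le_trans hJ).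
rewrite /weyl_density !exprMn exprVn le_eqVlt; apply/orP; left; apply/eqP.
have : pi != 0 :> R by rewrite lt0r_neq0 ?pi_gt0.
by generalize (pi : R) => p p0; field; rewrite ?expf_neq0.
Qed.

End cube_count.

(** * The Dirichlet form and approximation of eigenfunctions *)

Section bounded_support_forms.
Context {R : realType} {n : nat}.
Implicit Types (f g phi psi : 'rV[R]_n -> R) (A : set 'rV[R]_n).

Lemma isometry_bounded (O : 'M[R]_n) (b : 'rV[R]_n) A : O *m O^T = 1%:M ->
  bounded_set A -> bounded_set [set x | A (x *m O + b)].
Proof.
move=> OO [M [_ /(_ (`|M| + 1))]]; rewrite (le_lt_trans (ler_norm M)) ?ltrDl//.
move=> /(_ isT) AM; set M' := `|M| + 1 + `|b|.
exists (Num.sqrt (\sum_(i < n) M' * M')); split; first exact: num_real.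
move=> N MN x /= xA; apply: norm_le_coord => [|i].
  by rewrite (le_trans _ (ltW MN))// sqrtr_ge0.
apply: (le_trans (coord_le_enorm x i)); apply: le_trans (ltW MN).
rewrite /enorm ler_wsqrtr// -(dot_orthogonal x x OO); apply: ler_sum => j _.
rewrite -[leLHS]ger0_norm ?normrM; last by rewrite -expr2 sqr_ge0.
have : `|(x *m O) 0 j| <= M'.
  apply: (le_trans (coord_le_norm _ j)); rewrite -(addrK b (x *m O)).
  by rewrite (le_trans (ler_normB _ _))// lerD2r; exact: AM.
by move=> h; apply: ler_pM.
Qed.

Lemma ip_comp (O : 'M[R]_n) (b : 'rV[R]_n) A f g : O *m O^T = 1%:M ->
  bounded_set A -> smooth_in A f -> smooth_in A g ->
  ip (fun x => f (x *m O + b)) (fun x => g (x *m O + b)) = ip f g.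
Proof.
move=> OO bA sf sg.
apply: (@Rintegral_isometry R n (fun x => f x * g x) O b OO).
  have [sf1 _] := sf; have [sg1 _] := sg.
  by apply: measurable_funM; apply: continuous_measurable_rV; exact: smooth_continuous.
apply: (smooth_inM_integrable (isometry_bounded b OO bA)); exact: smooth_in_comp.
Qed.

Lemma smooth_in_neg_laplacian A f : smooth_in A f -> smooth_in A (\- laplacian f).
Proof.
move=> /smooth_in_laplacian/(smooth_inZ (-1)); congr (smooth_in A _).
by apply/funext => x /=; rewrite -[LHS]/(-1 * laplacian f x) mulN1r.
Qed.

Lemma neg_laplacian_comp (O : 'M[R]_n) (b : 'rV[R]_n) f : O *m O^T = 1%:M ->
  smooth_on setT f ->
  \- laplacian (fun x => f (x *m O + b)) = fun x => (\- laplacian f) (x *m O + b).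
Proof. by move=> OO sf; rewrite (laplacian_comp b OO sf). Qed.

Lemma translate_obox A : bounded_set A -> exists (l : R) (b : 'rV[R]_n),
  0 < l /\ [set x | A (x *m 1%:M + b)] `<=` obox l.
Proof.
move=> [M [_ /(_ (`|M| + 1))]]; rewrite (le_lt_trans (ler_norm M)) ?ltrDl//.
move=> /(_ isT) AM; have N0 := normr_ge0 M.
exists (2 * (`|M| + 2)), (const_mx (- (`|M| + 2))); split.
  by rewrite mulr_gt0// ltr_wpDl.
move=> x /= /AM; rewrite mulmx1 => xM i.
have := le_trans (coord_le_norm _ i) xM; rewrite !mxE ler_norml => /andP[h1 h2].
by apply/andP; split; lra.
Qed.

Lemma form_comp (O : 'M[R]_n) (b : 'rV[R]_n) A f g : O *m O^T = 1%:M ->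
  bounded_set A -> smooth_in A f -> smooth_in A g ->
  ip (fun x => f (x *m O + b)) (\- laplacian (fun x => g (x *m O + b))) =
  ip f (\- laplacian g).
Proof.
move=> OO bA sf sg; have [sg1 _] := sg.
exact: (etrans (congr1 (ip _) (neg_laplacian_comp b OO sg1))
  (ip_comp b OO bA sf (smooth_in_neg_laplacian sg))).
Qed.

(** Supports are bounded, so a translation carries them into a cube, where the grid argument
    applies. *)
Lemma form_sym A f g : bounded_set A -> smooth_in A f -> smooth_in A g ->
  ip f (\- laplacian g) = ip g (\- laplacian f).
Proof.
move=> bA sf sg; have [l [b [l0 Al]]] := translate_obox bA.
have OO : 1%:M *m (1%:M)^T = 1%:M :> 'M[R]_n by rewrite trmx1 mulmx1.
have sc h : smooth_in A h -> smooth_in (obox l) (fun x => h (x *m 1%:M + b)).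
  by move=> sh; apply: (smooth_in_sub Al); exact: smooth_in_comp.
exact: (etrans (esym (form_comp b OO bA sf sg))
  (etrans (form_sym_obox l0 (sc _ sf) (sc _ sg)) (form_comp b OO bA sg sf))).
Qed.

Lemma form_ge0 A f : bounded_set A -> smooth_in A f -> 0 <= ip f (\- laplacian f).
Proof.
move=> bA sf; have [l [b [l0 Al]]] := translate_obox bA.
have OO : 1%:M *m (1%:M)^T = 1%:M :> 'M[R]_n by rewrite trmx1 mulmx1.
have sc h : smooth_in A h -> smooth_in (obox l) (fun x => h (x *m 1%:M + b)).
  by move=> sh; apply: (smooth_in_sub Al); exact: smooth_in_comp.
have := form_ge0_obox l0 (sc _ sf).
by move=> h; apply: (le_trans h); rewrite le_eqVlt; apply/orP; left; apply/eqP;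
  exact: (form_comp b OO bA sf sf).
Qed.

End bounded_support_forms.

(** The case [c = 0] is included because the forms it serves are known to be nonnegative, not
    definite. *)
Lemma discriminant_le {R : realType} (a b c : R) : 0 <= c ->
  (forall t, 0 <= a + t * b *+ 2 + t ^+ 2 * c) -> b ^+ 2 <= a * c.
Proof.
rewrite le_eqVlt => /orP[/eqP<- h|c0 h].
  have [->|b0] := eqVneq b 0; first by rewrite expr0n mulr0.
  (* At this [t] the affine expression [a + t * b *+ 2] equals [-1]. *)
  have := h (- (a + 1) / (b *+ 2)); rewrite mulr0 addr0 -mulrnAr divfK.
    by move=> ?; exfalso; lra.
  by rewrite mulrn_eq0.
have cn := lt0r_neq0 c0; have := h (- b / c).
have -> : a + - b / c * b *+ 2 + (- b / c) ^+ 2 * c = (a * c - b ^+ 2) / c by field.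
by rewrite pmulr_lge0 ?invr_gt0// subr_ge0.
Qed.

(** * The pairing of square integrable functions *)

Section square_integrable.
Context {R : realType} {n : nat} (Omega : set 'rV[R]_n).
Hypothesis mO : measurable Omega.
Local Notation vol := (@lebesgue_rV R n).
Local Notation inner := (inner Omega).
Local Notation L2 := (L2 Omega).
Implicit Types (u v w : 'rV[R]_n -> R).

Lemma L2M_integrable u v : L2 u -> L2 v ->
  vol.-integrable Omega (EFin \o (fun x => u x * v x)).
Proof.
move=> [mu iu] [mv iv]; apply: (le_integrable mO _ _ (integrableD mO iu iv)).
  by apply/measurable_EFinP; exact: measurable_funM.
move=> x _; rewrite /= lee_fin normrM [leRHS]ger0_norm ?addr_ge0 ?sqr_ge0//.
rewrite -[u x ^+ 2]real_normK ?num_real// -[v x ^+ 2]real_normK ?num_real//.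
have := sqr_ge0 (`|u x| - `|v x|); rewrite sqrrB mulr2n.
by have := mulr_ge0 (normr_ge0 (u x)) (normr_ge0 (v x)); lra.
Qed.

Lemma L2D u v : L2 u -> L2 v -> L2 (fun x => u x + v x).
Proof.
move=> uL vL; have [mu iu] := uL; have [mv iv] := vL.
split; first exact: measurable_funD.
have iuv := L2M_integrable uL vL.
have := integrableD mO (integrableD mO iu iv) (integrableD mO iuv iuv).
apply: eq_integrable => // x _; rewrite /= -!EFinD; congr (_%:E); ring.
Qed.

Lemma L2Z (c : R) u : L2 u -> L2 (fun x => c * u x).
Proof.
move=> [mu iu]; split; first exact: measurable_funM.
have := integrableZl mO (c ^+ 2) iu.
by apply: eq_integrable => // x _; rewrite -EFinM exprMn.
Qed.

Lemma L2_0 : L2 (fun=> 0).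
Proof.
split; first exact: measurable_cst.
have := integrable0 vol Omega; apply: eq_integrable => // x _.
by rewrite expr0n.
Qed.

Lemma L2_sum (I : Type) (r : seq I) (c : I -> R) (u : I -> 'rV[R]_n -> R) :
  (forall i, L2 (u i)) -> L2 (fun x => \sum_(i <- r) c i * u i x).
Proof.
move=> uL; elim: r => [|i r IH].
  by under eq_fun do rewrite big_nil; exact: L2_0.
by under eq_fun do rewrite big_cons; apply: L2D => //; exact: L2Z.
Qed.

Lemma L2B u v : L2 u -> L2 v -> L2 (u \- v).
Proof.
move=> uL vL; have := L2D uL (L2Z (-1) vL); congr L2.
by apply/funext => x /=; rewrite mulN1r.
Qed.

Lemma innerC u v : inner u v = inner v u.
Proof. by apply: eq_Rintegral => x _; rewrite mulrC. Qed.

Lemma innerDl u v w : L2 u -> L2 v -> L2 w ->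
  inner (fun x => u x + v x) w = inner u w + inner v w.
Proof.
move=> uL vL wL; rewrite -RintegralD//; try exact: L2M_integrable.
by apply: eq_Rintegral => x _; rewrite mulrDl.
Qed.

Lemma innerZl (c : R) u w : L2 u -> L2 w ->
  inner (fun x => c * u x) w = c * inner u w.
Proof.
move=> uL wL; rewrite -RintegralZl//; last exact: L2M_integrable.
by apply: eq_Rintegral => x _; rewrite mulrA.
Qed.

Lemma innerBl u v w : L2 u -> L2 v -> L2 w ->
  inner (u \- v) w = inner u w - inner v w.
Proof.
move=> uL vL wL; rewrite -RintegralB//; try exact: L2M_integrable.
by apply: eq_Rintegral => x _; rewrite mulrBl.
Qed.

Lemma innerBr u v w : L2 u -> L2 v -> L2 w ->
  inner w (u \- v) = inner w u - inner w v.
Proof. by move=> uL vL wL; rewrite innerC innerBl// !(innerC w). Qed.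

Lemma inner_suml (I : Type) (r : seq I) (c : I -> R) (u : I -> 'rV[R]_n -> R) w :
  (forall i, L2 (u i)) -> L2 w ->
  inner (fun x => \sum_(i <- r) c i * u i x) w = \sum_(i <- r) c i * inner (u i) w.
Proof.
move=> uL wL; elim: r => [|i r IH].
  rewrite big_nil; under eq_fun do rewrite big_nil.
  transitivity (inner (fun x => 0 * w x) w); last by rewrite innerZl// mul0r.
  by apply: eq_Rintegral => x _; rewrite !mul0r.
under eq_fun do rewrite big_cons.
rewrite innerDl ?innerZl ?IH ?big_cons//; [exact: L2Z|exact: L2_sum].
Qed.

Lemma inner_quad (I : finType) (c d : I -> R) (u : I -> 'rV[R]_n -> R) :
  (forall i, L2 (u i)) ->
  inner (fun x => \sum_i c i * u i x) (fun x => \sum_i d i * u i x) =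
  \sum_i \sum_j c i * d j * inner (u i) (u j).
Proof.
move=> uL; rewrite inner_suml//; last exact: L2_sum.
apply: eq_bigr => i _; rewrite innerC inner_suml// mulr_sumr.
by apply: eq_bigr => j _; rewrite innerC mulrA.
Qed.

Lemma inner_ge0 u : 0 <= inner u u.
Proof. by apply: Rintegral_ge0 => x _; rewrite -expr2 sqr_ge0. Qed.

Lemma inner_CS u v : L2 u -> L2 v -> inner u v ^+ 2 <= inner u u * inner v v.
Proof.
move=> uL vL; apply: discriminant_le; first exact: inner_ge0.
move=> t; have := inner_ge0 (fun x => u x + t * v x).
have tvL := L2Z t vL.
rewrite innerDl//; last exact: L2D.
rewrite !(innerC _ (fun x => u x + _)) !innerDl// innerZl// (innerC u) !innerZl//.
by rewrite (innerC v (fun x => t * v x)) innerZl// (innerC v u); congr (_ <= _); ring.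
Qed.

Lemma inner_eq0 u : L2 u -> inner u u = 0 ->
  {ae vol, forall x, Omega x -> u x = 0}.
Proof.
move=> uL u0; have [mu iu] := uL.
have fin := integrable_fin_num mO (L2M_integrable uL uL).
have : (\int[vol]_(x in Omega) `|(u x * u x)%:E| = 0)%E.
  transitivity (\int[vol]_(x in Omega) (u x * u x)%:E)%E.
    by apply: eq_integral => x _; rewrite gee0_abs// lee_fin -expr2 sqr_ge0.
  by rewrite -[LHS]fineK// -[fine _]/(inner u u) u0.
have mu2 : measurable_fun Omega (fun x => (u x * u x)%:E).
  by apply/measurable_EFinP; exact: measurable_funM.
move/(ae_eq_integral_abs vol mO mu2); apply: filterS => x h /h[] /eqP.
by rewrite mulf_eq0 orbb => /eqP.
Qed.

Lemma sqr_le_cvg0 (x y : nat -> R) : (forall k, x k ^+ 2 <= y k) ->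
  y k @[k --> \oo] --> (0 : R) -> x k @[k --> \oo] --> (0 : R).
Proof.
move=> xy /cvgrPdist_lt y0; apply/cvgrPdist_lt => e e0.
have := y0 (e ^+ 2); rewrite exprn_gt0// => /(_ isT); apply: filterS => k.
rewrite !sub0r !normrN => h; have : `|x k| ^+ 2 < e ^+ 2.
  rewrite real_normK ?num_real//.
  by rewrite (le_lt_trans (xy k))// (le_lt_trans (ler_norm _)).
by rewrite ltr_sqr ?nnegrE// ltW.
Qed.

Lemma inner_cvg (a b : nat -> 'rV[R]_n -> R) u v :
  (forall k, L2 (a k)) -> (forall k, L2 (b k)) -> L2 u -> L2 v ->
  inner (a k \- u) (a k \- u) @[k --> \oo] --> (0 : R) ->
  inner (b k \- v) (b k \- v) @[k --> \oo] --> (0 : R) ->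
  inner (a k) (b k) @[k --> \oo] --> inner u v.
Proof.
move=> aL bL uL vL au bv.
(* Every term but the last contains a difference that tends to 0, and Cauchy-Schwarz controls it. *)
have E k : inner (a k) (b k) = inner (a k \- u) (b k \- v) + inner (a k \- u) v
    + inner (b k \- v) u + inner u v.
  have auL := L2B (aL k) uL; have bvL := L2B (bL k) vL.
  rewrite !innerBl// !innerBr// (innerC (b k) u) (innerC v u); ring.
suff : inner (a k \- u) (b k \- v) + inner (a k \- u) v + inner (b k \- v) u
    + inner u v @[k --> \oo] --> 0 + 0 + 0 + inner u v.
  by rewrite !add0r; under eq_fun do rewrite -E.
apply: cvgD; last exact: cvg_cst.
apply: cvgD; first apply: cvgD.
- apply: (sqr_le_cvg0 (y := fun k => inner (a k \- u) (a k \- u) * inner (b k \- v) (b k \- v))).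
    by move=> k; apply: inner_CS; exact: L2B.
  by rewrite -(mulr0 0); apply: cvgM.
- apply: (sqr_le_cvg0 (y := fun k => inner (a k \- u) (a k \- u) * inner v v)).
    by move=> k; apply: inner_CS => //; exact: L2B.
  by rewrite -(mul0r (inner v v)); apply: cvgMl.
- apply: (sqr_le_cvg0 (y := fun k => inner (b k \- v) (b k \- v) * inner u u)).
    by move=> k; apply: inner_CS => //; exact: L2B.
  by rewrite -(mul0r (inner u u)); apply: cvgMl.
Qed.

Lemma smooth_in_L2 phi : bounded_set Omega -> smooth_in Omega phi -> L2 phi.
Proof.
move=> bO sp; have [sp1 _] := sp; split.
  by apply: measurable_funTS; apply: continuous_measurable_rV; exact: smooth_continuous.
have := smooth_inM_integrable bO sp sp.
by apply: integrableS.
Qed.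

Lemma innerE u phi : smooth_in Omega phi -> inner phi u = ip phi u.
Proof.
move=> sp; rewrite /inner /ip /Rintegral; congr fine.
rewrite integral_mkcond; apply: eq_integral => x _; rewrite patchE.
by case: ifPn => //; rewrite notin_setE => /(smooth_in_out sp) ->; rewrite mul0r.
Qed.

End square_integrable.

#[local] Opaque laplacian.

(** * Eigenfunctions through form-Cauchy sequences *)

Section eigenfunction_approximation.
Context {R : realType} {n : nat} (Omega : set 'rV[R]_n).
Hypothesis cO : compact Omega.
Local Notation vol := (@lebesgue_rV R n).
Local Notation inner := (inner Omega).
Local Notation L2 := (L2 Omega).
Implicit Types (u v w phi psi : 'rV[R]_n -> R).

Let mO : measurable Omega.
Proof. by apply: measurable_closed; apply: compact_closed => //; exact: norm_hausdorff. Qed.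

Let bO : bounded_set Omega.
Proof. exact: compact_bounded. Qed.

(** The bilinear version of [form], with the Laplacian on the second argument to match the weak
    eigenvalue equation. *)
Definition dform phi psi : R := inner phi (\- laplacian psi).

Local Notation smooth := (smooth_in Omega).

Lemma test_smooth_in phi : test_function Omega phi -> smooth phi.
Proof. by move=> [sp h]; split => //; apply: subset_trans h _; exact: interior_subset. Qed.

Let sL2 phi : smooth phi -> L2 phi.
Proof. exact: smooth_in_L2. Qed.

Let slL2 phi : smooth phi -> L2 (\- laplacian phi).
Proof. by move=> sp; apply/sL2/smooth_in_neg_laplacian. Qed.

Lemma dformE phi psi : smooth phi -> dform phi psi = ip phi (\- laplacian psi).
Proof. by move=> sp; rewrite /dform innerE. Qed.

Lemma dformC phi psi : smooth phi -> smooth psi -> dform phi psi = dform psi phi.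
Proof. by move=> sp sq; rewrite (dformE _ sp) (dformE _ sq); exact: (form_sym bO). Qed.

Lemma dform_ge0 phi : smooth phi -> 0 <= dform phi phi.
Proof. by move=> sp; rewrite (dformE _ sp); exact: (form_ge0 bO). Qed.

Lemma dformDZ phi psi (t : R) h : smooth phi -> smooth psi -> smooth h ->
  dform (fun x => phi x + t * psi x) h = dform phi h + t * dform psi h.
Proof.
move=> sp sq sh; rewrite /dform innerDl//; [|exact: sL2|by apply: L2Z; [|exact: sL2]|exact: slL2].
by rewrite innerZl//; [exact: sL2|exact: slL2].
Qed.

Lemma smoothDZ phi psi (t : R) : smooth phi -> smooth psi ->
  smooth (fun x => phi x + t * psi x).
Proof. by move=> sp sq; apply: (smooth_inD sp); exact: (smooth_inZ t sq). Qed.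

Lemma dformDZ2 phi psi (t : R) : smooth phi -> smooth psi ->
  dform (fun x => phi x + t * psi x) (fun x => phi x + t * psi x) =
  dform phi phi + t * dform phi psi *+ 2 + t ^+ 2 * dform psi psi.
Proof.
move=> sp sq; have s := smoothDZ t sp sq.
have e h (sh : smooth h) := dformDZ t sp sq sh.
rewrite (e _ s) (dformC sp s) (dformC sq s) (e _ sp) (e _ sq) (dformC sq sp).
by move: (dform phi phi) (dform phi psi) (dform psi psi) => a b c; ring.
Qed.

Lemma dform_CS phi psi : smooth phi -> smooth psi ->
  dform phi psi ^+ 2 <= dform phi phi * dform psi psi.
Proof.
move=> sp sq; apply: discriminant_le; first exact: dform_ge0.
by move=> t; rewrite -(dformDZ2 t sp sq); apply: dform_ge0; exact: smoothDZ.
Qed.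

Lemma smoothB phi psi : smooth phi -> smooth psi -> smooth (phi \- psi).
Proof.
move=> sp sq; have := smoothDZ (-1) sp sq; congr smooth_in.
by apply/funext => x /=; rewrite mulN1r.
Qed.

Lemma dformBl phi psi h : smooth phi -> smooth psi -> smooth h ->
  dform (phi \- psi) h = dform phi h - dform psi h.
Proof. by move=> sp sq sh; rewrite /dform innerBl//; [exact: sL2|exact: sL2|exact: slL2]. Qed.

(** The difference of the two sides is the form at [phi - 2 psi]. It bounds the energy along a
    form-Cauchy sequence. *)
Lemma dform_le phi psi : smooth phi -> smooth psi ->
  dform phi phi <= 2 * dform (phi \- psi) (phi \- psi) + 2 * dform psi psi.
Proof.
move=> sp sq; have sB := smoothB sp sq.
have := dform_ge0 (smoothDZ (- 2) sp sq).
rewrite (dformDZ2 _ sp sq).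
have -> : dform (phi \- psi) (phi \- psi) =
    dform phi phi + (-1) * dform phi psi *+ 2 + (-1) ^+ 2 * dform psi psi.
  rewrite -(dformDZ2 _ sp sq); have -> : phi \- psi = (fun x => phi x + -1 * psi x).
    by apply/funext => x /=; rewrite mulN1r.
  by [].
by move: (dform phi phi) (dform phi psi) (dform psi psi) => a b c h; lra.
Qed.

Lemma form_dform phi : Defs.form Omega phi = dform phi phi.
Proof. by rewrite /Defs.form innerC. Qed.

Section approximation.
Variables (I : finType) (mu : I -> R) (u : I -> 'rV[R]_n -> R)
  (phi : I -> nat -> 'rV[R]_n -> R).
Hypothesis uL : forall i, L2 (u i).
Hypothesis eig : forall i psi, test_function Omega psi ->
  inner (u i) (\- laplacian psi) = mu i * inner (u i) psi.
Hypothesis tphi : forall i k, test_function Omega (phi i k).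
Hypothesis phiu : forall i,
  inner (phi i k \- u i) (phi i k \- u i) @[k --> \oo] --> (0 : R).
Hypothesis phic : forall i (eps : R), 0 < eps -> exists N : nat, forall j k,
  (N <= j)%N -> (N <= k)%N -> Defs.form Omega (phi i j \- phi i k) < eps.

Let sphi i k : smooth (phi i k).
Proof. exact: test_smooth_in. Qed.

Lemma gram_cvg i j :
  inner (phi i k) (phi j k) @[k --> \oo] --> inner (u i) (u j).
Proof.
by apply: (inner_cvg mO) => // k; exact: sL2.
Qed.

Let inner0 v : L2 v -> inner (v \- v) (v \- v) = 0.
Proof. by move=> vL; rewrite innerBl// ?subrr//; exact: L2B. Qed.

Let gram_cvg1 i j : inner (u i) (phi j k) @[k --> \oo] --> inner (u i) (u j).
Proof.
apply: (@inner_cvg _ _ Omega mO (fun=> u i) (phi j)) => //.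
  by move=> k; exact: sL2.
by under eq_fun do rewrite inner0//; exact: cvg_cst.
Qed.

(** With [phi j k] fixed, letting [l] grow in [dform (phi i l) (phi j k)] gives
    [mu i * inner (u i) (phi j k)] by the weak equation. The cost of replacing [k] by [l] in the
    first argument is small uniformly in [l], by Cauchy-Schwarz, the Cauchy property and bounded
    energy of [phi j k]. *)
Lemma dform_cvg i j :
  dform (phi i k) (phi j k) @[k --> \oo] --> mu i * inner (u i) (u j).
Proof.
have dbound : exists C, 0 < C /\ \forall k \near \oo, dform (phi j k) (phi j k) <= C.
  have [N HN] := phic j ltr01; have qN := dform_ge0 (sphi j N).
  exists (2 + 2 * dform (phi j N) (phi j N)); split.
    by rewrite ltr_pwDl// mulr_ge0.
  exists N => // k /= Nk; apply: (le_trans (dform_le (sphi j k) (sphi j N))).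
  rewrite lerD2r; have := HN k N Nk (leqnn N); rewrite form_dform => h.
  by rewrite -[leRHS]mulr1 ler_pM2l// ltW.
have [C [C0 HC]] := dbound.
have diff0 : (dform (phi i k) (phi j k) - mu i * inner (u i) (phi j k))
    @[k --> \oo] --> (0 : R).
  apply/cvgrPdist_lt => e e0.
  (* Chosen so that Cauchy-Schwarz against an energy at most [C] gives an error at most [e / 2]. *)
  have [|N HN] := phic i (eps := (e / 2) ^+ 2 / C).
    by rewrite divr_gt0// exprn_gt0// divr_gt0.
  have NN : \forall k \near \oo, (N <= k)%N by exists N.
  near=> k; rewrite sub0r normrN.
  have Ck : dform (phi j k) (phi j k) <= C by near: k.
  have Nk : (N <= k)%N by near: k.
  have lcvg : dform (phi i l) (phi j k) @[l --> \oo] --> mu i * inner (u i) (phi j k).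
    rewrite -eig//; apply: (@inner_cvg _ _ Omega mO (phi i) (fun=> \- laplacian (phi j k))) => //.
    - by move=> l; exact: sL2.
    - by move=> l; exact: slL2.
    - exact: slL2.
    - by under eq_fun do rewrite (inner0 (slL2 (sphi j k))); exact: cvg_cst.
  have le l : (N <= l)%N -> `|dform (phi i k) (phi j k) - dform (phi i l) (phi j k)| <= e / 2.
    move=> Nl; rewrite -dformBl//.
    have sB := smoothB (sphi i k) (sphi i l).
    have := dform_CS sB (sphi j k); have := HN k l Nk Nl; rewrite form_dform => h1 h2.
    have q1 := dform_ge0 sB; have q2 := dform_ge0 (sphi j k).
    rewrite -ler_sqr ?nnegrE//; last by rewrite divr_ge0// ltW.
    rewrite real_normK ?num_real//; apply: (le_trans h2).
    rewrite -[leRHS](@divfK _ C) ?lt0r_neq0//.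
    exact: (ler_pM q1 q2 (ltW h1) Ck).
  apply: (@le_lt_trans _ _ (e / 2)); last by lra.
  have ncvg : `|dform (phi i k) (phi j k) - dform (phi i l) (phi j k)| @[l --> \oo] -->
      `|dform (phi i k) (phi j k) - mu i * inner (u i) (phi j k)|.
    by apply: cvg_norm; apply: cvgB => //; exact: cvg_cst.
  rewrite -(cvg_lim _ ncvg)//; apply: limr_le; first by apply/cvg_ex; eexists; exact: ncvg.
  by exists N.
have E k : dform (phi i k) (phi j k) =
    (dform (phi i k) (phi j k) - mu i * inner (u i) (phi j k)) + mu i * inner (u i) (phi j k).
  by rewrite subrK.
under eq_fun do rewrite E.
have : (dform (phi i k) (phi j k) - mu i * inner (u i) (phi j k)) +
  mu i * inner (u i) (phi j k) @[k --> \oo] --> 0 + mu i * inner (u i) (u j).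
  by apply: cvgD => //; apply: cvgMr; exact: gram_cvg1.
by rewrite add0r.
Unshelve. all: by end_near.
Qed.

(** Symmetry of the approximating forms makes the limits [mu i * inner (u i) (u j)] and
    [mu j * inner (u j) (u i)] equal. *)
Lemma eigen_ortho i j : mu i != mu j -> inner (u i) (u j) = 0.
Proof.
move=> ij; have h1 := dform_cvg (i := i) (j := j); have h2 := dform_cvg (i := j) (j := i).
have e : mu i * inner (u i) (u j) = mu j * inner (u j) (u i).
  have E : (fun k => dform (phi j k) (phi i k)) = (fun k => dform (phi i k) (phi j k)).
    by apply/funext => k; exact: dformC.
  by move: h2; rewrite E => h2; exact: (cvg_unique _ h1 h2).
apply/eqP; move: e; rewrite (innerC Omega (u j)) => /eqP.
by rewrite -subr_eq0 -mulrBl mulf_eq0 subr_eq0 (negbTE ij).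
Qed.

(** Independence is asked for one eigenvalue at a time, orthogonality supplying the rest; bases of
    different eigenspaces can then simply be put together. *)
Hypothesis indep : forall i0 (c : I -> R), (forall i, mu i != mu i0 -> c i = 0) ->
  {ae vol, forall x, Omega x -> \sum_i c i * u i x = 0} -> c i0 = 0.

(** If the form vanishes at [c], let [d] keep the coefficients for the eigenvalue of [i0]. By
    orthogonality the combination for [c] pairs with that for [d] as the latter with itself, so
    Cauchy-Schwarz forces the combination for [d] to vanish almost everywhere. *)
Lemma gram_posdef : posdef (fun i j => inner (u i) (u j)).
Proof.
move=> c [i0 c0]; rewrite lt_neqAle; apply/andP; split; last first.
  by rewrite /quad -inner_quad//; exact: inner_ge0.
apply/eqP => /esym q0; pose d i := if mu i == mu i0 then c i else 0.
have uS (e : I -> R) : L2 (fun x => \sum_i e i * u i x) by exact: L2_sum.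
have dd : inner (fun x => \sum_i c i * u i x) (fun x => \sum_i d i * u i x) =
    inner (fun x => \sum_i d i * u i x) (fun x => \sum_i d i * u i x).
  rewrite !inner_quad//; apply: eq_bigr => i _; apply: eq_bigr => j _.
  have [ij|/eigen_ortho->] := eqVneq (mu i) (mu j); last by rewrite !mulr0.
  rewrite /d ij; case: eqP => // _; by rewrite !mulr0 !mul0r.
have := inner_CS mO (uS c) (uS d); rewrite dd (inner_quad mO c c)// -/(quad _ _) q0 mul0r.
move=> h; have : inner (fun x => \sum_i d i * u i x) (fun x => \sum_i d i * u i x) = 0.
  by apply/eqP; rewrite -sqrf_eq0 eq_le h sqr_ge0.
move/(inner_eq0 mO (uS d)) => /(indep (i0 := i0)); rewrite /d eqxx => e.
move/eqP: c0; apply; apply: e => i; by case: eqP.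
Qed.

(* In the limit the form is diag(mu) times the Gram matrix, eigenfunctions for
   distinct eigenvalues being orthogonal; positive definiteness is open. *)
Lemma approximate_posdef (lam0 lam : R) : (forall i, mu i <= lam0) -> lam0 < lam ->
  exists k, posdef (fun i j => lam * ip (phi i k) (phi j k) -
                               ip (phi i k) (\- laplacian (phi j k))).
Proof.
move=> mu0 lt.
have cv i j : lam * ip (phi i k) (phi j k) - ip (phi i k) (\- laplacian (phi j k))
    @[k --> \oo] --> lam * inner (u i) (u j) - mu i * inner (u i) (u j).
  have E k : lam * ip (phi i k) (phi j k) - ip (phi i k) (\- laplacian (phi j k)) =
      lam * inner (phi i k) (phi j k) - dform (phi i k) (phi j k).
    congr (lam * _ - _); first exact: (esym (innerE _ (sphi i k))).
    exact: (esym (dformE _ (sphi i k))).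
  under eq_fun do rewrite E.
  by apply: cvgB; [apply: cvgMr; exact: gram_cvg|exact: dform_cvg].
have pQ : posdef (fun i j => lam * inner (u i) (u j) - mu i * inner (u i) (u j)).
  move=> c cn0; have := gram_posdef cn0.
  (* Splits [lam - mu i] as [(lam - lam0) + (lam0 - mu i)]. The second part is the squared norm of
     the combination with coefficients [w], because pairs with distinct eigenvalues are
     orthogonal. *)
  pose w i := Num.sqrt (lam0 - mu i) * c i.
  have w0 : 0 <= \sum_i \sum_j c i * c j * ((lam0 - mu i) * inner (u i) (u j)).
    rewrite (_ : \sum_i _ = inner (fun x => \sum_i w i * u i x) (fun x => \sum_i w i * u i x)).
      exact: inner_ge0.
    rewrite inner_quad//; apply: eq_bigr => i _; apply: eq_bigr => j _.
    have [ij|/eigen_ortho->] := eqVneq (mu i) (mu j); last by rewrite !mulr0.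
    rewrite /w -ij -[X in X * inner _ _](sqr_sqrtr (_ : 0 <= lam0 - mu i)) ?subr_ge0//.
    by move: (inner _ _) (Num.sqrt _) => g s; ring.
  move=> g0; have : 0 < (lam - lam0) * quad (fun i j => inner (u i) (u j)) c.
    by rewrite mulr_gt0// subr_gt0.
  move=> g1; apply: (lt_le_trans (ltr_wpDr w0 g1)).
  rewrite /quad mulr_sumr -big_split/=; apply: ler_sum => i _.
  rewrite mulr_sumr -big_split/=; apply: ler_sum => j _.
  rewrite le_eqVlt; apply/orP; left; apply/eqP.
  by move: (inner _ _) => g; ring.
have [N _ HN] := posdef_near cv pQ.
by exists N; apply: HN => /=.
Qed.

End approximation.

Lemma spectral_approx (I : finType) (mu : I -> R) (u : I -> 'rV[R]_n -> R)
    (lam0 lam : R) :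
  (forall i, dirichlet_laplacian Omega (u i) (fun x => mu i * u i x)) ->
  (forall i0 (c : I -> R), (forall i, mu i != mu i0 -> c i = 0) ->
    {ae vol, forall x, Omega x -> \sum_i c i * u i x = 0} -> c i0 = 0) ->
  (forall i, mu i <= lam0) -> lam0 < lam ->
  exists phi : I -> 'rV[R]_n -> R, (forall i, smooth (phi i)) /\
    posdef (fun i j => lam * ip (phi i) (phi j) - ip (phi i) (\- laplacian (phi j))).
Proof.
move=> H indep mu0 lt.
have uL i : L2 (u i) by have [[]] := H i.
have ex i : exists phi : nat -> 'rV[R]_n -> R,
    [/\ forall k, test_function Omega (phi k),
        inner (phi k \- u i) (phi k \- u i) @[k --> \oo] --> (0 : R)
      & forall eps : R, 0 < eps -> exists N : nat, forall j k,
          (N <= j)%N -> (N <= k)%N -> Defs.form Omega (phi j \- phi k) < eps].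
  by have [[]] := H i.
have [phi hphi] := choice ex.
have [||||k hk] := @approximate_posdef I mu u phi uL _ _ _ _ indep lam0 lam mu0 lt.
- move=> i psi tpsi; have [_ _ h] := H i; rewrite h// innerZl//.
  exact/sL2/test_smooth_in.
- by move=> i; have [] := hphi i.
- by move=> i; have [] := hphi i.
- by move=> i; have [] := hphi i.
by exists (fun i => phi i k); split => // i; apply: test_smooth_in; have [] := hphi i.
Qed.

End eigenfunction_approximation.

(** * Packings and densities *)

Section copies.
Context {R : realType} {n : nat}.
Implicit Types (A G Omega : set 'rV[R]_n) (P : set (set 'rV[R]_n)).
Local Notation vol := (@lebesgue_rV R n).

Lemma congruentE Omega A : congruent Omega A -> exists (O : 'M[R]_n) (b : 'rV[R]_n),
  O *m O^T = 1%:M /\ A = [set x | Omega (x *m O + b)].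
Proof.
move=> [f [fi ->]]; have [a [ O [OO fE]]] := isometry_affine fi.
have OO' := mulmx1C OO.
exists O^T, (- (a *m O^T)); split; first by rewrite trmxK.
apply/seteqP; split => [_ [x xO <-]|y /= h] /=.
  by rewrite fE mulmxDl -mulmxA OO mulmx1 addrK.
exists (y *m O^T - a *m O^T) => //; rewrite fE mulmxBl -!mulmxA OO' !mulmx1.
by rewrite subrK.
Qed.

Lemma vol_congruent Omega A : measurable Omega -> congruent Omega A ->
  measurable A /\ vol A = vol Omega.
Proof.
move=> mO /congruentE[ O [b [OO ->]]]; split; last exact: vol_isometry.
by have := measurable_isometry O b measurableT mO; rewrite setTI.
Qed.

Lemma ip_disjoint (f g : 'rV[R]_n -> R) : (forall x, f x * g x = 0) -> ip f g = 0.
Proof.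
by move=> h; rewrite /ip /Rintegral integral0_eq// => x _; rewrite h.
Qed.

(** Functions on distinct copies have disjoint supports, so the matrix on the cube is block
    diagonal, one block [Q0] per copy by invariance under isometries, and stays positive
    definite. *)
Lemma copies_count Omega (I J : finType) (phi : I -> 'rV[R]_n -> R) (lam l : R)
    (O : J -> 'M[R]_n) (b : J -> 'rV[R]_n) (a : 'rV[R]_n) :
  bounded_set Omega -> (forall i, smooth_in Omega (phi i)) ->
  posdef (fun i j => lam * ip (phi i) (phi j) - ip (phi i) (\- laplacian (phi j))) ->
  0 < l -> 0 <= lam -> (forall j, O j *m (O j)^T = 1%:M) ->
  (forall j k x, Omega (x *m O j + b j) -> Omega (x *m O k + b k) -> j = k) ->
  (forall j x, Omega (x *m O j + b j) -> forall i, a 0 i < x 0 i < a 0 i + l) ->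
  #|I|%:R * #|J|%:R <= @weyl_density R n lam * l ^+ n.
Proof.
move=> bO sphi pQ l0 lam0 OO disj box.
pose b' j := a *m O j + b j.
pose v (p : I * J) : 'rV[R]_n -> R := fun x => phi p.1 (x *m O p.2 + b' p.2).
have shift j x : x *m O j + b' j = (x + a) *m O j + b j by rewrite mulmxDl addrA.
have sv p : smooth_in [set x | Omega (x *m O p.2 + b' p.2)] (v p).
  exact: smooth_in_comp.
have sb p : smooth_in (obox l) (v p).
  apply: smooth_in_sub (sv p) => x /=; rewrite shift => /box h i.
  by have := h i; rewrite mxE => /andP[h1 h2]; apply/andP; split; lra.
rewrite -natrM -(card_prod I J); apply: (cube_count l0 lam0 sb) => c cn0.
pose Q0 i j := lam * ip (phi i) (phi j) - ip (phi i) (\- laplacian (phi j)).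
have E p q : lam * ip (v p) (v q) - ip (v p) (\- laplacian (v q)) =
    (p.2 == q.2)%:R * Q0 p.1 q.1.
  have key (x y x' y' z : R) : x = x' -> y = y' -> z = lam * x' - y' ->
    lam * x - y = z by move=> -> -> ->.
  have [e|ne] := eqVneq p.2 q.2.
    apply: (key _ _ (ip (phi p.1) (phi q.1)) (ip (phi p.1) (\- laplacian (phi q.1)))).
    - by rewrite /v e; exact: (ip_comp (b' q.2) (OO q.2) bO (sphi p.1) (sphi q.1)).
    - by rewrite /v e; exact: (form_comp (b' q.2) (OO q.2) bO (sphi p.1) (sphi q.1)).
    - exact: mul1r.
  have dj (g : 'rV[R]_n -> R) : smooth_in [set x | Omega (x *m O q.2 + b' q.2)] g ->
      ip (v p) g = 0.
    move=> sg; apply: ip_disjoint => x.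
    have [xp|xp] := pselect (Omega (x *m O p.2 + b' p.2)); last first.
      by rewrite (smooth_in_out (sv p) xp) mul0r.
    rewrite (smooth_in_out sg) ?mulr0// => xq; move/eqP: ne; apply.
    by move: xp xq; rewrite /= !shift; exact: disj.
  apply: (key _ _ 0 0 _ (dj _ (sv q)) (dj _ (smooth_in_neg_laplacian (sv q)))).
  by rewrite mulr0 subr0; exact: mul0r.
have qE : quad (fun p q => lam * ip (v p) (v q) - ip (v p) (\- laplacian (v q))) c =
    \sum_j quad Q0 (fun i => c (i, j)).
  transitivity (\sum_(p : I * J) \sum_(q : I * J)
      c (p.1, p.2) * c (q.1, q.2) * ((p.2 == q.2)%:R * Q0 p.1 q.1)).
    rewrite /quad; apply: eq_bigr => -[i j] _; apply: eq_bigr => -[i' j'] _.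
    by congr (_ * _); exact: (E (i, j) (i', j')).
  rewrite -(pair_bigA _ (fun i j => \sum_(q : I * J)
    c (i, j) * c (q.1, q.2) * ((j == q.2)%:R * Q0 i q.1)))/=.
  rewrite exchange_big/=; apply: eq_bigr => j _; apply: eq_bigr => i _.
  rewrite -(pair_bigA _ (fun i' j' => c (i, j) * c (i', j') * ((j == j')%:R * Q0 i i')))/=.
  apply: eq_bigr => i' _; rewrite (bigD1 j)//= eqxx mul1r big1 ?addr0// => j' j'j.
  by rewrite eq_sym (negbTE j'j) mul0r mulr0.
rewrite qE; have [[i j] cij] := cn0.
have qge0 k : 0 <= quad Q0 (fun i => c (i, k)).
  have [[i' ci']|h] := pselect (exists i, c (i, k) != 0).
    by apply/ltW/pQ; exists i'.
  rewrite /quad big1// => i' _; rewrite big1// => j' _.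
  have [->|ci'] := eqVneq (c (i', k)) 0; first by rewrite !mul0r.
  by case: h; exists i'.
rewrite (bigD1 j)//= ltr_wpDr//; first by apply: sumr_ge0.
by apply: pQ; exists i.
Qed.

Definition thick (r : R) G : set 'rV[R]_n := [set x | exists2 y, G y & `|x - y| < r].

Lemma open_thick r G : 0 < r -> open (thick r G).
Proof.
move=> r0.
have -> : thick r G = \bigcup_(y in G) ball y r.
  apply/seteqP; split => x.
    by move=> [y Gy xy]; exists y => //; rewrite mx_norm_ball /ball_/= distrC.
  by move=> [y Gy]; rewrite mx_norm_ball /ball_/= distrC => xy; exists y.
by apply: bigcup_open => y _; exact: ball_open.
Qed.

(* Every copy meeting G meets a cube of side L around one of its points in G,
   and the copies meeting a fixed cube lie in a cube of side L + 2 D. *)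
Lemma packing_count Omega P G (I : finType) (phi : I -> 'rV[R]_n -> R) (lam L D : R)
    (r : seq (set 'rV[R]_n)) :
  bounded_set Omega -> (forall i, smooth_in Omega (phi i)) ->
  posdef (fun i j => lam * ip (phi i) (phi j) - ip (phi i) (\- laplacian (phi j))) ->
  0 <= lam -> 0 < L -> 0 < D ->
  (forall x y, Omega x -> Omega y -> enorm (x - y) < D) ->
  packing Omega P -> (vol (thick L G) < +oo)%E ->
  uniq r -> (forall A, A \in r -> P A /\ A `&` G !=set0) ->
  #|I|%:R * (size r)%:R * L ^+ n <=
    @weyl_density R n lam * (L + 2 * D) ^+ n * fine (vol (thick L G)).
Proof.
move=> bO sphi pQ lam0 L0 D0 diam [Pc Pd] Goo ur rP.
pose T := 'I_(size r); pose A (t : T) := nth set0 r t.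
have Ar t : A t \in r by exact: mem_nth.
have Ainj t u : A t = A u -> t = u.
  by move=> /eqP; rewrite nth_uniq// => /eqP/val_inj.
have [x xA] : exists x : T -> 'rV[R]_n, forall t, (A t `&` G) (x t).
  have h t : exists x, (A t `&` G) x by have [_ [y yA]] := rP _ (Ar t); exists y.
  by have [x hx] := choice h; exists x.
have [Ob hOb] : exists Ob : T -> 'M[R]_n * 'rV[R]_n, forall t,
    (Ob t).1 *m (Ob t).1^T = 1%:M /\ A t = [set x | Omega (x *m (Ob t).1 + (Ob t).2)].
  have h t : exists Ob : 'M[R]_n * 'rV[R]_n,
      Ob.1 *m Ob.1^T = 1%:M /\ A t = [set x | Omega (x *m Ob.1 + Ob.2)].
    have [At _] := rP _ (Ar t); have [ O [b [OO AE]]] := congruentE (Pc _ At).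
    by exists (O, b).
  by have [Ob hOb] := choice h; exists Ob.
pose s := [seq cell_index L (x t) | t : T].
have ps t : cell_index L (x t) \in s by apply: map_f; rewrite mem_enum.
(* The occupied cells; the copies are grouped by the cell of their chosen point in [G]. *)
pose Z : finType := seq_sub s; pose p (t : T) : Z := SeqSub (ps t).
set W := @weyl_density R n lam * (L + 2 * D) ^+ n.
have fib (z : Z) : #|I|%:R * #|[pred t | p t == z]|%:R <= W.
  pose J := {t : T | p t == z}.
  rewrite -(card_sig (fun t => p t == z)) -/J.
  (* The margin [D] on each side of the cell accommodates copies of diameter less than [D]. *)
  pose a : 'rV[R]_n := \row_i ((val z i)%:~R * L - D).
  apply: (@copies_count Omega I J phi lam (L + 2 * D) (fun j => (Ob (val j)).1)
    (fun j => (Ob (val j)).2) a) => //.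
  - by rewrite addr_gt0// mulr_gt0.
  - by move=> j; have [] := hOb (val j).
  - move=> j k y yj yk; apply: val_inj; apply: Ainj.
    have [PAj _] := rP _ (Ar (val j)); have [PAk _] := rP _ (Ar (val k)).
    apply: Pd => //; exists y; split.
      by have [_ ->] := hOb (val j).
    by have [_ ->] := hOb (val k).
  - move=> j y yj i; have [OO AE] := hOb (val j).
    have [xj _] := xA (val j); rewrite AE /= in xj.
    have zj : cell L (val z) (x (val j)).
      apply/(cellP _ _ L0); have /eqP pz := valP j.
      exact: (congr1 val pz).
    have := diam _ _ yj xj; rewrite opprD addrACA subrr addr0 -mulmxBl.
    rewrite /enorm dot_orthogonal// => d.
    have := le_lt_trans (coord_le_enorm _ i) d; rewrite !mxE ltr_norml => /andP[d1 d2].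
    have /andP[z1 z2] := zj i; rewrite mulrDl mul1r in z2.
    by apply/andP; split; lra.
have cZ : #|Z|%:R * L ^+ n <= fine (vol (thick L G)).
  rewrite -lee_fin fineK ?ge0_fin_numE//.
  apply: (@card_cells_le R n Z predT (fun z : seq_sub s => ssval z) L (thick L G)) => //.
  - by move=> z z' h; apply: val_inj.
  - by apply: measurable_open; exact: open_thick.
  (* An occupied cell contains a point of [G] and has sup-norm diameter at most [L], hence lies in
     [thick L G]. *)
  - move=> z _ y yz; have /mapP[t _ zt] := ssvalP z.
    exists (x t); first by have [] := xA t.
    by apply: (cell_dist L0 yz); rewrite zt; exact: cell_index_in.
have W0 : 0 <= W.
  apply: mulr_ge0; last by rewrite exprn_ge0// addr_ge0 ?mulr_ge0// ltW.
  rewrite /weyl_density mulr_ge0 ?exprn_ge0 ?sqrtr_ge0//.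
  by rewrite divr_ge0 ?fine_ge0 ?exprn_ge0 ?mulr_ge0 ?pi_ge0.
have -> : (size r)%:R = \sum_(z : Z) #|[pred t | p t == z]|%:R :> R.
  rewrite -natr_sum; congr (_%:R).
  rewrite -[LHS]card_ord -sum1_card (partition_big p predT)//=.
  by apply: eq_bigr => z _; rewrite -sum1_card; apply: eq_bigl => t; rewrite inE.
rewrite mulr_sumr mulr_suml.
apply: (@le_trans _ _ (\sum_(z : Z) W * L ^+ n)).
  by apply: ler_sum => z _; rewrite ler_wpM2r// exprn_ge0// ltW.
rewrite sumr_const -mulr_natr -mulrA; apply: ler_wpM2l => //.
by rewrite mulrC.
Qed.

End copies.

(** * From counting copies to upper densities *)

Section densities.
Context {R : realType} {n : nat}.
Implicit Types (A G Omega : set 'rV[R]_n) (P : set (set 'rV[R]_n)) (o : 'rV[R]_n).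
Local Notation vol := (@lebesgue_rV R n).

Lemma homothetyE o (s : R) G : 0 < s ->
  homothety o s G = [set x | G (s^-1 *: x + (o - s^-1 *: o))].
Proof.
move=> s0; have sn := lt0r_neq0 s0; apply/seteqP; split => [_ [x Gx <-]|x /= Gx].
  have e : s^-1 *: (o + s *: (x - o)) + (o - s^-1 *: o) = x.
    by apply/rowP => i; rewrite !mxE; field.
  by rewrite /= e.
exists (s^-1 *: x + (o - s^-1 *: o)) => //.
by apply/rowP => i; rewrite !mxE; field.
Qed.

Lemma vol_homothety o (s : R) G : 0 < s -> measurable G ->
  vol (homothety o s G) = ((s ^+ n)%:E * vol G)%E.
Proof. by move=> s0 mG; rewrite homothetyE// vol_affine ?invr_gt0// invrK. Qed.

Lemma thick_homothety o (s L : R) G : 0 < s ->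
  thick L (homothety o s G) = [set x | thick (L / s) G (s^-1 *: x + (o - s^-1 *: o))].
Proof.
move=> s0; have sn := lt0r_neq0 s0; rewrite (homothetyE _ _ s0).
have dist (x y : 'rV[R]_n) : `|s^-1 *: x + (o - s^-1 *: o) -
    (s^-1 *: y + (o - s^-1 *: o))| = `|x - y| / s.
  by rewrite opprD addrACA subrr addr0 -scalerBr normrZ gtr0_norm ?invr_gt0// mulrC.
apply/seteqP; split => x /=.
  move=> [y /= Gy xy]; exists (s^-1 *: y + (o - s^-1 *: o)) => //.
  by rewrite dist ltr_pM2r ?invr_gt0.
move=> [y Gy xy]; pose z := s *: (y - (o - s^-1 *: o)).
have zE : s^-1 *: z + (o - s^-1 *: o) = y.
  by rewrite /z scalerA mulVf// scale1r subrK.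
exists z; first by rewrite /= zE.
by move: xy; rewrite -zE dist ltr_pM2r ?invr_gt0.
Qed.

Lemma thick_sub (r r' : R) G : r <= r' -> thick r G `<=` thick r' G.
Proof. by move=> rr x [y Gy xy]; exists y => //; exact: lt_le_trans rr. Qed.

Lemma thick_bounded (r : R) G : bounded_set G -> bounded_set (thick r G).
Proof.
move=> [M [_ /(_ (`|M| + 1))]]; rewrite (le_lt_trans (ler_norm M)) ?ltrDl//.
move=> /(_ isT) GM; exists (`|M| + 1 + r); split; first exact: num_real.
move=> N MN x [y Gy xy]; apply: ltW; apply: le_lt_trans MN.
rewrite -[x](subrK y) (le_trans (ler_normD _ _))// addrC lerD//; first exact: GM.
exact: ltW.
Qed.

(** The thickenings decrease to the closure of [G], which has the volume of [G] because the boundary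
    is null; continuity from above concludes. *)
Lemma vol_thick_cvg G (e : R) : gauge_domain G -> 0 < e ->
  exists r : R, 0 < r /\ (vol (thick r G) < vol G + e%:E)%E.
Proof.
move=> [mG bG [g Gg] G0] e0.
pose F k := thick (k.+1%:R^-1) G.
have r0 k : (0 : R) < k.+1%:R^-1 by rewrite invr_gt0.
have mF k : measurable (F k) by apply: measurable_open; exact: open_thick.
have Foo k : (vol (F k) < +oo)%E by apply: vol_bounded => //; exact: thick_bounded.
have FE : \bigcap_k F k = closure G.
  apply/seteqP; split => x.
    move=> xF B /nbhs_ballP[d /= d0 dB].
    have [k kd] : exists k : nat, (k.+1%:R^-1 : R) < d.
      exists (Num.truncn d^-1); rewrite -[ltRHS]invrK ltf_pV2 ?posrE ?invr_gt0//.
      exact: truncnS_gt.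
    have [y Gy xy] := xF k I; exists y; split => //; apply: dB.
    by rewrite mx_norm_ball /ball_/=; exact: lt_trans kd.
  move=> xG k _; have /xG[y [Gy]] : nbhs x (ball x (k.+1%:R^-1 : R)).
    exact: nbhsx_ballx.
  by rewrite mx_norm_ball /ball_/= => xy; exists y.
have mcl : measurable (closure G) by apply: measurable_closed; exact: closed_closure.
have clG : (vol (closure G) <= vol G)%E.
  have mb : measurable (boundary G).
    by apply: measurableD => //; apply: measurable_open; exact: open_interior.
  rewrite -[leRHS]adde0 -G0; apply: le_trans (measureU2 _ mG mb).
  apply: le_measure; rewrite ?inE//; first exact: measurableU.
  move=> x xG; have [xi|xi] := pselect (interior G x); last by right.
  by left; exact: interior_subset.
have nonincr : {homo F : a b / (a <= b)%N >-> (b <= a)%O}.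
  move=> a b ab; apply/subsetPset; apply: thick_sub.
  by rewrite lef_pV2 ?posrE// ler_nat ltnS.
have := nonincreasing_cvg_mu (Foo 0%N) mF _ nonincr; rewrite FE => /(_ mcl) cv.
have fG : vol G \is a fin_num by rewrite ge0_fin_numE// vol_bounded.
have fcl : vol (closure G) \is a fin_num.
  by rewrite ge0_fin_numE// (le_lt_trans clG)// ltey_eq fG.
have [k _ hk] : \forall k \near \oo, (vol (F k) < vol G + e%:E)%E.
  have : vol (F k) @[k --> \oo] --> (fine (vol (closure G)))%:E by rewrite fineK.
  move=> /fine_cvgP[_ /cvgrPdist_lt/(_ _ e0)].
  apply: filterS => k /=; rewrite ltr_norml => /andP[h _].
  have fF : vol (F k) \is a fin_num by rewrite ge0_fin_numE.
  rewrite -(fineK fF) -(fineK fG) -EFinD lte_fin.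
  have : fine (vol (closure G)) <= fine (vol G) by rewrite -lee_fin !fineK.
  move: h; move: (fine _) (fine _) (fine _) => a b c; lra.
by exists (k.+1%:R^-1); split => //; apply: hk => /=.
Qed.

Lemma gauge_vol_gt0 G : gauge_domain G -> (0 < fine (vol G))%R.
Proof.
move=> [mG bG Gi _]; rewrite fine_gt0// vol_bounded// andbT.
apply: (@lt_le_trans _ _ (vol (interior G))).
  by apply: vol_open_gt0 => //; exact: open_interior.
apply: le_measure; rewrite ?inE//; first by apply: measurable_open; exact: open_interior.
exact: interior_subset.
Qed.

(** An [\esum] is a supremum over finite subfamilies, so finite lists of copies are enough. *)
Lemma outer_density_le Omega P G (C : R) : measurable Omega -> vol Omega \is a fin_num ->
  packing Omega P -> 0 < fine (vol G) ->
  (forall r : seq (set 'rV[R]_n), uniq r ->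
    (forall A, A \in r -> P A /\ A `&` G !=set0) ->
    (size r)%:R * fine (vol Omega) <= C * fine (vol G)) ->
  (outer_density P G <= C%:E)%E.
Proof.
move=> mO fO [Pc _] G0 H; rewrite /outer_density.
have : (\esum_(A in [set A | P A /\ A `&` G !=set0]) vol A <= (C * fine (vol G))%:E)%E.
  apply: ge_ereal_sup => _ [X [fX XS] <-].
  have -> : \sum_(A \in X) vol A =
      ((size (finmap.enum_fset (fset_set X)))%:R * fine (vol Omega))%:E.
    rewrite fsbig_finite//= (eq_big_seq (fun=> (fine (vol Omega))%:E)).
      rewrite sumEFin big_const_seq count_predT iter_addr_0 mulr_natl//.
    move=> A; rewrite in_fset_set// inE => /XS[PA _].
    by have [_ ->] := vol_congruent mO (Pc _ PA); rewrite fineK.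
  rewrite lee_fin; apply: H => [|A]; first exact: finmap.fset_uniq.
  by rewrite in_fset_set// inE => /XS.
move=> h; apply: le_trans (lee_wpmul2l _ h) _; first by rewrite lee_fin invr_ge0 ltW.
by rewrite -EFinM mulrCA mulVf ?mulr1// lt0r_neq0.
Qed.

(** Cubes of side [L = t^-1] are used: [(1 + 2 * D * t) ^+ n] is the volume ratio of the cubes of
    sides [L + 2 * D] and [L], and [1 + t] allows for thickening the gauge. Both factors tend to 1
    with [t] going to 0. *)
Lemma upper_density_le Omega P G o (I : finType) (phi : I -> 'rV[R]_n -> R) (lam D t : R) :
  measurable Omega -> bounded_set Omega -> (forall i, smooth_in Omega (phi i)) ->
  posdef (fun i j => lam * ip (phi i) (phi j) - ip (phi i) (\- laplacian (phi j))) ->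
  (0 < #|I|)%N -> 0 <= lam -> 0 < D ->
  (forall x y, Omega x -> Omega y -> enorm (x - y) < D) ->
  packing Omega P -> gauge_domain G -> 0 < t ->
  (upper_density P G o <= (@weyl_density R n lam * fine (vol Omega) / #|I|%:R *
     (1 + 2 * D * t) ^+ n * (1 + t))%:E)%E.
Proof.
move=> mO bO sphi pQ I0 lam0 D0 diam PP GG t0; set C := (X in X%:E).
have [mG bG _ _] := GG; have G0 := gauge_vol_gt0 GG.
have fG : vol G \is a fin_num by rewrite ge0_fin_numE// vol_bounded.
have fO : vol Omega \is a fin_num by rewrite ge0_fin_numE// vol_bounded.
have [|r [r0 rG]] := @vol_thick_cvg G (t * fine (vol G)) GG; first exact: mulr_gt0.
have L0 : 0 < t^-1 by rewrite invr_gt0.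
(* A single neighbourhood of infinity bounds the upper limit: for [s > t^-1 / r], thickening the
   scaled gauge by [t^-1] amounts to thickening [G] by less than [r]. *)
apply: (@le_trans _ _ (ereal_sup [set outer_density P (homothety o s G) |
    s in [set s | t^-1 / r < s]])).
  apply: ereal_inf_lbound; exists [set s | t^-1 / r < s] => //.
  by exists (t^-1 / r); split => //; exact: num_real.
apply: ge_ereal_sup => _ [s /= sr <-].
have s0 : 0 < s by apply: lt_trans sr; exact: divr_gt0.
have volH : fine (vol (homothety o s G)) = s ^+ n * fine (vol G).
  by rewrite vol_homothety// fineM.
apply: (outer_density_le mO fO PP); first by rewrite volH mulr_gt0// exprn_gt0.
move=> q uq qP; set T := thick t^-1 (homothety o s G).
have mth : measurable (thick (t^-1 / s) G).
  by apply: measurable_open; apply: open_thick; exact: divr_gt0.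
have volT : (vol T = (s ^+ n)%:E * vol (thick (t^-1 / s) G))%E.
  by rewrite /T thick_homothety// vol_affine ?invr_gt0// invrK.
have thle : (vol (thick (t^-1 / s) G) <= (fine (vol G) * (1 + t))%:E)%E.
  apply: (@le_trans _ _ (vol (thick r G))).
    apply: le_measure; rewrite ?inE//; first by apply: measurable_open; exact: open_thick.
    by apply: thick_sub; rewrite ler_pdivrMr// mulrC -ler_pdivrMr// ltW.
  by rewrite (le_trans (ltW rG))// -(fineK fG) -EFinD lee_fin mulrDr mulr1 mulrC.
have Tle : (vol T <= (s ^+ n * (fine (vol G) * (1 + t)))%:E)%E.
  by rewrite volT EFinM lee_wpmul2l// lee_fin exprn_ge0// ltW.
have Too : (vol T < +oo)%E by apply: le_lt_trans Tle _; exact: ltry.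
have := packing_count bO sphi pQ lam0 L0 D0 diam PP Too uq qP.
have fT : fine (vol T) <= s ^+ n * (fine (vol G) * (1 + t)).
  by rewrite -lee_fin fineK// ge0_fin_numE.
rewrite -/T volH /C => h.
have Kn : (0 : R) < #|I|%:R by rewrite ltr0n.
have W0 : 0 <= @weyl_density R n lam.
  rewrite /weyl_density mulr_ge0 ?exprn_ge0 ?sqrtr_ge0//.
  by rewrite divr_ge0 ?fine_ge0 ?exprn_ge0 ?mulr_ge0 ?pi_ge0.
have O0 : 0 <= fine (vol Omega) by exact: fine_ge0.
have e1 : (t^-1 + 2 * D) ^+ n = (t^-1) ^+ n * (1 + 2 * D * t) ^+ n.
  rewrite -exprMn; congr (_ ^+ n); field; exact: lt0r_neq0.
have D1 : 0 <= (1 + 2 * D * t) ^+ n.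
  by rewrite exprn_ge0// addr_ge0// mulr_ge0 ?mulr_ge0// ltW.
have Ln : 0 < t^-1 ^+ n by rewrite exprn_gt0.
move: h; rewrite e1.
move: Kn W0 O0 D1 Ln fT; move: (fine (vol Omega)) (fine (vol T)) (fine (vol G)).
move: (@weyl_density _ _ _) ((1 + 2 * D * t) ^+ n) (t^-1 ^+ n) (s ^+ n) (#|I|%:R : R).
move: ((size q)%:R : R) => N w d ll sn k vO vT vG k0 w0 vO0 d0 ll0 vTle h.
have h2 : k * N <= w * d * vT.
  rewrite -(ler_pM2r ll0); apply: (le_trans h).
  by rewrite le_eqVlt; apply/orP; left; apply/eqP; ring.
have h3 : k * N <= w * d * (sn * (vG * (1 + t))).
  by apply: (le_trans h2); rewrite ler_wpM2l// mulr_ge0.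
have -> : w * vO / k * d * (1 + t) * (sn * vG) =
    (w * d * (sn * (vG * (1 + t)))) * vO / k by field; exact: lt0r_neq0.
by rewrite ler_pdivlMr// mulrAC ler_wpM2r// mulrC.
Qed.

End densities.

(** * Positivity of the packing constant *)

Section packing_constant_bounds.
Context {R : realType} {n : nat} (Omega : set 'rV[R]_n).
Hypothesis cO : compact Omega.
Local Notation vol := (@lebesgue_rV R n).

Lemma compact_measurable : measurable Omega.
Proof. by apply: measurable_closed; apply: compact_closed => //; exact: norm_hausdorff. Qed.

Lemma compact_diameter : exists D : R, 0 < D /\
  forall x y, Omega x -> Omega y -> enorm (x - y) < D.
Proof.
have [M [_ /(_ (`|M| + 1))]] := compact_bounded cO.
rewrite (le_lt_trans (ler_norm M)) ?ltrDl// => /(_ isT) OM.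
set N := `|M| + 1 + (`|M| + 1); set S := Num.sqrt (\sum_(i < n) N * N).
exists (S + 1); split; first by rewrite ltr_wpDl// sqrtr_ge0.
move=> x y xO yO; apply: (@le_lt_trans _ _ S); last by rewrite ltrDl.
rewrite /enorm ler_wsqrtr//; apply: ler_sum => i _.
have h : `|(x - y) 0 i| <= N.
  apply: (le_trans (coord_le_norm _ i)); rewrite (le_trans (ler_normB _ _))//.
  by apply: lerD; exact: OM.
rewrite -[leLHS]ger0_norm ?normrM; last by rewrite -expr2 sqr_ge0.
by apply: ler_pM.
Qed.

Definition unit_cube (p : 'rV[R]_n) : set 'rV[R]_n :=
  rect (fun i => `[p 0 i, p 0 i + 1]%classic).

Lemma unit_cube_gauge p : gauge_domain (unit_cube p).
Proof.
pose op : set 'rV[R]_n := rect (fun i => `]p 0 i, p 0 i + 1[%classic).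
have mi b1 b2 i : measurable ([set` Interval (BSide b1 (p 0 i)) (BSide b2 (p 0 i + 1))]
    : set (measurableTypeR R)) by exact: measurable_itv.
have vi b1 b2 i : @lebesgue_measure R
    ([set` Interval (BSide b1 (p 0 i)) (BSide b2 (p 0 i + 1))]) = 1%:E.
  by rewrite lebesgue_measure_itv/= lte_fin ltrDl ltr01 -EFinB addrAC subrr add0r.
have mc : measurable (unit_cube p) by apply: measurable_rect => i; exact: mi.
have mo : measurable op by apply: measurable_rect => i; exact: mi.
have vc : vol (unit_cube p) = 1%:E.
  by rewrite (@vol_rect _ _ _ (fun=> 1)) ?big1//.
have vo : vol op = 1%:E.
  by rewrite (@vol_rect _ _ _ (fun=> 1)) ?big1//.
have oo : open op.
  rewrite openE => x opx; exists (fun=> fun i => `]p 0 i, p 0 i + 1[%classic).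
    move=> k i; rewrite (ord1 k); apply: open_nbhs_nbhs.
    by split; [exact: interval_open|exact: opx].
  by move=> y h i; exact: h.
have cc : closed (unit_cube p).
  apply: compact_closed; first exact: norm_hausdorff.
  apply: (@rV_compact R n (fun i => `[p 0 i, p 0 i + 1]%classic)) => i.
  exact: segment_compact.
have osub : op `<=` interior (unit_cube p).
  rewrite -(open_subsetE _ oo) => x opx i; have := opx i; rewrite /= !in_itv/=.
  by move=> /andP[/ltW-> /ltW->].
split => //.
- exists (`|p| + 1); split; first exact: num_real.
  move=> M pM x xc; apply: norm_le_coord => [|i].
    by rewrite (le_trans _ (ltW pM))// addr_ge0.
  apply: le_trans (ltW pM); have := xc i; rewrite /= in_itv/= => /andP[h1 h2].
  have := coord_le_norm p i; rewrite !ler_norml => /andP[h3 h4].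
  by apply/andP; split; lra.
- exists (p + const_mx 2^-1); apply: osub => i.
  by rewrite /= in_itv/= !mxE ltrDl ltrD2l invr_gt0 ltr0n invf_lt1 ?ltr1n.
apply/eqP; rewrite eq_le measure_ge0 andbT.
have <- : vol (unit_cube p `\` op) = 0%E.
  have e : unit_cube p `&` op = op.
    by apply/setIidPr; exact: (subset_trans osub (@interior_subset _ _)).
  have coo : (vol (unit_cube p) < +oo)%E by rewrite vc ltry.
  have -> : (vol (unit_cube p `\` op) = vol (unit_cube p) - vol (unit_cube p `&` op))%E.
    exact: measureD.
  by rewrite e vc vo -EFinB subrr.
apply: le_measure; rewrite ?inE.
- apply: measurableD; first by apply: measurable_closed; exact: closed_closure.
  by apply: measurable_open; exact: open_interior.
- exact: measurableD.
move=> x [xc xi]; split; first exact: cc.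
by move=> /osub.
Qed.

(* The translates of Omega by a lattice of mesh larger than its diameter. *)
Lemma packing_constant_gt0 : (0 < vol Omega)%E -> (0 < packing_constant Omega)%E.
Proof.
move=> O0; have mO := compact_measurable.
have fO : vol Omega \is a fin_num.
  by rewrite ge0_fin_numE// vol_bounded//; exact: compact_bounded.
have [p Op] : Omega !=set0.
  by apply/set0P; apply: contraTneq O0 => ->; rewrite measure0 ltxx.
have [T [T0 diam]] := compact_diameter.
pose A (z : {ffun 'I_n -> int}) : set 'rV[R]_n :=
  [set x | Omega (1 *: x + - \row_i ((z i)%:~R * T))].
have volA z : vol (A z) = vol Omega by rewrite /A vol_affine// invr1 expr1n mul1e.
pose P := [set A z | z in [set: {ffun 'I_n -> int}]].
have Adisj z w x : A z x -> A w x -> z = w.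
  move=> zx wx; apply/ffunP => i; apply/eqP/negPn/negP => zw.
  have := le_lt_trans (coord_le_enorm _ i) (diam _ _ zx wx).
  rewrite !mxE (_ : _ - _ = ((w i) - (z i))%:~R * T); last by rewrite intrB; ring.
  rewrite normrM [`|T|]gtr0_norm// -[ltRHS]mul1r ltr_pM2r// -intr_norm.
  rewrite ltrz1 => h; have : `|w i - z i| != 0.
    by rewrite normr_eq0 subr_eq0 eq_sym.
  by move: h; have := normr_ge0 (w i - z i); lia.
have PP : packing Omega P.
  split.
    move=> _ [z _ <-]; exists (fun x => x + \row_i ((z i)%:~R * T)); split.
      by move=> x y; rewrite opprD addrACA subrr addr0.
    apply/seteqP; split => [x zx|_ [x xO <-]].
      by exists (1 *: x + - \row_i ((z i)%:~R * T)) => //; rewrite scale1r subrK.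
    by rewrite /A /= scale1r addrK.
  by move=> _ _ [z _ <-] [w _ <-] [x [zx wx]]; rewrite (Adisj _ _ _ zx wx).
(* The density of the lattice packing: one copy per lattice cube of side [T]. *)
pose c := fine (vol Omega) / T ^+ n.
have c0 : 0 < c by rewrite divr_gt0 ?exprn_gt0// fine_gt0// O0 -ge0_fin_numE.
apply: (@lt_le_trans _ _ c%:E); first by rewrite lte_fin.
apply: (@le_trans _ _ (upper_density P (unit_cube p) p)); last first.
  apply: ereal_sup_ubound; exists (P, unit_cube p, p) => //; split => //.
  exact: unit_cube_gauge.
apply: le_ereal_inf_tmp => _ [V [M [_ MV]] <-].
(* A whole multiple of [T] beyond [M]: the cube of side [m * T] meets at least [m ^+ n] translates,
   so every neighbourhood of infinity contains a scale with density at least [c]. *)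
pose m := (Num.truncn (`|M| / T)).+1; pose s := m%:R * T.
have sM : M < s.
  apply: (le_lt_trans (ler_norm M)); rewrite /s -ltr_pdivrMr//; exact: truncnS_gt.
have s0 : 0 < s by rewrite mulr_gt0.
apply: (@le_trans _ _ (outer_density P (homothety p s (unit_cube p)))); last first.
  by apply: ereal_sup_ubound; exists s => //; exact: MV.
have [mG _ _ _] := unit_cube_gauge p.
have vG : vol (homothety p s (unit_cube p)) = (s ^+ n)%:E.
  rewrite vol_homothety// /unit_cube (@vol_rect _ _ _ (fun=> 1)).
  - by rewrite big1// mule1.
  - by move=> i; exact: measurable_itv.
  by move=> i; rewrite lebesgue_measure_itv/= lte_fin ltrDl ltr01 -EFinB addrAC subrr add0r.
rewrite /outer_density vG /=.
pose g (k : {ffun 'I_n -> 'I_m}) := A [ffun i => (k i : int)].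
have gi : injective g.
  move=> k k' h; have : g k (p + \row_i ((k i)%:R * T)).
    rewrite /g /A /= scale1r (_ : _ - _ = p)//; apply/rowP => i.
    by rewrite !mxE ffunE addrK.
  move=> kx; have := kx; rewrite h => /(Adisj _ _ _ kx)/ffunP e.
  by apply/ffunP => i; have := e i; rewrite !ffunE => -[/val_inj].
pose r := [seq g k | k : {ffun 'I_n -> 'I_m}].
have ur : uniq r by rewrite map_inj_uniq// enum_uniq.
have : ((m%:R ^+ n * fine (vol Omega))%:E <= \esum_(B in [set B | P B /\
    B `&` homothety p s (unit_cube p) !=set0]) vol B)%E.
  apply: ereal_sup_ubound; exists [set` r].
    split; first exact: finite_seq.
    move=> B /mapP[k _ ->]; split; first by exists [ffun i => (k i : int)].
    exists (p + \row_i ((k i)%:R * T)); split.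
      rewrite /g /A /= scale1r (_ : _ - _ = p)//; apply/rowP => i.
      by rewrite !mxE ffunE addrK.
    exists (p + s^-1 *: \row_i ((k i)%:R * T)).
      move=> i; rewrite /= in_itv/= !mxE lerDl lerD2l.
      have k0 : 0 <= (k i)%:R * T by rewrite mulr_ge0// ltW.
      have k1 : (k i)%:R * T <= s by rewrite /s ler_pM2r// ler_nat ltnW.
      apply/andP; split; first by rewrite mulr_ge0// invr_ge0 ltW.
      by rewrite mulrC ler_pdivrMr// mul1r.
    by rewrite addrAC subrr add0r scalerA divff ?scale1r// lt0r_neq0.
  rewrite -fsbig_seq// /r big_image/= (eq_bigr (fun=> (fine (vol Omega))%:E)).
    rewrite sumEFin; congr (_%:E).
    by rewrite sumr_const card_ffun !card_ord -[LHS]mulr_natl natrX.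
  by move=> k _; rewrite (fineK fO); exact: volA.
move=> h; apply: le_trans (lee_wpmul2l _ h); last by rewrite lee_fin invr_ge0 exprn_ge0// ltW.
rewrite -EFinM lee_fin /c /s exprMn le_eqVlt; apply/orP; left; apply/eqP.
have mn : (m%:R : R) ^+ n != 0 by rewrite expf_neq0// pnatr_eq0.
have Tn : T ^+ n != 0 by rewrite expf_neq0// lt0r_neq0.
by move: mn Tn; move: (fine _) (_ ^+ n) (T ^+ n) => a b d b0 d0; field; rewrite b0 d0.
Qed.

End packing_constant_bounds.

(** * The eigenvalue bound *)

Section eigenvalue_bound.
Context {R : realType} {n : nat} (Omega : set 'rV[R]_n).
Hypothesis cO : compact Omega.
Local Notation vol := (@lebesgue_rV R n).

Lemma weyl_functionE (lam : R) : 0 <= lam ->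
  weyl_function Omega lam = @weyl_density R n lam * fine (vol Omega).
Proof.
move=> lam0; rewrite /weyl_function /weyl_density [n%:R / 2]mulrC powRrM.
rewrite powR12_sqrt// powR_mulrn ?sqrtr_ge0//.
rewrite -/unit_ball; move: (fine _) (fine _) (_ ^+ n) (_ ^+ n) => a b c d; ring.
Qed.

Lemma weyl_density_ge0 (lam : R) : 0 <= @weyl_density R n lam.
Proof.
rewrite /weyl_density mulr_ge0 ?exprn_ge0 ?sqrtr_ge0//.
by rewrite divr_ge0 ?fine_ge0 ?exprn_ge0 ?mulr_ge0 ?pi_ge0.
Qed.

Lemma exprn_cont (k : nat) (f : R -> R) : continuous f ->
  continuous (fun t => f t ^+ k).
Proof.
move=> cf; elim: k => [|k IH].
  by under eq_fun do rewrite expr0; exact: cont_cst.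
by under eq_fun do rewrite exprS; exact: contM.
Qed.

(** For each [t > 0] the approximating functions at level [lam + t] bound the packing constant by
    [B t], and [B] is continuous at 0. The bound also makes the constant finite, so that its [fine]
    value is meaningful. *)
Lemma eigenfunctions_count (I : finType) (mu : I -> R) (u : I -> 'rV[R]_n -> R)
    (lam : R) : 0 <= lam ->
  (forall i, dirichlet_laplacian Omega (u i) (fun x => mu i * u i x)) ->
  (forall i0 (c : I -> R), (forall i, mu i != mu i0 -> c i = 0) ->
    {ae vol, forall x, Omega x -> \sum_i c i * u i x = 0} -> c i0 = 0) ->
  (forall i, mu i <= lam) ->
  #|I|%:R <= weyl_function Omega lam / fine (packing_constant Omega).
Proof.
move=> lam0 eig indep mul.
have mO := compact_measurable cO; have bO := compact_bounded cO.
have fO : vol Omega \is a fin_num by rewrite ge0_fin_numE// vol_bounded.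
rewrite weyl_functionE//.
have := measure_ge0 vol Omega; rewrite le_eqVlt => /orP[/eqP O0|O0]; last first.
  have pc0 := packing_constant_gt0 cO O0.
  (* [B] divides by [#|I|], so the empty family is settled beforehand. *)
  have [->|I0] := posnP #|I|.
    apply: divr_ge0; last by apply: fine_ge0; exact: ltW.
    by apply: mulr_ge0; [exact: weyl_density_ge0|exact: fine_ge0].
  have [D [D0 diam]] := compact_diameter cO.
  have Kn : (0 : R) < #|I|%:R by rewrite ltr0n.
  pose B t := @weyl_density R n (lam + t) * fine (vol Omega) / #|I|%:R *
     (1 + 2 * D * t) ^+ n * (1 + t).
  have pcB t : 0 < t -> (packing_constant Omega <= (B t)%:E)%E.
    move=> t0; have lt : lam < lam + t by rewrite ltrDl.
    have [phi [sphi pQ]] := spectral_approx cO eig indep mul lt.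
    apply: ge_ereal_sup => _ [[[P G] o] [/= PP GG] <-].
    have l0 : 0 <= lam + t by rewrite addr_ge0// ltW.
    exact: (upper_density_le o mO bO sphi pQ I0 l0 D0 diam PP GG t0).
  have pcfin : packing_constant Omega \is a fin_num.
    rewrite ge0_fin_numE ?(ltW pc0)//; apply: le_lt_trans (pcB 1 ltr01) _.
    exact: ltry.
  have d0 : 0 < fine (packing_constant Omega).
    by rewrite fine_gt0// pc0 -ge0_fin_numE// ltW.
  have cB : continuous B.
    apply: contM; last by apply: contD; [exact: cont_cst|move=> x; exact: cvg_id].
    apply: contM; last first.
      apply: exprn_cont; apply: contD; first exact: cont_cst.
      by apply: contM; [exact: cont_cst|move=> x; exact: cvg_id].
    apply: contM; last exact: cont_cst.
    apply: contM; last exact: cont_cst.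
    apply: contM; first exact: cont_cst.
    apply: exprn_cont => x; apply: (@continuous_comp _ _ _ (fun t => lam + t) Num.sqrt).
      by apply: contD; [exact: cont_cst|move=> y; exact: cvg_id].
    exact: sqrt_continuous.
  have B0 : B k.+1%:R^-1 @[k --> \oo] --> B 0.
    by apply: continuous_cvg; [exact: cB|exact: cvg_harmonic].
  have : fine (packing_constant Omega) <= B 0.
    rewrite -(cvg_lim _ B0)//; apply: limr_ge; first by apply/cvg_ex; eexists; exact: B0.
    apply: nearW => k; rewrite -lee_fin fineK//; apply: pcB.
    by rewrite invr_gt0.
  rewrite /B addr0 mulr0 addr0 expr1n !mulr1 ler_pdivlMr// ler_pdivlMr//.
  by rewrite mulrC.
have -> : fine (vol Omega) = 0 by rewrite -O0.
rewrite mulr0 mul0r.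
(* If [Omega] is null, the approximants vanish: the set where one is nonzero is open and contained
   in a null set. Positive definiteness then leaves no index. *)
have [->|I0] := posnP #|I|; first by [].
have lt : lam < lam + 1 by rewrite ltrDl.
have [phi [sphi pQ]] := spectral_approx cO eig indep mul lt.
have phi0 i x : phi i x = 0.
  apply/eqP/negPn/negP => px.
  pose U : set 'rV[R]_n := [set y | phi i y != 0].
  have oU : open U.
    apply: (@open_comp _ _ (phi i) [set t | t != 0]); last exact: open_neq.
    by move=> y _; have [sm _] := sphi i; exact: smooth_continuous sm y.
  have /lt_geF : (0 < vol U)%E by apply: vol_open_gt0 => //; exists x.
  rewrite [X in (_ <= X)%E]O0 le_measure ?inE//; first exact: measurable_open.
  move=> y Uy; apply: contrapT => yO; move: Uy.
  by rewrite /U/= (smooth_in_out (sphi i) yO) eqxx.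
have /card_gt0P[i _] := I0.
have := pQ (fun=> 1); rewrite /quad big1 ?ltxx => [|j _]; last first.
  rewrite big1// => k _.
  rewrite ip_disjoint; last by move=> x; rewrite phi0 mul0r.
  rewrite ip_disjoint; last by move=> x; rewrite phi0 mul0r.
  by rewrite mulr0 subr0 mulr0.
by move=> contra; suff : false by []; apply: contra; exists i; exact: oner_neq0.
Qed.

(** The last clause says that the supremum defining [multiplicity] is reached by this family. *)
Definition eigenspace_basis (mu : R) (z : {k : nat & 'I_k -> 'rV[R]_n -> R}) :=
  [/\ forall i, dirichlet_laplacian Omega (tagged z i) (fun x => mu * tagged z i x),
      L2_independent Omega (tagged z)
    & (multiplicity Omega mu <= (tag z)%:R%:E)%E].

(** [eigenfunctions_count] for a constant [mu] bounds the length of independent families, so one of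
    maximal length exists. *)
Lemma eigenspace_basis_exists (mu lam : R) : 0 <= lam -> mu <= lam ->
  exists z, eigenspace_basis mu z.
Proof.
move=> lam0 mul.
pose Q k := `[< exists u : 'I_k -> 'rV[R]_n -> R,
  (forall i, dirichlet_laplacian Omega (u i) (fun x => mu * u i x)) /\
  L2_independent Omega u >].
have Q0 : exists k, Q k.
  by exists 0%N; apply/asboolP; exists (fun _ _ => 0); split=> [[]//|c _ []].
set F := weyl_function Omega lam / fine (packing_constant Omega).
have QF k : Q k -> k%:R <= F.
  move=> /asboolP[u [eig ind]]; rewrite -[k]card_ord.
  apply: (@eigenfunctions_count _ (fun=> mu) u) => // i0 c _ ae0.
  exact: ind c ae0 i0.
have F0 : 0 <= F by have [k Qk] := Q0; apply: le_trans (QF k Qk).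
have Qb k : Q k -> (k <= Num.bound F)%N.
  move=> /QF kF; rewrite -(@ler_nat R); apply: le_trans kF _.
  by apply: ltW; exact: archi_boundP.
case: (ex_maxnP Q0 Qb) => k /asboolP[u [eig ind]] kmax.
exists (existT (fun k => 'I_k -> 'rV[R]_n -> R) k u); split => //.
apply: ge_ereal_sup => _ [j Qj <-]; rewrite lee_fin ler_nat; apply: kmax.
exact/asboolP.
Qed.

(** The sum over all real [mu] is a supremum over finite sets; for each finite set the eigenspace
    bases are put together and counted at once. *)
Lemma eigenvalue_count_le (lam : R) : 0 <= lam ->
  (eigenvalue_count Omega lam <=
   (weyl_function Omega lam / fine (packing_constant Omega))%:E)%E.
Proof.
move=> lam0.
have /choice[b bP] : forall mu, exists z, mu <= lam -> eigenspace_basis mu z.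
  move=> mu.
  have [mul|mul] := leP mu lam.
    by have [z zP] := eigenspace_basis_exists lam0 mul; exists z.
  (* An arbitrary value above [lam], where nothing is claimed. *)
  by exists (existT (fun k => 'I_k -> 'rV[R]_n -> R) 0%N (fun _ _ => 0)).
apply: ge_ereal_sup => _ [X [fX XS] <-].
rewrite fsbig_finite//=.
set s := finmap.enum_fset (fset_set X).
have su : uniq s by exact: finmap.fset_uniq.
have sl mu : mu \in s -> mu <= lam.
  by rewrite /s in_fset_set// inE => /XS.
pose I := {a : 'I_(size s) & 'I_(tag (b (nth 0 s a)))}.
pose pairI a j : I := existT _ a j.
pose mu (i : I) := nth 0 s (tag i).
pose u (i : I) : 'rV[R]_n -> R := tagged (b (mu i)) (tagged i).
have mul i : mu i <= lam by apply: sl; exact: mem_nth.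
apply: (@le_trans _ _ (#|{: I}|%:R%:E)); last first.
  rewrite lee_fin; apply: (@eigenfunctions_count _ mu u) => // [i|[a i] c c0 ae0].
    by have [eig _ _] := bP _ (mul i); exact: eig.
  have [_ ind _] := bP _ (mul (pairI a i)).
  apply: (ind (fun j => c (pairI _ j)) _ i).
  apply: filterS ae0 => x + Ox => /(_ Ox) sum0; apply: etrans sum0.
  transitivity (\sum_(a' : 'I_(size s)) \sum_(j : 'I_(tag (b (nth 0 s a'))))
      c (pairI a' j) * u (pairI a' j) x); last first.
    by rewrite sig_big_dep/=; apply: eq_bigr => -[].
  (* The entries of [s] are distinct, so [c] vanishes on every block other than that of [a]. *)
  rewrite [RHS](bigD1 a)//= [X in _ + X]big1 ?addr0// => a' a'a.
  by apply: big1 => j _; rewrite c0 ?mul0r// /mu/= nth_uniq.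
rewrite card_tagged sumnE big_map big_enum/=.
rewrite (big_nth 0) big_mkord natr_sum -sumEFin; apply: lee_sum => a _.
by rewrite card_ord; have [_ _] := bP _ (sl _ (mem_nth 0 (ltn_ord a))).
Qed.

End eigenvalue_bound.

Theorem mainTheorem5 (R : realType) (n : nat) (Omega : set 'rV[R]_n) :
  normal_domain Omega ->
  dirichlet_superspectral Omega
    (fun lambda => weyl_function Omega lambda / fine (packing_constant Omega)).
Proof. by move=> [cO _ _] lam; exact: eigenvalue_count_le. Qed.
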